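(* Under the standing setting: (a) If $f_0=\infty$ and $f_\infty\in(0,\infty)$, then there exist $\lambda^*\in(0,\infty)$ and $m^*\in(0,\infty]$ such that for every $\lambda\in(0,\lambda^* )$ problem (P$_\lambda$) has a positive solution $u(\lambda)$ with $\|u(\lambda)\|_\infty\in(0,m^* )$, these solutions can be chosen so that $\lim_{\lambda\to0^+}\|u(\lambda)\|_\infty=0$, and, if $m^*\in(0,\infty)$, problem (P$_{\lambda^*}$) has a positive solution. (b) If $f_0\in(0,\infty)$ and $f_\infty=\infty$, then there exist $\lambda^*\in(0,\infty)$ and $m^*\in[0,\infty)$ such that for every $\lambda\in(0,\lambda^* )$ problem (P$_\lambda$) has a positive solution $u(\lambda)$ with $\|u(\lambda)\|_\infty\in(m^*,\infty)$, these solutions can be chosen so that $\lim_{\lambda\to0^+}\|u(\lambda)\|_\infty=\infty$, and, if $m^*\in(0,\infty)$, problem (P$_{\lambda^*}$) has a positive solution.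
   Context: Standing setting. $\varphi:\mathbb{R}\to\mathbb{R}$ is an odd, increasing homeomorphism satisfying condition (A): there exist increasing homeomorphisms $\psi_1,\psi_2:[0,\infty)\to[0,\infty)$ such that $\varphi(x)\psi_1(y)\le \varphi(xy)\le \varphi(x)\psi_2(y)$ for all $x,y\ge 0$. Let $c,d\in C([0,1],(0,\infty))$, and $\|\cdot\|_\infty$ the maximum norm on $C[0,1]$. Let $f\in C([0,\infty),[0,\infty))$ with $f(s)>0$ for $s>0$, and write $f_0=\lim_{s\to0^+}f(s)/\varphi(s)$, $f_\infty=\lim_{s\to\infty}f(s)/\varphi(s)$ (assumed to exist in $[0,\infty]$ whenever referred to). Let $h\in C((0,1),[0,\infty))$, $h\not\equiv 0$, with $\int_0^{1/2}\psi_1^{-1}\big(\int_s^{1/2}h(\tau)d\tau\big)ds+\int_{1/2}^1\psi_1^{-1}\big(\int_{1/2}^s h(\tau)d\tau\big)ds<\infty$. Notation attached to $h$: $\alpha_h=\sup\{x\in(0,1): h=0 \text{ on }(0,x)\}$ ($0$ if empty); $\beta_h=\inf\{x\in(0,1): h=0\text{ on }(x,1)\}$ ($1$ if empty); $\bar\alpha_h=\sup\{x\in(\alpha_h,1]: h>0 \text{ on }(\alpha_h,x)\}$; $\bar\beta_h=\inf\{x\in[0,\beta_h): h>0\text{ on }(x,\beta_h)\}$; $\gamma_h^1=(3\alpha_h+\bar\alpha_h)/4$, $\gamma_h^2=(\bar\beta_h+3\beta_h)/4$. It is assumed that $0\le\alpha_h<\gamma_h^1<\gamma_h^2<\beta_h\le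 1$. For $\lambda\ge0$, problem (P$_\lambda$) is: $(d(t)\varphi(c(t)u'(t)))'+\lambda h(t)f(u(t))=0$ for $t\in(0,1)$, $u(0)=u(1)=0$. A solution is $u\in C[0,1]\cap C^1(0,1)$ such that $t\mapsto d(t)\varphi(c(t)u'(t))$ is continuously differentiable on $(0,1)$ and the equation and boundary conditions hold; it is positive if $u(t)>0$ for all $t\in(0,1)$. *)

(* Defs.v *)
From Stdlib Require Import Reals Lra ClassicalEpsilon.
Open Scope R_scope.

Definition cont_on_closed (g : R -> R) (a b : R) : Prop :=
  forall t, a <= t <= b -> forall eps, 0 < eps -> exists del, 0 < del /\
    forall s, a <= s <= b -> Rabs (s - t) < del -> Rabs (g s - g t) < eps.

Definition cont_on_nonneg (g : R -> R) : Prop :=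
  forall t, 0 <= t -> forall eps, 0 < eps -> exists del, 0 < del /\
    forall s, 0 <= s -> Rabs (s - t) < del -> Rabs (g s - g t) < eps.

Definition cont_on_open (g : R -> R) (a b : R) : Prop :=
  forall t, a < t < b -> continuity_pt g t.

Definition odd_inc_homeo (phi : R -> R) : Prop :=
  continuity phi /\
  (forall x y, x < y -> phi x < phi y) /\
  (forall y, exists x, phi x = y) /\
  (forall x, phi (- x) = - phi x).

Definition inc_homeo_nonneg (psi : R -> R) : Prop :=
  cont_on_nonneg psi /\
  (forall x, 0 <= x -> 0 <= psi x) /\
  (forall x y, 0 <= x -> x < y -> psi x < psi y) /\
  (forall y, 0 <= y -> exists x, 0 <= x /\ psi x = y).

Definition condA (phi psi1 psi2 : R -> R) : Prop :=
  inc_homeo_nonneg psi1 /\ inc_homeo_nonneg psi2 /\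
  forall x y, 0 <= x -> 0 <= y ->
    phi x * psi1 y <= phi (x * y) /\ phi (x * y) <= phi x * psi2 y.

Definition inv_nonneg (psi : R -> R) (y : R) : R :=
  match excluded_middle_informative (exists x, 0 <= x /\ psi x = y) with
  | left H => proj1_sig (constructive_indefinite_description _ H)
  | right _ => 0
  end.

(* Riemann integral of g from a to b (0 if g is not Riemann integrable) *)
Definition RInt (g : R -> R) (a b : R) : R :=
  match excluded_middle_informative (exists _ : Riemann_integrable g a b, True) with
  | left H => RiemannInt (proj1_sig (constructive_indefinite_description _ H))
  | right _ => 0
  end.

Definition sup_norm (u : R -> R) : R :=
  let E := fun y => exists t, 0 <= t <= 1 /\ y = Rabs (u t) in
  match excluded_middle_informative (exists m, is_lub E m) with
  | left H => proj1_sig (constructive_indefinite_description _ H)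
  | right _ => 0
  end.

Definition is_glb (E : R -> Prop) (m : R) : Prop :=
  (forall x, E x -> m <= x) /\ (forall m', (forall x, E x -> m' <= x) -> m' <= m).

Definition Aset (h : R -> R) (x : R) : Prop :=
  0 < x < 1 /\ forall t, 0 < t < x -> h t = 0.
Definition is_alpha (h : R -> R) (a : R) : Prop :=
  ((exists x, Aset h x) /\ is_lub (Aset h) a) \/ ((~ exists x, Aset h x) /\ a = 0).
Definition Bset (h : R -> R) (x : R) : Prop :=
  0 < x < 1 /\ forall t, x < t < 1 -> h t = 0.
Definition is_beta (h : R -> R) (b : R) : Prop :=
  ((exists x, Bset h x) /\ is_glb (Bset h) b) \/ ((~ exists x, Bset h x) /\ b = 1).
Definition Abarset (h : R -> R) (a x : R) : Prop :=
  a < x <= 1 /\ forall t, a < t < x -> 0 < h t.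
Definition is_alphabar (h : R -> R) (a ab : R) : Prop :=
  (exists x, Abarset h a x) /\ is_lub (Abarset h a) ab.
Definition Bbarset (h : R -> R) (b x : R) : Prop :=
  0 <= x < b /\ forall t, x < t < b -> 0 < h t.
Definition is_betabar (h : R -> R) (b bb : R) : Prop :=
  (exists x, Bbarset h b x) /\ is_glb (Bbarset h b) bb.

Definition h_ok (psi1 h : R -> R) : Prop :=
  cont_on_open h 0 1 /\
  (forall t, 0 < t < 1 -> 0 <= h t) /\
  (exists t, 0 < t < 1 /\ h t <> 0) /\
  (exists B, forall a, 0 < a <= 1/2 ->
     RInt (fun s => inv_nonneg psi1 (RInt h s (1/2))) a (1/2) <= B) /\
  (exists B, forall b, 1/2 <= b < 1 ->
     RInt (fun s => inv_nonneg psi1 (RInt h (1/2) s)) (1/2) b <= B) /\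
  (exists a b ab bb, is_alpha h a /\ is_beta h b /\ is_alphabar h a ab /\
     is_betabar h b bb /\
     0 <= a /\ a < (3 * a + ab) / 4 /\ (3 * a + ab) / 4 < (bb + 3 * b) / 4 /\
     (bb + 3 * b) / 4 < b /\ b <= 1).

Definition f_ok (f : R -> R) : Prop :=
  cont_on_nonneg f /\ (forall s, 0 <= s -> 0 <= f s) /\ (forall s, 0 < s -> 0 < f s).

Definition lim0_infty (f phi : R -> R) : Prop :=
  forall M, exists del, 0 < del /\ forall s, 0 < s < del -> M < f s / phi s.
Definition lim0_finite (f phi : R -> R) (L : R) : Prop :=
  forall eps, 0 < eps -> exists del, 0 < del /\
    forall s, 0 < s < del -> Rabs (f s / phi s - L) < eps.
Definition liminf_infty (f phi : R -> R) : Prop :=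
  forall M, exists N, forall s, N < s -> M < f s / phi s.
Definition liminf_finite (f phi : R -> R) (L : R) : Prop :=
  forall eps, 0 < eps -> exists N,
    forall s, N < s -> Rabs (f s / phi s - L) < eps.

Definition is_solution (phi c d h f : R -> R) (lam : R) (u : R -> R) : Prop :=
  cont_on_closed u 0 1 /\ u 0 = 0 /\ u 1 = 0 /\
  exists u' w' : R -> R,
    (forall t, 0 < t < 1 -> derivable_pt_lim u t (u' t)) /\
    cont_on_open u' 0 1 /\
    (forall t, 0 < t < 1 ->
       derivable_pt_lim (fun s => d s * phi (c s * u' s)) t (w' t)) /\
    cont_on_open w' 0 1 /\
    (forall t, 0 < t < 1 -> w' t + lam * h t * f (u t) = 0).

Definition is_pos_solution (phi c d h f : R -> R) (lam : R) (u : R -> R) : Prop :=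
  is_solution phi c d h f lam u /\ forall t, 0 < t < 1 -> 0 < u t.

(* Main.v *)
(* For fixed [lam], the problem is discretized on an odd number N of cells by an explicit Euler
   scheme for the pair (u, d phi(c u')), in which h is replaced by its infimum over
   neighbouring cells, so that the singularities of h at 0 and 1 never enter and Riemann sums
   are dominated by integrals. The scheme depends continuously on the initial value p of d
   phi(c u'), without any uniqueness for the initial value problem. If the maximum m of a
   discrete trajectory satisfies lam f <= kap phi(m) on [0, m] with kap small, the trajectory
   ends above 0, because it cannot fall by m; if lam f >= K phi on [rho m, m] with K large, it
   ends below 0, because otherwise it would be quasi-concave and would have to rise above m. In
   (a) the second alternative holds for small m and the first for large m, in (b) conversely,
   so the intermediate value theorem in p yields discrete solutions with norms between two
   prescribed bounds. An ultrafilter limit as N goes to infinity solves the equation: local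
   increments pass to the limit, and the integrability of psi1^-1 of the integral of h gives
   continuity at 0 and 1.

In (a) the bound on the norms can be made small with lam, in (b) large, so one may take m* = oo
in (a) and m* = 0 in (b). *)
From mathcomp Require filter.
Require Import Defs.
From Stdlib Require Import ZArith Reals Lra Lia ClassicalEpsilon.
From Coquelicot Require Import Coquelicot.
Open Scope R_scope.

(** * Ultrafilter limits *)

(** Condition (A) stands in for the homogeneity of a power: it turns a factor in front of [phi m]
    into a factor in front of [m], so that distances travelled are always compared with the same
    [m], and the constants kap and K depend on neither lam nor N. The coefficients c and d destroy
    the concavity of u. What remains is that w is nonincreasing; comparing the slopes on both sides
    of a point, again by (A), gives u(t) >= const t(1-t) max u. This estimate feeds the largeness
    argument and the nonnegativity of the discrete solutions; it survives the limit, where it gives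
    positivity and a lower bound of the norm up to a constant factor. The number of cells is odd so
    that 1/2 is the centre of a cell and time reversal exchanges the two halves exactly. The
    ultrafilter supplies limits at all real t at once, in place of compactness and subsequences. The
    admissible range of lam depends on the size demanded of the norm, whereas the theorem asks for
    one family of solutions; hence the final selection by almost extremal norm. *)

Record ultra (U : (nat -> Prop) -> Prop) : Prop := {
  ultra_ev : forall (P : nat -> Prop) n0, (forall n, (n0 <= n)%nat -> P n) -> U P;
  ultra_and : forall P Q : nat -> Prop, U P -> U Q -> U (fun n => P n /\ Q n);
  ultra_mono : forall P Q : nat -> Prop, (forall n, P n -> Q n) -> U P -> U Q;
  ultra_proper : forall P : nat -> Prop, U P -> exists n, P n;
  ultra_em : forall P : nat -> Prop, U P \/ U (fun n => ~ P n) }.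

Lemma exists_ultra : exists U, ultra U.
Proof.
  destruct (@filter.ultraFilterLemma nat filter.eventually filter.eventually_filter)
    as [U [HU Hsub]].
  pose proof (@filter.ultra_proper _ _ HU) as [Hne HF].
  exists U; split.
  - intros P n0 HP. apply Hsub. exists n0; [exact I|]. intros n Hn. apply HP.
    apply (ssrbool.elimT ssrnat.leP Hn).
  - intros P Q. apply (@filter.filterI _ _ HF).
  - intros P Q HPQ. apply (@filter.filterS _ _ HF P Q). exact HPQ.
  - intros P HP. apply NNPP. intros Hno. apply Hne.
    apply (@filter.filterS _ _ HF P); [|exact HP].
    intros n Hn. exfalso. apply Hno. now exists n.
  - intros P. exact (@filter.in_ultra_setVsetC _ U P HU).
Qed.

(** The limit is the supremum of the [y] that lie below [x n] for [U]-almost all [n]; since of two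
    complementary sets one belongs to [U], both one-sided estimates hold almost everywhere. *)
Lemma ultra_lim (U : (nat -> Prop) -> Prop) (x : nat -> R) (B : R) :
  ultra U -> U (fun n => Rabs (x n) <= B) ->
  exists l, forall eps, 0 < eps -> U (fun n => Rabs (x n - l) < eps).
Proof.
  intros HU HB.
  destruct (completeness (fun y => U (fun n => y <= x n))) as [l [Hub Hlub]].
  - exists B. intros y Hy.
    destruct (ultra_proper U HU _ (ultra_and U HU _ _ HB Hy)) as [n [H1 H2]].
    pose proof (Rle_abs (x n)); lra.
  - exists (- B). apply (ultra_mono U HU _ _) with (2 := HB). intros n Hn.
    pose proof (Rle_abs (- x n)). rewrite Rabs_Ropp in H. lra.
  - exists l. intros eps Heps.
    assert (H1 : U (fun n => ~ (l + eps <= x n))).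
    { destruct (ultra_em U HU (fun n => l + eps <= x n)) as [H|H]; [|exact H].
      specialize (Hub _ H). lra. }
    assert (H2 : U (fun n => l - eps / 2 <= x n)).
    { destruct (ultra_em U HU (fun n => l - eps / 2 <= x n)) as [H|H]; [exact H|].
      exfalso. assert (l <= l - eps / 2); [|lra]. apply Hlub. intros y Hy.
      destruct (Rle_or_lt y (l - eps / 2)) as [|Hlt]; [assumption|].
      destruct (ultra_proper U HU _ (ultra_and U HU _ _ H Hy)) as [n [H3 H4]].
      exfalso; apply H3; lra. }
    apply (ultra_mono U HU) with (2 := ultra_and U HU _ _ H1 H2).
    intros n [H3 H4]. apply Rabs_def1; lra.
Qed.

(** * The inverses of phi and psi1 *)

Lemma choice_fun {A B : Type} (Q : A -> B -> Prop) :
  (forall x, exists y, Q x y) -> exists f, forall x, Q x (f x).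
Proof.
  intros H. exists (fun x => proj1_sig (constructive_indefinite_description _ (H x))).
  intros x. exact (proj2_sig (constructive_indefinite_description _ (H x))).
Qed.

Lemma Rdiv_le_iff (x y z : R) : 0 < z -> (x <= y / z <-> x * z <= y).
Proof.
  intros Hz. split; intros H.
  - apply Rmult_le_compat_r with (r := z) in H; [|lra].
    replace (y / z * z) with y in H by (field; lra). exact H.
  - apply Rmult_le_reg_r with z; [exact Hz|].
    replace (y / z * z) with y by (field; lra). exact H.
Qed.

Lemma Rle_div_iff (x y z : R) : 0 < z -> (y / z <= x <-> y <= x * z).
Proof.
  intros Hz. split; intros H.
  - apply Rmult_le_compat_r with (r := z) in H; [|lra].
    replace (y / z * z) with y in H by (field; lra). exact H.
  - apply Rmult_le_reg_r with z; [exact Hz|].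
    replace (y / z * z) with y by (field; lra). exact H.
Qed.

(** [q] is the inverse of [phi], [Psi] that of [psi1] extended by 0 to negative arguments. The last
    three fields are condition (A) read through [q], the form in which slopes are compared. *)
Record phi_inverse (phi psi1 psi2 q Psi : R -> R) : Prop := {
  phi_lt : forall x y, x < y -> phi x < phi y;
  phi_0 : phi 0 = 0;
  phi_q : forall y, phi (q y) = y;
  q_phi : forall x, q (phi x) = x;
  q_lt : forall x y, x < y -> q x < q y;
  q_opp : forall y, q (- y) = - q y;
  q_cont : continuity q;
  psi1_pos : forall x, 0 < x -> 0 < psi1 x;
  psi2_pos : forall x, 0 < x -> 0 < psi2 x;
  psi2_onto : forall y, 0 <= y -> exists x, 0 <= x /\ psi2 x = y;
  phi_ge : forall x y, 0 <= x -> 0 <= y -> phi x * psi1 y <= phi (x * y);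
  Psi_ge0 : forall y, 0 <= Psi y;
  Psi_le : forall x y, x <= y -> Psi x <= Psi y;
  Psi_cont : continuity Psi;
  q_phi_mul : forall m y, 0 <= m -> 0 <= y -> q (phi m * y) <= m * Psi y;
  q_psi1 : forall s y, 0 <= s -> 0 <= y -> q (psi1 s * y) <= s * q y;
  q_psi2 : forall s y, 0 <= s -> 0 <= y -> s * q y <= q (psi2 s * y) }.

(** * Inverse of a homeomorphism of the half-line, extended to the line *)

Lemma homeo_0 (psi : R -> R) : inc_homeo_nonneg psi -> psi 0 = 0.
Proof.
  intros (_ & Hpos & Hinc & Honto).
  destruct (Honto 0 (Rle_refl 0)) as [x [Hx Ex]].
  destruct (Rle_lt_or_eq_dec 0 x Hx) as [H|<-]; [|exact Ex].
  specialize (Hinc 0 x (Rle_refl 0) H). specialize (Hpos 0 (Rle_refl 0)). lra.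
Qed.

Section InverseOnHalfLine.
Variable psi : R -> R.
Hypothesis Hpsi : inc_homeo_nonneg psi.

Lemma inv_nonneg_spec y : 0 <= y -> 0 <= inv_nonneg psi y /\ psi (inv_nonneg psi y) = y.
Proof.
  intros Hy. unfold inv_nonneg.
  destruct (excluded_middle_informative _) as [H|H].
  - exact (proj2_sig (constructive_indefinite_description _ H)).
  - exfalso. apply H. apply Hpsi. exact Hy.
Qed.

(** The default value 0 of [inv_nonneg] agrees with the value at 0, so the inverse is monotone and
    continuous on the whole line. *)
Lemma inv_nonneg_neg y : y <= 0 -> inv_nonneg psi y = 0.
Proof.
  intros Hy. destruct (Req_dec y 0) as [->|Hne].
  - destruct (inv_nonneg_spec 0 (Rle_refl 0)) as [H1 H2].
    destruct (Rle_lt_or_eq_dec _ _ H1) as [H|H]; [|now symmetry].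
    destruct Hpsi as (_ & _ & Hinc & _).
    specialize (Hinc _ _ (Rle_refl 0) H). rewrite (homeo_0 _ Hpsi) in Hinc. lra.
  - unfold inv_nonneg.
    destruct (excluded_middle_informative _) as [[x [H1 H2]]|H]; [|reflexivity].
    exfalso. destruct Hpsi as (_ & Hpos & _). specialize (Hpos x H1). lra.
Qed.

Lemma inv_nonneg_ge0 y : 0 <= inv_nonneg psi y.
Proof.
  destruct (Rle_or_lt y 0) as [H|H].
  - rewrite inv_nonneg_neg; lra.
  - apply inv_nonneg_spec. lra.
Qed.

Lemma inv_nonneg_lt_iff x y : 0 <= x -> 0 <= y -> (inv_nonneg psi y < x <-> y < psi x).
Proof.
  intros Hx Hy. destruct (inv_nonneg_spec y Hy) as [H1 H2].
  destruct Hpsi as (_ & _ & Hinc & _). split; intros H.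
  - rewrite <- H2. now apply Hinc.
  - apply Rnot_le_lt. intros Hle.
    destruct (Rle_lt_or_eq_dec _ _ Hle) as [H'|H'].
    + specialize (Hinc _ _ Hx H'). lra.
    + subst x. lra.
Qed.

Lemma inv_nonneg_le x y : x <= y -> inv_nonneg psi x <= inv_nonneg psi y.
Proof.
  intros Hxy. destruct (Rle_or_lt x 0) as [H|H].
  - rewrite (inv_nonneg_neg x H). apply inv_nonneg_ge0.
  - apply Rnot_lt_le. intros Hlt.
    apply inv_nonneg_lt_iff in Hlt; [|apply inv_nonneg_ge0|lra].
    destruct (inv_nonneg_spec x) as [_ E]; lra.
Qed.

Lemma inv_nonneg_cont : continuity (inv_nonneg psi).
Proof.
  intros y eps Heps.
  destruct Hpsi as (_ & Hpos & Hinc & Honto).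
  set (x := inv_nonneg psi y).
  assert (Hx : 0 <= x) by apply inv_nonneg_ge0.
  assert (Hup : exists z, y < z /\ inv_nonneg psi z < x + eps).
  { assert (Hyz : y < psi (x + eps)).
    { destruct (Rle_or_lt 0 y) as [H|H].
      - apply inv_nonneg_lt_iff; [lra|exact H|]. fold x; lra.
      - specialize (Hpos (x + eps)). lra. }
    (* The first entry lies strictly between [y] and [psi (x + eps)]; the second keeps the witness
       nonnegative when [y] is negative. *)
    exists (Rmax ((y + psi (x + eps)) / 2) (psi (x + eps) / 2)).
    assert (0 < psi (x + eps)).
    { assert (0 <= psi 0) by (apply Hpos; lra).
      assert (psi 0 < psi (x + eps)) by (apply Hinc; lra). lra. }
    pose proof (Rmax_l ((y + psi (x + eps)) / 2) (psi (x + eps) / 2)).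
    pose proof (Rmax_r ((y + psi (x + eps)) / 2) (psi (x + eps) / 2)).
    split; [lra|]. apply inv_nonneg_lt_iff; [lra|lra|].
    apply Rmax_lub_lt; lra. }
  assert (Hdown : exists z, z < y /\ x - eps < inv_nonneg psi z).
  { destruct (Rle_or_lt x (eps / 2)) as [H|H].
    - exists (y - 1). pose proof (inv_nonneg_ge0 (y - 1)). lra.
    - assert (Hy : 0 < y).
      { apply Rnot_le_lt. intros H'. apply inv_nonneg_neg in H'. fold x in H'. lra. }
      exists (psi (x - eps / 2)). split.
      + apply Rnot_le_lt. intros H'.
        destruct (inv_nonneg_spec y) as [_ E]; [lra|]. fold x in E.
        assert (psi (x - eps / 2) < psi x) by (apply Hinc; lra). lra.
      + apply Rnot_le_lt. intros H'.
        assert (H2 : inv_nonneg psi (psi (x - eps / 2)) < x - eps / 2) by lra.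
        apply inv_nonneg_lt_iff in H2; [lra|lra|]. apply Hpos; lra. }
  destruct Hup as [z1 [Hz1 Hz1']]. destruct Hdown as [z2 [Hz2 Hz2']].
  exists (Rmin (z1 - y) (y - z2)). split; [apply Rmin_pos; lra|].
  intros s [_ Hs]. simpl in *. unfold R_dist in *.
  pose proof (Rmin_l (z1 - y) (y - z2)). pose proof (Rmin_r (z1 - y) (y - z2)).
  apply Rabs_def2 in Hs. fold x.
  assert (inv_nonneg psi s <= inv_nonneg psi z1) by (apply inv_nonneg_le; lra).
  assert (inv_nonneg psi z2 <= inv_nonneg psi s) by (apply inv_nonneg_le; lra).
  apply Rabs_def1; lra.
Qed.

End InverseOnHalfLine.

Lemma phi_inverse_exists (phi psi1 psi2 : R -> R) :
  odd_inc_homeo phi -> condA phi psi1 psi2 ->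
  exists q, phi_inverse phi psi1 psi2 q (inv_nonneg psi1).
Proof.
  intros (Hcont & Hinc & Honto & Hodd) (H1 & H2 & HA).
  destruct (choice_fun (fun y x => phi x = y) Honto) as [q Hpq].
  assert (Hlt : forall x y, phi x < phi y -> x < y).
  { intros x y H. apply Rnot_le_lt. intros [Hl| ->]; [|lra].
    specialize (Hinc _ _ Hl). lra. }
  assert (Hinj : forall x y, phi x = phi y -> x = y).
  { intros x y H. destruct (Rtotal_order x y) as [Hl|[He|Hl]]; [|exact He|];
      specialize (Hinc _ _ Hl); lra. }
  assert (Hp0 : phi 0 = 0).
  { specialize (Hodd 0). rewrite Ropp_0 in Hodd. lra. }
  assert (Hle : forall x y, phi x <= phi y -> x <= y).
  { intros x y [H|H]; [left; now apply Hlt|right; now apply Hinj]. }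
  assert (Hq0 : forall y, 0 <= y -> 0 <= q y).
  { intros y Hy. apply Hle. rewrite Hpq, Hp0. exact Hy. }
  assert (Hqlt : forall x y, x < y -> q x < q y).
  { intros x y H. apply Hlt. now rewrite !Hpq. }
  assert (Hpos : forall psi, inc_homeo_nonneg psi -> forall x, 0 < x -> 0 < psi x).
  { intros psi Hpsi x Hx. rewrite <- (homeo_0 _ Hpsi).
    destruct Hpsi as (_ & _ & Hi & _). apply Hi; lra. }
  exists q. split.
  - exact Hinc.
  - exact Hp0.
  - exact Hpq.
  - intros x. apply Hinj. apply Hpq.
  - exact Hqlt.
  - intros y. apply Hinj. now rewrite Hodd, !Hpq.
  - intros y eps Heps.
    exists (Rmin (phi (q y + eps) - y) (y - phi (q y - eps))).
    assert (Ha : phi (q y) < phi (q y + eps)) by (apply Hinc; lra).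
    assert (Hb : phi (q y - eps) < phi (q y)) by (apply Hinc; lra).
    rewrite Hpq in Ha, Hb.
    split; [apply Rmin_pos; lra|]. intros s [_ Hs]. simpl in *. unfold R_dist in *.
    pose proof (Rmin_l (phi (q y + eps) - y) (y - phi (q y - eps))).
    pose proof (Rmin_r (phi (q y + eps) - y) (y - phi (q y - eps))).
    apply Rabs_def2 in Hs.
    assert (q s < q y + eps) by (apply Hlt; rewrite Hpq; lra).
    assert (q y - eps < q s) by (apply Hlt; rewrite Hpq; lra).
    apply Rabs_def1; lra.
  - now apply Hpos.
  - now apply Hpos.
  - apply H2.
  - intros x y Hx Hy. now apply HA.
  - now apply inv_nonneg_ge0.
  - now apply inv_nonneg_le.
  - now apply inv_nonneg_cont.
  - intros m y Hm Hy. destruct (inv_nonneg_spec psi1 H1 y Hy) as [Ha Hb].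
    apply Hle. rewrite Hpq. rewrite <- Hb at 1. now apply HA.
  - intros s y Hs Hy. apply Hle. rewrite Hpq. rewrite <- (Hpq y) at 1.
    rewrite Rmult_comm, (Rmult_comm s). apply HA; [now apply Hq0|exact Hs].
  - intros s y Hs Hy. apply Hle. rewrite Hpq. rewrite <- (Hpq y) at 2.
    rewrite Rmult_comm, (Rmult_comm (psi2 s)). apply HA; [now apply Hq0|exact Hs].
Qed.

(** * Integral bounds near an endpoint *)

(* [H] stands for the integral of [h] from 1/2 and [P] for the integral of [Psi \o H], extended
   to 1 by its supremum; only these lower Riemann sum bounds are used. *)
Record right_weight (Psi h H P : R -> R) : Prop := {
  rw_0 : H (1/2) = 0;
  rw_H : forall s t eta, 1/2 <= s <= t -> t < 1 ->
    (forall x, s <= x <= t -> eta <= h x) -> (t - s) * eta <= H t - H s;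
  rw_P : forall s t, 1/2 <= s <= t -> t <= 1 -> (t - s) * Psi (H s) <= P t - P s;
  rw_tail : forall eps, 0 < eps -> exists b, 1/2 <= b < 1 /\ P 1 - P b <= eps }.

Lemma Defs_RInt_eq (g : R -> R) a b : ex_RInt g a b -> Defs.RInt g a b = RInt g a b.
Proof.
  intros Hex. unfold Defs.RInt. destruct (excluded_middle_informative _) as [H|H].
  - apply eq_sym, RInt_Reals.
  - exfalso. apply H. exists (ex_RInt_Reals_0 _ _ _ Hex). exact I.
Qed.

Lemma ex_RInt_cont_open (g : R -> R) a b :
  cont_on_open g 0 1 -> 0 < a < 1 -> 0 < b < 1 -> ex_RInt g a b.
Proof.
  intros Hg Ha Hb. apply (ex_RInt_continuous (V := R_CompleteNormedModule)). intros z Hz.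
  apply continuity_pt_filterlim, Hg.
  revert Hz. unfold Rmin, Rmax. destruct (Rle_dec a b); lra.
Qed.

Lemma RInt_cont_open (g : R -> R) a t :
  cont_on_open g 0 1 -> 0 < a < 1 -> 0 < t < 1 -> continuity_pt (fun x => RInt g a x) t.
Proof.
  intros Hg Ha Ht. apply continuity_pt_filterlim.
  apply (continuous_RInt_1 (V := R_NormedModule) g a t (fun x => RInt g a x)).
  assert (Hp : 0 < Rmin t (1 - t)) by (apply Rmin_pos; lra).
  exists (mkposreal _ Hp). intros y Hy.
  unfold ball in Hy; simpl in Hy. unfold AbsRing_ball, abs, minus, plus, opp in Hy; simpl in Hy.
  pose proof (Rmin_l t (1 - t)). pose proof (Rmin_r t (1 - t)).
  apply Rabs_def2 in Hy.
  apply (RInt_correct (V := R_CompleteNormedModule)). apply ex_RInt_cont_open; [exact Hg|exact Ha|lra].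
Qed.

Lemma RInt_ge_const (g : R -> R) a b eta :
  a <= b -> ex_RInt g a b -> (forall x, a <= x <= b -> eta <= g x) ->
  (b - a) * eta <= RInt g a b.
Proof.
  intros Hab Hex Hge.
  replace ((b - a) * eta) with (RInt (fun _ => eta) a b)
    by (rewrite RInt_const; reflexivity).
  apply RInt_le; [exact Hab|apply ex_RInt_const|exact Hex|].
  intros x Hx. apply Hge. lra.
Qed.

(** [P] is the integral [G] below 1 and the supremum of [G] at 1. As [h] is nonnegative, [Psi] of
    [H] is nondecreasing, so left endpoint Riemann sums stay below the integral, whatever the growth
    at 1. *)
Lemma right_weight_of_bound (Psi h H : R -> R) (B : R) :
  (forall x y, x <= y -> Psi x <= Psi y) -> (forall y, 0 <= Psi y) ->
  continuity Psi -> cont_on_open H 0 1 ->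
  (forall t, 0 < t < 1 -> 0 <= h t) -> H (1/2) = 0 ->
  (forall s t eta, 1/2 <= s <= t -> t < 1 ->
    (forall x, s <= x <= t -> eta <= h x) -> (t - s) * eta <= H t - H s) ->
  (forall b, 1/2 <= b < 1 -> RInt (fun s => Psi (H s)) (1/2) b <= B) ->
  exists P, right_weight Psi h H P.
Proof.
  intros Hmon Hpos Hcont HH Hh H0 HHh HB.
  set (G := fun b => RInt (fun s => Psi (H s)) (1/2) b).
  assert (HPH : cont_on_open (fun s => Psi (H s)) 0 1).
  { intros t Ht. apply (continuity_pt_comp H Psi); [now apply HH|apply Hcont]. }
  assert (HG : forall s t, 1/2 <= s <= t -> t < 1 -> (t - s) * Psi (H s) <= G t - G s).
  { intros s t Hst Ht.
    assert (E : G t = G s + RInt (fun s => Psi (H s)) s t).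
    { unfold G. rewrite <- (RInt_Chasles (V := R_CompleteNormedModule)  _ (1/2) s t); [reflexivity| |];
        apply ex_RInt_cont_open; (exact HPH || lra). }
    rewrite E.
    assert ((t - s) * Psi (H s) <= RInt (fun s => Psi (H s)) s t); [|lra].
    apply RInt_ge_const; [lra|apply ex_RInt_cont_open; (exact HPH || lra)|].
    intros x Hx. apply Hmon.
    assert ((x - s) * 0 <= H x - H s); [|lra].
    apply HHh; [lra|lra|]. intros y Hy. apply Hh. lra. }
  destruct (completeness (fun y => exists b, 1/2 <= b < 1 /\ y = G b)) as [S [Hub Hlub]].
  - exists B. intros y [b [Hb ->]]. now apply HB.
  - exists (G (1/2)). exists (1/2). split; [lra|reflexivity].
  - exists (fun t => if Rlt_dec t 1 then G t else S). split.
    + exact H0.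
    + exact HHh.
    + intros s t Hst Ht. destruct (Rlt_dec t 1) as [Hlt|Hge].
      * destruct (Rlt_dec s 1); [|lra]. now apply HG.
      * assert (t = 1) as -> by lra.
        destruct (Rlt_dec s 1) as [Hs|Hs]; [|replace s with 1 by lra; lra].
        pose proof (Hpos (H s)) as Hp.
        assert (Hall : forall x, s <= x < 1 -> (x - s) * Psi (H s) <= S - G s).
        { intros x Hx. assert (G x <= S) by (apply Hub; exists x; split; [lra|reflexivity]).
          specialize (HG s x). lra. }
        apply Rnot_lt_le. intros Hc.
        pose proof (Hall s ltac:(lra)) as Hs0.
        destruct (Rle_lt_or_eq_dec _ _ Hp) as [Hp'|Hp']; [|rewrite <- Hp' in Hc; lra].
        (* [Hall] is used close to 1: this [x] makes its left side the mean of [S - G s] and the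
           supposedly larger [(1 - s) * Psi (H s)], hence larger than [S - G s]. *)
        set (x := s + (S - G s + (1 - s) * Psi (H s)) / (2 * Psi (H s))).
        assert (Ex : (x - s) * Psi (H s) = (S - G s + (1 - s) * Psi (H s)) / 2)
          by (unfold x; field; lra).
        assert (s <= x < 1).
        { split; apply Rnot_lt_le || apply Rnot_le_lt; intros Hx; nra. }
        specialize (Hall x ltac:(assumption)). lra.
    + intros eps Heps.
      destruct (classic (exists b, 1/2 <= b < 1 /\ S - eps < G b)) as [[b [Hb Hb']]|Hno].
      * exists b. split; [exact Hb|]. destruct (Rlt_dec 1 1); [lra|].
        destruct (Rlt_dec b 1); lra.
      * exfalso. assert (S <= S - eps); [|lra]. apply Hlub.
        intros y [b [Hb ->]]. apply Rnot_lt_le. intros Hlt. apply Hno. now exists b.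
Qed.

Lemma right_weight_right (Psi h : R -> R) :
  (forall x y, x <= y -> Psi x <= Psi y) -> (forall y, 0 <= Psi y) -> continuity Psi ->
  cont_on_open h 0 1 -> (forall t, 0 < t < 1 -> 0 <= h t) ->
  (exists B, forall b, 1/2 <= b < 1 ->
     Defs.RInt (fun s => Psi (Defs.RInt h (1/2) s)) (1/2) b <= B) ->
  exists H P, right_weight Psi h H P.
Proof.
  intros Hmon Hpos Hcont Hc Hh [B HB].
  exists (fun t => RInt h (1/2) t).
  assert (HH : cont_on_open (fun t => RInt h (1/2) t) 0 1).
  { intros t Ht. apply RInt_cont_open; [exact Hc|lra|exact Ht]. }
  apply (right_weight_of_bound Psi h (fun t => RInt h (1/2) t) B); try assumption.
  - apply (RInt_point (V := R_CompleteNormedModule)).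
  - intros s t eta Hst Ht Heta.
    rewrite <- (RInt_Chasles (V := R_CompleteNormedModule) h (1/2) s t);
      [|apply ex_RInt_cont_open; (assumption || lra)..].
    unfold plus; simpl.
    assert ((t - s) * eta <= RInt h s t); [|lra].
    apply RInt_ge_const; [lra|apply ex_RInt_cont_open; (assumption || lra)|exact Heta].
  - intros b Hb.
    assert (Eq : forall x, Rmin (1/2) b < x < Rmax (1/2) b ->
      Psi (RInt h (1/2) x) = Psi (Defs.RInt h (1/2) x)).
    { intros x. rewrite Rmin_left, Rmax_right by lra. intros Hx.
      rewrite Defs_RInt_eq; [reflexivity|]. apply ex_RInt_cont_open; (assumption || lra). }
    assert (Hex : ex_RInt (fun s => Psi (RInt h (1/2) s)) (1/2) b).
    { apply ex_RInt_cont_open; [|lra|lra]. intros t Ht.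
      apply (continuity_pt_comp (fun t => RInt h (1/2) t) Psi); [now apply HH|apply Hcont]. }
    rewrite (RInt_ext _ _ _ _ Eq). rewrite <- Defs_RInt_eq; [now apply HB|].
    apply (ex_RInt_ext _ _ _ _ Eq Hex).
Qed.

Lemma right_weight_left (Psi h : R -> R) :
  (forall x y, x <= y -> Psi x <= Psi y) -> (forall y, 0 <= Psi y) -> continuity Psi ->
  cont_on_open h 0 1 -> (forall t, 0 < t < 1 -> 0 <= h t) ->
  (exists B, forall a, 0 < a <= 1/2 ->
     Defs.RInt (fun s => Psi (Defs.RInt h s (1/2))) a (1/2) <= B) ->
  exists H P, right_weight Psi (fun t => h (1 - t)) H P.
Proof.
  intros Hmon Hpos Hcont Hc Hh [B HB].
  exists (fun t => RInt h (1 - t) (1/2)).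
  assert (HF : cont_on_open (fun t => RInt h t (1/2)) 0 1).
  { intros t Ht. apply continuity_pt_filterlim.
    apply (continuous_RInt_2 (V := R_NormedModule) h t (1/2) (fun x => RInt h x (1/2))).
    assert (Hp : 0 < Rmin t (1 - t)) by (apply Rmin_pos; lra).
    exists (mkposreal _ Hp). intros y Hy.
    unfold ball in Hy; simpl in Hy. unfold AbsRing_ball, abs, minus, plus, opp in Hy; simpl in Hy.
    pose proof (Rmin_l t (1 - t)). pose proof (Rmin_r t (1 - t)).
    apply Rabs_def2 in Hy.
    apply (RInt_correct (V := R_CompleteNormedModule)). apply ex_RInt_cont_open; [exact Hc|lra|lra]. }
  assert (HH : cont_on_open (fun t => RInt h (1 - t) (1/2)) 0 1).
  { intros t Ht. apply (continuity_pt_comp (fun t => 1 - t) (fun t => RInt h t (1/2))).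
    - reg.
    - apply HF. lra. }
  apply (right_weight_of_bound Psi _ (fun t => RInt h (1 - t) (1/2)) B); try assumption.
  - intros t Ht. apply Hh. lra.
  - replace (1 - 1/2) with (1/2) by lra. apply (RInt_point (V := R_CompleteNormedModule)).
  - intros s t eta Hst Ht Heta.
    rewrite <- (RInt_Chasles (V := R_CompleteNormedModule) h (1 - t) (1 - s) (1/2));
      [|apply ex_RInt_cont_open; (assumption || lra)..].
    unfold plus; simpl.
    assert ((1 - s - (1 - t)) * eta <= RInt h (1 - t) (1 - s)); [|lra].
    apply RInt_ge_const; [lra|apply ex_RInt_cont_open; (assumption || lra)|].
    intros x Hx. replace x with (1 - (1 - x)) by lra. apply Heta. lra.
  - intros b Hb.
    assert (Eq : forall x, Rmin (1 - b) (1/2) < x < Rmax (1 - b) (1/2) ->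
      Psi (RInt h x (1/2)) = Psi (Defs.RInt h x (1/2))).
    { intros x. rewrite Rmin_left, Rmax_right by lra. intros Hx.
      rewrite Defs_RInt_eq; [reflexivity|]. apply ex_RInt_cont_open; (assumption || lra). }
    assert (HPF : cont_on_open (fun t => Psi (RInt h t (1/2))) 0 1).
    { intros t Ht.
      apply (continuity_pt_comp (fun t => RInt h t (1/2)) Psi); [now apply HF|apply Hcont]. }
    assert (Hex : ex_RInt (fun s => Psi (RInt h s (1/2))) (1 - b) (1/2))
      by (apply ex_RInt_cont_open; [exact HPF|lra|lra]).
    (* The substitution of [1 - s] for [s] carries the bound near 0 over to the reflected weight
       near 1. *)
    assert (E : RInt (fun s => Psi (RInt h (1 - s) (1/2))) (1/2) b
                = RInt (fun s => Psi (RInt h s (1/2))) (1 - b) (1/2)).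
    { rewrite <- (opp_RInt_swap (V := R_CompleteNormedModule) _ (1/2) (1 - b))
        by now apply ex_RInt_swap.
      pose proof (RInt_comp_lin (V := R_CompleteNormedModule)
        (fun s => Psi (RInt h s (1/2))) (-1) 1 (1/2) b) as E.
      replace (-1 * (1/2) + 1) with (1/2) in E by lra.
      replace (-1 * b + 1) with (1 - b) in E by lra.
      rewrite <- E by (now apply ex_RInt_swap). clear E.
      rewrite <- (RInt_opp (V := R_CompleteNormedModule)).
      - apply RInt_ext. intros x _. unfold scal, opp; simpl. unfold mult; simpl.
        replace (-1 * x + 1) with (1 - x) by ring. ring.
      - apply (ex_RInt_comp_lin (V := R_CompleteNormedModule)
          (fun s => Psi (RInt h s (1/2))) (-1) 1 (1/2) b).
        replace (-1 * (1/2) + 1) with (1/2) by lra.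
        replace (-1 * b + 1) with (1 - b) by lra. now apply ex_RInt_swap. }
    rewrite E, (RInt_ext _ _ _ _ Eq). rewrite <- Defs_RInt_eq; [apply HB; lra|].
    apply (ex_RInt_ext _ _ _ _ Eq Hex).
Qed.

(** * The discrete scheme *)

(** This comparison of increments replaces integration: [y] will mostly be a multiple of [grid], or
    [P] along the grid. *)
Lemma telescope_le (x y : nat -> R) (i j : nat) : (i <= j)%nat ->
  (forall k, (i <= k < j)%nat -> x (S k) - x k <= y (S k) - y k) -> x j - x i <= y j - y i.
Proof.
  intros Hij. induction Hij as [|j Hij IH]; intros H; [lra|].
  assert (x j - x i <= y j - y i) by (apply IH; intros k Hk; apply H; lia).
  specialize (H j ltac:(lia)). lra.
Qed.

Definition grid (N k : nat) : R := INR k / INR N.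

Lemma grid_S N k : grid N (S k) = grid N k + / INR N.
Proof. unfold grid. rewrite S_INR. unfold Rdiv. ring. Qed.

Lemma grid_le N i j : (0 < N)%nat -> (i <= j)%nat -> grid N i <= grid N j.
Proof.
  intros HN Hij. apply lt_INR in HN. apply le_INR in Hij. simpl in HN. unfold grid, Rdiv.
  apply Rmult_le_compat_r; [|exact Hij]. left. now apply Rinv_0_lt_compat.
Qed.

Lemma grid_0 N : grid N 0 = 0.
Proof. unfold grid. simpl. unfold Rdiv. ring. Qed.

Lemma grid_N N : (0 < N)%nat -> grid N N = 1.
Proof. intros HN. apply lt_INR in HN. simpl in HN. unfold grid. field. lra. Qed.

Lemma grid_sub N k : (0 < N)%nat -> (k <= N)%nat -> grid N (N - k) = 1 - grid N k.
Proof.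
  intros HN Hk. apply lt_INR in HN. simpl in HN. unfold grid. rewrite minus_INR by exact Hk.
  field. lra.
Qed.

(* [u] lives on the nodes [k/N], [w] approximates [d phi(c u')] on the cells; this staggering
   makes the scheme symmetric under reversal of time. *)
Record scheme (q g : R -> R) (c0 c1 d0 d1 : R) (N : nat) (cs ds hs u w : nat -> R) : Prop := {
  sch_u : forall k, (k < N)%nat -> u (S k) - u k = / INR N * (q (w k / ds k) / cs k);
  sch_w : forall k, (S k < N)%nat -> w (S k) - w k = - (/ INR N * (hs (S k) * g (u (S k))));
  sch_c : forall k, (k < N)%nat -> c0 <= cs k <= c1;
  sch_d : forall k, (k < N)%nat -> d0 <= ds k <= d1;
  sch_h : forall k, (0 < k < N)%nat -> 0 <= hs k }.

Definition max_at (u : nat -> R) (N j : nat) : Prop :=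
  (j <= N)%nat /\ forall k, (k <= N)%nat -> u k <= u j.

Lemma max_at_exists (u : nat -> R) (N : nat) : exists j, max_at u N j.
Proof.
  induction N as [|N [j [Hj Hmax]]].
  - exists 0%nat. split; [lia|]. intros k Hk. replace k with 0%nat by lia. lra.
  - destruct (Rle_lt_dec (u (S N)) (u j)) as [H|H].
    + exists j. split; [lia|]. intros k Hk.
      destruct (Nat.eq_dec k (S N)) as [->|]; [exact H|]. apply Hmax. lia.
    + exists (S N). split; [lia|]. intros k Hk.
      destruct (Nat.eq_dec k (S N)) as [->|]; [lra|]. specialize (Hmax k ltac:(lia)). lra.
Qed.

Lemma max_at_rev u N j : max_at u N j -> max_at (fun k => u (N - k)%nat) N (N - j).
Proof.
  intros [Hj Hmax]. split; [lia|]. intros k Hk.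
  replace (N - (N - j))%nat with j by lia. apply Hmax. lia.
Qed.

Section Scheme.
Variables (phi psi1 psi2 q Psi g : R -> R) (c0 c1 d0 d1 : R).
Hypothesis Hq : phi_inverse phi psi1 psi2 q Psi.
Hypothesis Hg : forall s, 0 <= g s.
Hypotheses (Hc0 : 0 < c0) (Hd0 : 0 < d0).
Hypotheses (Hc1 : c0 <= c1) (Hd1 : d0 <= d1).

Lemma q_le x y : x <= y -> q x <= q y.
Proof. intros [H| ->]; [left; now apply (q_lt _ _ _ _ _ Hq)|apply Rle_refl]. Qed.

Lemma q_0 : q 0 = 0.
Proof. rewrite <- (phi_0 _ _ _ _ _ Hq) at 1. apply (q_phi _ _ _ _ _ Hq). Qed.

Lemma q_ge0 x : 0 <= x -> 0 <= q x.
Proof. intros H. rewrite <- q_0. now apply q_le. Qed.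

Lemma phi_le x y : x <= y -> phi x <= phi y.
Proof. intros [H| ->]; [left; now apply (phi_lt _ _ _ _ _ Hq)|apply Rle_refl]. Qed.

Lemma phi_pos x : 0 < x -> 0 < phi x.
Proof. intros H. rewrite <- (phi_0 _ _ _ _ _ Hq). now apply (phi_lt _ _ _ _ _ Hq). Qed.

Lemma phi_ge0 x : 0 <= x -> 0 <= phi x.
Proof. intros H. rewrite <- (phi_0 _ _ _ _ _ Hq). now apply phi_le. Qed.

(** [q] need not be subadditive; the sum is at most twice the larger term, which costs only a factor
    2 in the argument. *)
Lemma q_add_le x y : 0 <= x -> 0 <= y -> q (x + y) <= q (2 * x) + q (2 * y).
Proof.
  intros Hx Hy.
  assert (0 <= q (2 * x)) by (apply q_ge0; lra).
  assert (0 <= q (2 * y)) by (apply q_ge0; lra).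
  destruct (Rle_lt_dec x y).
  - assert (q (x + y) <= q (2 * y)) by (apply q_le; lra). lra.
  - assert (q (x + y) <= q (2 * x)) by (apply q_le; lra). lra.
Qed.

Variables (N : nat) (cs ds hs u w : nat -> R).
Hypothesis HN : (0 < N)%nat.
Hypothesis Hsch : scheme q g c0 c1 d0 d1 N cs ds hs u w.

Lemma INR_N_pos : 0 < INR N.
Proof. now apply lt_0_INR. Qed.

Lemma inv_N_pos : 0 < / INR N.
Proof. apply Rinv_0_lt_compat, INR_N_pos. Qed.

(** Nodes are reflected by [N - k] but cells by [N - 1 - k]. The slope changes sign, hence so does
    [w], and the oddness of [q] restores the equation on each cell. *)
Lemma scheme_rev :
  scheme q g c0 c1 d0 d1 N (fun k => cs (N - 1 - k)%nat) (fun k => ds (N - 1 - k)%nat)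
    (fun k => hs (N - k)%nat) (fun k => u (N - k)%nat) (fun k => - w (N - 1 - k)%nat).
Proof.
  destruct Hsch as [Hu Hw HC HD HH]. split.
  - intros k Hk. specialize (Hu (N - 1 - k)%nat ltac:(lia)).
    replace (S (N - 1 - k)) with (N - k)%nat in Hu by lia.
    replace (N - S k)%nat with (N - 1 - k)%nat by lia.
    replace (- w (N - 1 - k)%nat / ds (N - 1 - k)%nat)
      with (- (w (N - 1 - k)%nat / ds (N - 1 - k)%nat)) by (unfold Rdiv; ring).
    rewrite (q_opp _ _ _ _ _ Hq).
    replace (- q (w (N - 1 - k)%nat / ds (N - 1 - k)%nat) / cs (N - 1 - k)%nat)
      with (- (q (w (N - 1 - k)%nat / ds (N - 1 - k)%nat) / cs (N - 1 - k)%nat))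
      by (unfold Rdiv; ring).
    lra.
  - intros k Hk. specialize (Hw (N - 1 - S k)%nat ltac:(lia)).
    replace (S (N - 1 - S k)) with (N - S k)%nat in Hw by lia.
    replace (N - 1 - k)%nat with (N - S k)%nat by lia. lra.
  - intros k Hk. apply HC. lia.
  - intros k Hk. apply HD. lia.
  - intros k Hk. apply HH. lia.
Qed.

Lemma w_noninc i j : (i <= j < N)%nat -> w j <= w i.
Proof.
  intros [Hij Hj].
  assert (w j - w i <= 0 - 0); [|lra].
  apply (telescope_le w (fun _ => 0)); [exact Hij|]. intros k Hk.
  rewrite (sch_w _ _ _ _ _ _ _ _ _ _ _ _ Hsch) by lia.
  assert (0 <= / INR N * (hs (S k) * g (u (S k)))); [|lra].
  apply Rmult_le_pos; [left; apply inv_N_pos|]. apply Rmult_le_pos; [|apply Hg].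
  apply (sch_h _ _ _ _ _ _ _ _ _ _ _ _ Hsch). lia.
Qed.

Lemma cell_pos k : (k < N)%nat -> 0 < cs k /\ 0 < ds k.
Proof.
  intros Hk. pose proof (sch_c _ _ _ _ _ _ _ _ _ _ _ _ Hsch k Hk).
  pose proof (sch_d _ _ _ _ _ _ _ _ _ _ _ _ Hsch k Hk). lra.
Qed.

(** * Slope bounds and the substitute for concavity *)

Lemma step_ge k y : (k < N)%nat -> 0 <= y <= w k ->
  / INR N * (q (y / d1) / c1) <= u (S k) - u k.
Proof.
  intros Hk Hy. rewrite (sch_u _ _ _ _ _ _ _ _ _ _ _ _ Hsch k Hk).
  destruct (cell_pos k Hk) as [Hc Hd].
  pose proof (sch_c _ _ _ _ _ _ _ _ _ _ _ _ Hsch k Hk) as HC.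
  pose proof (sch_d _ _ _ _ _ _ _ _ _ _ _ _ Hsch k Hk) as HD.
  apply Rmult_le_compat_l; [left; apply inv_N_pos|].
  unfold Rdiv at 1 3. apply Rmult_le_compat.
  - apply q_ge0. apply Rmult_le_pos; [lra|]. left. apply Rinv_0_lt_compat. lra.
  - left. apply Rinv_0_lt_compat. lra.
  - apply q_le. unfold Rdiv. apply Rmult_le_compat; try lra.
    + left. apply Rinv_0_lt_compat. lra.
    + apply Rinv_le_contravar; lra.
  - apply Rinv_le_contravar; lra.
Qed.

Lemma step_le k y : (k < N)%nat -> 0 <= y -> w k <= y ->
  u (S k) - u k <= / INR N * (q (y / d0) / c0).
Proof.
  intros Hk Hy Hwy. rewrite (sch_u _ _ _ _ _ _ _ _ _ _ _ _ Hsch k Hk).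
  destruct (cell_pos k Hk) as [Hc Hd].
  pose proof (sch_c _ _ _ _ _ _ _ _ _ _ _ _ Hsch k Hk) as HC.
  pose proof (sch_d _ _ _ _ _ _ _ _ _ _ _ _ Hsch k Hk) as HD.
  apply Rmult_le_compat_l; [left; apply inv_N_pos|].
  assert (Hi : 0 < / cs k) by (apply Rinv_0_lt_compat; lra).
  assert (Hid : 0 < / ds k) by (apply Rinv_0_lt_compat; lra).
  assert (H0 : 0 <= q (y / d0)).
  { apply q_ge0. apply Rmult_le_pos; [lra|]. left. apply Rinv_0_lt_compat. lra. }
  apply Rle_trans with (q (y / d0) / cs k).
  - unfold Rdiv at 1 3. apply Rmult_le_compat_r; [lra|]. apply q_le.
    apply Rle_trans with (y / ds k).
    + unfold Rdiv. apply Rmult_le_compat_r; lra.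
    + unfold Rdiv. apply Rmult_le_compat_l; [lra|]. apply Rinv_le_contravar; lra.
  - unfold Rdiv at 1 3. apply Rmult_le_compat_l; [exact H0|]. apply Rinv_le_contravar; lra.
Qed.

Lemma rise_ge i j y : (i <= j <= N)%nat -> 0 <= y -> (forall k, (i <= k < j)%nat -> y <= w k) ->
  (grid N j - grid N i) * (q (y / d1) / c1) <= u j - u i.
Proof.
  intros Hij Hy Hw.
  pose proof (telescope_le (fun k => grid N k * (q (y / d1) / c1)) u i j ltac:(lia)) as T.
  simpl in T. assert (forall x z a, (x - z) * a = x * a - z * a) as -> by (intros; ring).
  apply T. intros k Hk. rewrite grid_S.
  pose proof (step_ge k y ltac:(lia) (conj Hy (Hw k Hk))). lra.
Qed.

Lemma rise_le i j y : (i <= j <= N)%nat -> 0 <= y -> (forall k, (i <= k < j)%nat -> w k <= y) ->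
  u j - u i <= (grid N j - grid N i) * (q (y / d0) / c0).
Proof.
  intros Hij Hy Hw.
  pose proof (telescope_le u (fun k => grid N k * (q (y / d0) / c0)) i j ltac:(lia)) as T.
  simpl in T. assert (forall x z a, (x - z) * a = x * a - z * a) as -> by (intros; ring).
  apply T. intros k Hk. rewrite grid_S.
  pose proof (step_le k y ltac:(lia) Hy (Hw k Hk)). lra.
Qed.

(** [w] is nonincreasing, so if [w k] is positive then [u] has risen on all cells up to [k] at least
    at the speed that [w k] dictates; the total rise, from a value above 0, is at most [m]. *)
Lemma w_le_of_bound k m : (k < N)%nat -> 0 <= m -> 0 <= u 0%nat -> u (S k) <= m ->
  w k <= d1 * phi (c1 * m / grid N (S k)).
Proof.
  intros Hk Hm0 H0 Hm.
  assert (Ht : 0 < grid N (S k)).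
  { unfold grid. apply Rdiv_lt_0_compat; [apply lt_0_INR; lia|apply INR_N_pos]. }
  destruct (Rle_lt_dec (w k) 0) as [Hw|Hw].
  - apply Rle_trans with 0; [exact Hw|]. apply Rmult_le_pos; [lra|]. apply phi_ge0.
    apply Rmult_le_pos; [nra|]. left. now apply Rinv_0_lt_compat.
  - pose proof (rise_ge 0 (S k) (w k) ltac:(lia) ltac:(lra)) as Hr.
    assert (Hw' : forall i, (0 <= i < S k)%nat -> w k <= w i).
    { intros i Hi. apply w_noninc. lia. }
    specialize (Hr Hw'). rewrite grid_0 in Hr.
    rewrite Rmult_comm. apply Rle_div_iff; [lra|].
    rewrite <- (phi_q _ _ _ _ _ Hq (w k / d1)). apply phi_le.
    apply Rdiv_le_iff; [exact Ht|].
    assert (E : q (w k / d1) = q (w k / d1) / c1 * c1) by (field; lra).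
    rewrite E. nra.
Qed.

(** Before [k] the speed is at least [q (w k / d1) / c1], after [k] at most [q (w k / d0) / c0]. The
    two are comparable because [psi2 s <= d0 / d1] and [q_psi2] give
    [s * q (w k / d0) <= q (w k / d1)]. For constant coefficients this would be concavity. *)
Lemma concave_left s j k : 0 < s -> psi2 s <= d0 / d1 ->
  max_at u N j -> 0 <= u 0%nat -> (k <= j)%nat ->
  grid N k * (u j - u k) <= c1 / (s * c0) * u k.
Proof.
  intros Hs Hps [Hj Hmax] H0 Hkj.
  assert (HCs : 0 < c1 / (s * c0)) by (apply Rdiv_lt_0_compat; [lra|nra]).
  assert (Ht : 0 <= grid N k).
  { rewrite <- (grid_0 N). apply grid_le; [exact HN|lia]. }
  assert (Ht1 : grid N j <= 1).
  { rewrite <- (grid_N N HN). now apply grid_le. }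
  assert (Hm : 0 <= u j) by (specialize (Hmax 0%nat ltac:(lia)); lra).
  destruct (Nat.eq_dec k j) as [->|Hne].
  { replace (u j - u j) with 0 by ring. nra. }
  destruct (Rlt_le_dec (w k) 0) as [Hw|Hw].
  (* With [w k] negative the trajectory no longer rises after [k], so [u k] is already the
     maximum. *)
  - assert (u j - u k <= (grid N j - grid N k) * (q (0 / d0) / c0)) as Hr.
    { apply rise_le; [lia|lra|]. intros i Hi. pose proof (w_noninc k i ltac:(lia)). lra. }
    replace (0 / d0) with 0 in Hr by (field; lra). rewrite q_0 in Hr.
    replace (0 / c0) with 0 in Hr by (field; lra). nra.
  - set (X := q (w k / d0)).
    assert (HX : 0 <= X).
    { apply q_ge0. apply Rmult_le_pos; [lra|]. left. now apply Rinv_0_lt_compat. }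
    assert (Hlow : grid N k * (s * X / c1) <= u k).
    { assert (Hr : (grid N k - grid N 0) * (q (w k / d1) / c1) <= u k - u 0%nat).
      { apply rise_ge; [lia|exact Hw|]. intros i Hi. apply w_noninc. lia. }
      rewrite grid_0 in Hr.
      assert (s * X <= q (w k / d1)).
      { apply Rle_trans with (q (psi2 s * (w k / d0))).
        - apply (q_psi2 _ _ _ _ _ Hq); [lra|]. apply Rmult_le_pos; [lra|].
          left. now apply Rinv_0_lt_compat.
        - apply q_le. replace (w k / d1) with (d0 / d1 * (w k / d0)) by (field; lra).
          apply Rmult_le_compat_r; [|exact Hps]. apply Rmult_le_pos; [lra|].
          left. now apply Rinv_0_lt_compat. }
      assert (s * X / c1 <= q (w k / d1) / c1).
      { apply Rmult_le_compat_r; [left; apply Rinv_0_lt_compat; lra|assumption]. }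
      nra. }
    assert (Hup : u j - u k <= X / c0).
    { assert (Hr : u j - u k <= (grid N j - grid N k) * (X / c0)).
      { apply rise_le; [lia|exact Hw|]. intros i Hi. apply w_noninc. lia. }
      assert (0 <= X / c0) by (apply Rmult_le_pos; [lra|left; now apply Rinv_0_lt_compat]).
      nra. }
    apply Rle_trans with (grid N k * (X / c0)).
    + now apply Rmult_le_compat_l.
    + replace (grid N k * (X / c0)) with (c1 / (s * c0) * (grid N k * (s * X / c1)))
        by (field; repeat split; lra).
      apply Rmult_le_compat_l; [lra|exact Hlow].
Qed.

(* The estimates below concern the right half; the left half follows through [scheme_rev], with
   weight [h (1 - t)]. *)
Variables (n : nat) (h H P : R -> R).
Hypothesis HNn : N = (2 * n + 1)%nat.
Hypothesis HW : right_weight Psi h H P.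
Hypothesis Hhs : forall k x, (0 < k < N)%nat -> 0 < x < 1 ->
  grid N k - / INR N <= x <= grid N k + / INR N -> hs k <= h x.
Hypothesis Hh0 : forall x, 0 < x < 1 -> 0 <= h x.

(** As [N = 2 * n + 1], the point 1/2 is the centre of cell [n], and node [n + 1] lies exactly half
    a cell to its right. *)
Lemma grid_mid k : (n < k)%nat -> 1/2 <= grid N k - / INR N / 2.
Proof.
  intros Hk. apply Rle_trans with (grid N (S n) - / INR N / 2).
  - unfold grid. rewrite S_INR. pose proof INR_N_pos as HI.
    assert (E : INR N = 2 * INR n + 1) by (rewrite HNn, plus_INR, mult_INR; simpl; ring).
    right. rewrite E in *. field. lra.
  - pose proof (grid_le N (S n) k HN ltac:(lia)). lra.
Qed.

Lemma grid_lt_1 k : (k < N)%nat -> grid N k < 1.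
Proof.
  intros Hk. pose proof (grid_le N (S k) N HN ltac:(lia)) as HG.
  rewrite grid_S, (grid_N N HN) in HG. pose proof inv_N_pos. lra.
Qed.

Lemma H_mono s t : 1/2 <= s <= t -> t < 1 -> H s <= H t.
Proof.
  intros Hst Ht. pose proof (rw_H _ _ _ _ HW s t 0 Hst Ht) as HH.
  assert (forall x, s <= x <= t -> 0 <= h x) as Hx by (intros x Hx; apply Hh0; lra).
  specialize (HH Hx). lra.
Qed.

Lemma H_ge0 t : 1/2 <= t < 1 -> 0 <= H t.
Proof. intros Ht. rewrite <- (rw_0 _ _ _ _ HW). apply H_mono; lra. Qed.

(** Only the half cell to the left of node [k] is used: it stays in the right half even for
    [k = n + 1], and it ends at [grid N k], before the singular endpoint. *)
Lemma hs_half_le k : (n < k < N)%nat ->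
  / INR N / 2 * hs k <= H (grid N k) - H (grid N k - / INR N / 2).
Proof.
  intros Hk. pose proof (grid_mid k ltac:(lia)). pose proof (grid_lt_1 k ltac:(lia)).
  pose proof inv_N_pos.
  replace (/ INR N / 2) with (grid N k - (grid N k - / INR N / 2)) at 1 by ring.
  apply (rw_H _ _ _ _ HW); [lra|lra|]. intros x Hx. apply Hhs; [lia|lra|lra].
Qed.

(** The half cells attached to different nodes are disjoint, so their contributions add up to at
    most [H (grid N k)]; the factor 2 compensates for their half length. *)
Lemma w_drop_le j k F : (n <= j)%nat -> (j < k < N)%nat -> 0 <= F ->
  (forall i, (i <= N)%nat -> g (u i) <= F) ->
  - w k <= - w j + 2 * F * H (grid N k).
Proof.
  intros Hj [Hjk Hk] HF HgF.
  assert (Hstep : forall i, (n < S i < N)%nat ->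
    - w (S i) <= - w i + 2 * F * (H (grid N (S i)) - H (grid N (S i) - / INR N / 2))).
  { intros i Hi. pose proof (sch_w _ _ _ _ _ _ _ _ _ _ _ _ Hsch i ltac:(lia)) as E.
    pose proof (hs_half_le (S i) Hi) as Hhalf.
    assert (Hprod : / INR N * (hs (S i) * g (u (S i))) <= / INR N * hs (S i) * F).
    { rewrite <- Rmult_assoc. apply Rmult_le_compat_l; [|apply HgF; lia].
      apply Rmult_le_pos; [left; apply inv_N_pos|].
      apply (sch_h _ _ _ _ _ _ _ _ _ _ _ _ Hsch). lia. }
    nra. }
  induction Hjk as [|k Hjk IH].
  - specialize (Hstep j ltac:(lia)).
    assert (0 <= H (grid N (S j) - / INR N / 2)); [|nra].
    pose proof (grid_mid (S j) ltac:(lia)). pose proof (grid_lt_1 (S j) ltac:(lia)).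
    pose proof inv_N_pos. apply H_ge0. lra.
  - specialize (IH ltac:(lia)). specialize (Hstep k ltac:(lia)).
    assert (H (grid N k) <= H (grid N (S k) - / INR N / 2)); [|nra].
    pose proof (grid_mid k ltac:(lia)). pose proof (grid_lt_1 (S k) ltac:(lia)).
    pose proof inv_N_pos. rewrite grid_S in *. apply H_mono; lra.
Qed.

(** [q_add_le] separates the initial slope [y] from the part accumulated through [H]. The first has
    constant speed; the second is a left endpoint Riemann sum of [Psi] of [H], hence bounded by an
    increment of [P]. *)
Lemma descent_le j y F : (n < j <= N)%nat -> 0 <= y -> 0 <= F ->
  (forall k, (j <= k < N)%nat -> - w k <= y + F * H (grid N k)) ->
  u j - u N <= / c0 * ((1 - grid N j) * q (2 * y / d0) + q (2 * F / d0) * (P 1 - P (grid N j))).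
Proof.
  intros Hj Hy HF Hw.
  assert (Hid0 : 0 < / d0) by now apply Rinv_0_lt_compat.
  assert (Hic0 : 0 < / c0) by now apply Rinv_0_lt_compat.
  (* With [phi x = 2 * F / d0], [q_phi_mul] pulls this [x] out of [q] and leaves
     [Psi (H (grid N k))]. *)
  set (x := q (2 * F / d0)).
  assert (Hx0 : 0 <= x) by (apply q_ge0; apply Rmult_le_pos; lra).
  pose proof (telescope_le (fun k => - u k)
    (fun k => / c0 * (grid N k * q (2 * y / d0) + x * P (grid N k))) j N ltac:(lia)) as T.
  simpl in T. rewrite (grid_N N HN) in T.
  enough (- u N - - u j <= / c0 * (1 * q (2 * y / d0) + x * P 1) -
     / c0 * (grid N j * q (2 * y / d0) + x * P (grid N j))) by lra.
  apply T. intros k Hk.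
  pose proof (grid_mid k ltac:(lia)) as Hmid. pose proof (grid_lt_1 k ltac:(lia)) as Hlt1.
  pose proof inv_N_pos as HiN.
  assert (HH : 0 <= H (grid N k)) by (apply H_ge0; lra).
  assert (HFH : 0 <= F * H (grid N k)) by now apply Rmult_le_pos.
  set (v := y + F * H (grid N k)).
  assert (Hstep : u k - u (S k) <= / INR N * (q (v / d0) / c0)).
  { pose proof (sch_u _ _ _ _ _ _ _ _ _ _ _ _ Hsch k ltac:(lia)) as E.
    pose proof (sch_c _ _ _ _ _ _ _ _ _ _ _ _ Hsch k ltac:(lia)) as HC.
    pose proof (sch_d _ _ _ _ _ _ _ _ _ _ _ _ Hsch k ltac:(lia)) as HD.
    replace (u k - u (S k)) with (/ INR N * (- q (w k / ds k) / cs k))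
      by (rewrite <- (Ropp_minus_distr (u (S k))), E; unfold Rdiv; ring).
    apply Rmult_le_compat_l; [lra|]. rewrite <- (q_opp _ _ _ _ _ Hq).
    assert (Hics : 0 < / cs k) by (apply Rinv_0_lt_compat; lra).
    assert (Hids : 0 < / ds k) by (apply Rinv_0_lt_compat; lra).
    assert (Hv : 0 <= q (v / d0)).
    { apply q_ge0. unfold v. apply Rmult_le_pos; lra. }
    apply Rle_trans with (q (v / d0) / cs k).
    - unfold Rdiv at 1 3. apply Rmult_le_compat_r; [lra|]. apply q_le.
      specialize (Hw k ltac:(lia)). fold v in Hw.
      replace (- (w k / ds k)) with (- w k * / ds k) by (unfold Rdiv; ring).
      apply Rle_trans with (v * / ds k).
      + apply Rmult_le_compat_r; lra.
      + apply Rmult_le_compat_l; [unfold v; lra|]. apply Rinv_le_contravar; lra.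
    - apply Rmult_le_compat_l; [exact Hv|]. apply Rinv_le_contravar; lra. }
  assert (Hsplit : q (v / d0) <= q (2 * y / d0) + x * Psi (H (grid N k))).
  { replace (v / d0) with (y / d0 + F * H (grid N k) / d0) by (unfold v; field; lra).
    eapply Rle_trans; [apply q_add_le; apply Rmult_le_pos; lra|].
    replace (2 * (y / d0)) with (2 * y / d0) by (field; lra).
    apply Rplus_le_compat_l.
    replace (2 * (F * H (grid N k) / d0)) with (phi x * H (grid N k)).
    - now apply (q_phi_mul _ _ _ _ _ Hq).
    - unfold x. rewrite (phi_q _ _ _ _ _ Hq). field. lra. }
  assert (HPk : / INR N * Psi (H (grid N k)) <= P (grid N (S k)) - P (grid N k)).
  { replace (/ INR N) with (grid N (S k) - grid N k) by (rewrite grid_S; ring).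
    apply (rw_P _ _ _ _ HW).
    - split; [lra|]. apply grid_le; [exact HN|lia].
    - rewrite <- (grid_N N HN). apply grid_le; [exact HN|lia]. }
  rewrite grid_S at 1.
  assert (/ INR N * (q (v / d0) / c0) <=
    / c0 * (/ INR N * q (2 * y / d0) + x * (P (grid N (S k)) - P (grid N k)))); [|lra].
  replace (/ INR N * (q (v / d0) / c0)) with (/ c0 * (/ INR N * q (v / d0)))
    by (unfold Rdiv; ring).
  apply Rmult_le_compat_l; [lra|]. nra.
Qed.

(** At the maximum the downward slope starts from nothing, so the whole descent is caused by
    [g <= K * phi m]. In [4 * K / d0] one factor 2 comes from the half cells and the other from
    [q_add_le]; [psi1 s] then turns [phi m] into [s * m], and [s * B < c0] makes the descent shorter
    than [m]. *)
Lemma descent_from_max j m K s B : (n < j)%nat -> max_at u N j -> u j = m -> 0 < m ->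
  (forall x, x <= m -> g x <= K * phi m) -> 0 <= K -> 0 <= s -> 4 * K / d0 <= psi1 s ->
  P 1 - P (1/2) <= B -> s * B < c0 -> u j - u N < m.
Proof.
  intros Hj [HjN Hmax] Hum Hm HgK HK Hs Hps HB HsB.
  assert (Hphim : 0 < phi m) by now apply phi_pos.
  assert (HKm : 0 <= K * phi m) by nra.
  destruct (Nat.eq_dec j N) as [->|HjN'].
  { lra. }
  (* Otherwise the cell before [j] would descend into the maximum. Here [j - 1 >= n], as [w_drop_le]
     requires. *)
  assert (Hwj : 0 <= w (j - 1)%nat).
  { apply Rnot_lt_le. intros Hneg.
    pose proof (sch_u _ _ _ _ _ _ _ _ _ _ _ _ Hsch (j - 1)%nat ltac:(lia)) as E.
    replace (S (j - 1)) with j in E by lia.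
    destruct (cell_pos (j - 1)%nat ltac:(lia)) as [Hcp Hdp].
    assert (Hqneg : q (w (j - 1)%nat / ds (j - 1)%nat) < 0).
    { rewrite <- q_0. apply (q_lt _ _ _ _ _ Hq).
      apply Rmult_neg_pos; [exact Hneg|now apply Rinv_0_lt_compat]. }
    assert (/ INR N * (q (w (j - 1)%nat / ds (j - 1)%nat) / cs (j - 1)%nat) < 0).
    { apply Rmult_pos_neg; [apply inv_N_pos|].
      apply Rmult_neg_pos; [exact Hqneg|now apply Rinv_0_lt_compat]. }
    specialize (Hmax (j - 1)%nat ltac:(lia)). lra. }
  assert (Hdesc := descent_le j 0 (2 * (K * phi m)) ltac:(lia) (Rle_refl 0) ltac:(lra)).
  assert (Hd : u j - u N <= / c0 * ((1 - grid N j) * q (2 * 0 / d0)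
      + q (2 * (2 * (K * phi m)) / d0) * (P 1 - P (grid N j)))).
  { apply Hdesc. intros k Hk.
    pose proof (w_drop_le (j - 1) k (K * phi m) ltac:(lia) ltac:(lia) HKm) as Hdr.
    assert (forall i, (i <= N)%nat -> g (u i) <= K * phi m) as Hgi.
    { intros i Hi. apply HgK. rewrite <- Hum. now apply Hmax. }
    specialize (Hdr Hgi). lra. }
  replace (2 * 0 / d0) with 0 in Hd by (field; lra). rewrite q_0, Rmult_0_r, Rplus_0_l in Hd.
  assert (Hqs : q (2 * (2 * (K * phi m)) / d0) <= s * m).
  { apply Rle_trans with (q (psi1 s * phi m)).
    - apply q_le. replace (2 * (2 * (K * phi m)) / d0) with (4 * K / d0 * phi m) by (field; lra).
      apply Rmult_le_compat_r; lra.
    - rewrite <- (q_phi _ _ _ _ _ Hq m) at 2. apply (q_psi1 _ _ _ _ _ Hq); lra. }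
  pose proof (grid_mid j Hj) as Hmid. pose proof (grid_lt_1 j ltac:(lia)) as Hlt1.
  pose proof inv_N_pos as HiN.
  assert (HP1 : P (grid N j) <= P 1).
  { pose proof (rw_P _ _ _ _ HW (grid N j) 1 ltac:(lra) ltac:(lra)).
    pose proof (Psi_ge0 _ _ _ _ _ Hq (H (grid N j))). nra. }
  assert (HP2 : P (1/2) <= P (grid N j)).
  { pose proof (rw_P _ _ _ _ HW (1/2) (grid N j) ltac:(lra) ltac:(lra)).
    pose proof (Psi_ge0 _ _ _ _ _ Hq (H (1/2))). nra. }
  apply Rle_lt_trans with (/ c0 * (s * m * B)).
  - eapply Rle_trans; [exact Hd|]. apply Rmult_le_compat_l; [left; now apply Rinv_0_lt_compat|].
    apply Rmult_le_compat; [|lra|exact Hqs|lra].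
    apply q_ge0. apply Rmult_le_pos; [lra|]. left. now apply Rinv_0_lt_compat.
  - replace (/ c0 * (s * m * B)) with (s * B * m / c0) by (field; lra).
    apply Rmult_lt_reg_r with c0; [exact Hc0|].
    replace (s * B * m / c0 * c0) with (s * B * m) by (field; lra). nra.
Qed.

End Scheme.

Arguments q_0 {phi psi1 psi2 q Psi} Hq.
Arguments scheme_rev {phi psi1 psi2 q Psi g c0 c1 d0 d1} Hq {N cs ds hs u w} HN Hsch.
Arguments w_noninc {q g c0 c1 d0 d1} Hg {N cs ds hs u w} HN Hsch.
Arguments rise_ge {phi psi1 psi2 q Psi g c0 c1 d0 d1} Hq Hc0 Hd0 Hc1 Hd1 {N cs ds hs u w} HN Hsch.
Arguments rise_le {phi psi1 psi2 q Psi g c0 c1 d0 d1} Hq Hc0 Hd0 {N cs ds hs u w} HN Hsch.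
Arguments w_le_of_bound {phi psi1 psi2 q Psi g c0 c1 d0 d1} Hq Hg Hc0 Hd0 Hc1 Hd1 {N cs ds hs u w} HN Hsch.
Arguments concave_left {phi psi1 psi2 q Psi g c0 c1 d0 d1} Hq Hg Hc0 Hd0 Hc1 Hd1 {N cs ds hs u w} HN Hsch.
Arguments w_drop_le {q Psi g c0 c1 d0 d1 N cs ds hs u w} HN Hsch {n h H P}.
Arguments descent_le {phi psi1 psi2 q Psi g c0 c1 d0 d1} Hq Hc0 Hd0 {N cs ds hs u w} HN Hsch {n h H P}.
Arguments descent_from_max {phi psi1 psi2 q Psi g c0 c1 d0 d1} Hq Hc0 Hd0 {N cs ds hs u w} HN Hsch {n h H P}.

(** * Two-sided estimates and shooting *)

Definition nfloor (x : R) : nat := Z.to_nat (Int_part x).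

Lemma nfloor_spec x : 0 <= x -> INR (nfloor x) <= x < INR (nfloor x) + 1.
Proof.
  intros Hx. destruct (base_Int_part x) as [H1 H2]. unfold nfloor.
  assert (Hz : (0 <= Int_part x)%Z).
  { assert (-1 < Int_part x)%Z; [|lia]. apply lt_IZR. lra. }
  rewrite INR_IZR_INZ, Z2Nat.id by exact Hz. lra.
Qed.

Lemma nfloor_grid N t : (0 < N)%nat -> 0 <= t ->
  grid N (nfloor (t * INR N)) <= t < grid N (nfloor (t * INR N)) + / INR N.
Proof.
  intros HN Ht. apply lt_INR in HN. simpl in HN.
  destruct (nfloor_spec (t * INR N)) as [H1 H2]; [nra|].
  unfold grid. split.
  - apply Rle_div_iff; lra.
  - replace (INR (nfloor (t * INR N)) / INR N + / INR N)
      with ((INR (nfloor (t * INR N)) + 1) / INR N) by (field; lra).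
    apply Rmult_lt_reg_r with (INR N); [exact HN|].
    replace ((INR (nfloor (t * INR N)) + 1) / INR N * INR N)
      with (INR (nfloor (t * INR N)) + 1) by (field; lra). exact H2.
Qed.

Lemma grid_lt_inv N i j : (0 < N)%nat -> grid N i < grid N j -> (i < j)%nat.
Proof.
  intros HN H. apply Nat.nle_gt. intros Hle. pose proof (grid_le N j i HN Hle). lra.
Qed.

(** The neighbourhood consists of the two cells adjacent to the node, so it is symmetric under time
    reversal. The upper bound controls the descent near the endpoints; the second clause, that
    [hs k] is the greatest lower bound, gives the drop of [w] where [h] is large and the convergence
    of [hs] to [h]. *)
Definition cell_inf (h : R -> R) (N : nat) (hs : nat -> R) : Prop :=
  forall k, (0 < k < N)%nat ->
    (forall x, 0 < x < 1 -> grid N k - / INR N <= x <= grid N k + / INR N -> hs k <= h x) /\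
    (forall e, (forall x, 0 < x < 1 -> grid N k - / INR N <= x <= grid N k + / INR N -> e <= h x) ->
       e <= hs k).

Lemma cell_inf_exists (h : R -> R) (N : nat) :
  (forall x, 0 < x < 1 -> 0 <= h x) -> exists hs, cell_inf h N hs.
Proof.
  intros Hh.
  set (cell := fun k x => 0 < x < 1 /\ grid N k - / INR N <= x <= grid N k + / INR N).
  assert (E : forall k, exists l, (0 < k < N)%nat ->
    (forall x, cell k x -> l <= h x) /\ (forall e, (forall x, cell k x -> e <= h x) -> e <= l)).
  { intros k. destruct (classic (0 < k < N)%nat) as [Hk|Hk]; [|exists 0; intros; contradiction].
    assert (HN : 0 < / INR N) by (apply Rinv_0_lt_compat, lt_0_INR; lia).
    assert (Hc : cell k (grid N k)).
    { assert (HN' : (0 < N)%nat) by lia. unfold cell. split; [|lra].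
      assert (HI : 0 < INR N) by (apply lt_0_INR; lia).
      assert (H1 : 0 < INR k) by (apply lt_0_INR; lia).
      assert (H2 : INR k < INR N) by (apply lt_INR; lia).
      unfold grid. split; [now apply Rdiv_lt_0_compat|].
      apply Rmult_lt_reg_r with (INR N); [exact HI|].
      replace (INR k / INR N * INR N) with (INR k) by (field; lra). lra. }
    destruct (completeness (fun y => forall x, cell k x -> y <= h x)) as [l [Hub Hlub]].
    - exists (h (grid N k)). intros y Hy. now apply Hy.
    - exists 0. intros x Hx. apply Hh, Hx.
    - exists l. intros _. split.
      + intros x Hx. apply Hlub. intros y Hy. now apply Hy.
      + intros e He. now apply Hub. }
  destruct (choice_fun _ E) as [hs Hl]. exists hs. intros k Hk.
  destruct (Hl k Hk) as [H1 H2]. split.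
  - intros x Hx Hx'. apply H1. now split.
  - intros e He. apply H2. intros x [Hx Hx']. now apply He.
Qed.

(** The pair holds [u] at node [k] and [w] on cell [k]; the update of [w] uses the new value [u'],
    yet everything remains explicit and therefore continuous in [p]. *)
Fixpoint shoot (q g : R -> R) (N : nat) (cs ds hs : nat -> R) (p : R) (k : nat) : R * R :=
  match k with
  | O => (0, p)
  | S k => let uw := shoot q g N cs ds hs p k in
           let u' := fst uw + / INR N * (q (snd uw / ds k) / cs k) in
           (u', snd uw - / INR N * (hs (S k) * g u'))
  end.

Lemma shoot_continuity q g N cs ds hs k : continuity q -> continuity g ->
  continuity (fun p => fst (shoot q g N cs ds hs p k)) /\
  continuity (fun p => snd (shoot q g N cs ds hs p k)).
Proof.
  intros Hq Hg. induction k as [|k [IHu IHw]]; simpl.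
  - split; [apply continuity_const; now intros x y|].
    apply derivable_continuous, derivable_id.
  - assert (Hu : continuity (fun p => fst (shoot q g N cs ds hs p k)
        + / INR N * (q (snd (shoot q g N cs ds hs p k) / ds k) / cs k))).
    { apply continuity_plus; [exact IHu|].
      apply (continuity_scal (fun p => q (snd (shoot q g N cs ds hs p k) / ds k) / cs k)).
      apply (continuity_mult (fun p => q (snd (shoot q g N cs ds hs p k) / ds k))
        (fun _ => / cs k)); [|apply continuity_const; now intros x y].
      apply (continuity_comp (fun p => snd (shoot q g N cs ds hs p k) / ds k) q); [|exact Hq].
      apply (continuity_mult (fun p => snd (shoot q g N cs ds hs p k)) (fun _ => / ds k));
        [exact IHw|apply continuity_const; now intros x y]. }
    split; [exact Hu|].
    apply (continuity_minus (fun p => snd (shoot q g N cs ds hs p k))); [exact IHw|].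
    apply (continuity_scal (fun p => hs (S k) * g _)).
    apply (continuity_scal (fun p => g _)).
    now apply (continuity_comp _ g).
Qed.

Section TwoSided.
Variables (phi psi1 psi2 q Psi g : R -> R) (c0 c1 d0 d1 : R).
Hypothesis Hq : phi_inverse phi psi1 psi2 q Psi.
Hypothesis Hg : forall s, 0 <= g s.
Hypotheses (Hc0 : 0 < c0) (Hd0 : 0 < d0).
Hypotheses (Hc1 : c0 <= c1) (Hd1 : d0 <= d1).
Variables (h H1 P1 H2 P2 : R -> R).
Hypothesis Hh0 : forall x, 0 < x < 1 -> 0 <= h x.
Hypothesis HW1 : right_weight Psi h H1 P1.
Hypothesis HW2 : right_weight Psi (fun t => h (1 - t)) H2 P2.
Variables (n N : nat) (cs ds hs : nat -> R).
Hypothesis HNn : N = (2 * n + 1)%nat.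
Hypothesis Hhs : cell_inf h N hs.

Notation scheme' := (scheme q g c0 c1 d0 d1 N).

Lemma N_pos : (0 < N)%nat.
Proof. lia. Qed.

Lemma cell_inf_rev k x : (0 < k < N)%nat -> 0 < x < 1 ->
  grid N k - / INR N <= x <= grid N k + / INR N -> hs (N - k)%nat <= h (1 - x).
Proof.
  intros Hk Hx Hxk. apply (proj1 (Hhs (N - k)%nat ltac:(lia))); [lra|].
  rewrite grid_sub by lia. lra.
Qed.

(** If the maximum lies in the right half, the descent to node [N] is shorter than [m]. If it lies
    in the left half, the reversed estimate says that the rise from node 0 is shorter than [m],
    contradicting [u 0 = 0]. *)
Lemma right_end_positive u w j m K s B :
  scheme' cs ds hs u w -> u 0%nat = 0 -> max_at u N j -> u j = m -> 0 < m ->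
  (forall x, x <= m -> g x <= K * phi m) -> 0 <= K -> 0 <= s -> 4 * K / d0 <= psi1 s ->
  P1 1 - P1 (1/2) <= B -> P2 1 - P2 (1/2) <= B -> s * B < c0 -> 0 < u N.
Proof.
  intros Hs Hu0 Hmax Hm Hm0 HgK HK Hs0 Hps HB1 HB2 HsB.
  destruct (Nat.le_gt_cases j n) as [Hj|Hj].
  - exfalso.
    pose proof (scheme_rev Hq N_pos Hs) as Hr.
    assert (Hd := descent_from_max Hq Hc0 Hd0 N_pos Hr HNn HW2).
    specialize (Hd ltac:(intros; now apply cell_inf_rev)
      ltac:(intros; apply Hh0; lra) (N - j)%nat m K s B ltac:(lia)
      (max_at_rev _ _ _ Hmax)).
    destruct Hmax as [HjN _].
    cbv beta in Hd. replace (N - (N - j))%nat with j in Hd by lia.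
    replace (N - N)%nat with 0%nat in Hd by lia.
    specialize (Hd Hm Hm0 HgK HK Hs0 Hps HB2 HsB). lra.
  - assert (Hd := descent_from_max Hq Hc0 Hd0 N_pos Hs HNn HW1).
    specialize (Hd ltac:(intros; now apply (proj1 (Hhs k ltac:(lia)))) Hh0 j m K s B Hj
      Hmax Hm Hm0 HgK HK Hs0 Hps HB1 HsB). lra.
Qed.

(** Left of the maximum the one-sided estimate is multiplied by [1 - t], right of it the reversed
    one by [t]. The summand 1 in the constant absorbs [t * (1 - t) * u k]. *)
Lemma concave_both u w s j k : scheme' cs ds hs u w -> 0 < s -> psi2 s <= d0 / d1 ->
  max_at u N j -> 0 <= u 0%nat -> 0 <= u N -> (k <= N)%nat ->
  grid N k * (1 - grid N k) * u j <= (c1 / (s * c0) + 1) * u k.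
Proof.
  intros Hs Hs0 Hps Hmax H0 HN0 Hk.
  assert (HC : 0 < c1 / (s * c0)) by (apply Rdiv_lt_0_compat; [lra|nra]).
  assert (Ht0 : 0 <= grid N k).
  { rewrite <- (grid_0 N). apply grid_le; [exact N_pos|lia]. }
  assert (Ht1 : grid N k <= 1).
  { rewrite <- (grid_N N N_pos). now apply grid_le; [exact N_pos|]. }
  pose proof (proj2 Hmax k Hk) as Hkm. pose proof (proj2 Hmax 0%nat ltac:(lia)) as H0m.
  destruct (Nat.le_gt_cases k j) as [Hkj|Hkj].
  - pose proof (concave_left Hq Hg Hc0 Hd0 Hc1 Hd1 N_pos Hs s j k Hs0 Hps Hmax H0 Hkj) as HL.
    set (C := c1 / (s * c0)) in *. set (t := grid N k) in *.
    assert (Hu : 0 <= u k) by nra.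
    assert (HA : (1 - t) * (t * (u j - u k)) <= (1 - t) * (C * u k))
      by (apply Rmult_le_compat_l; lra).
    assert (HB : (1 - t) * (C * u k) <= 1 * (C * u k))
      by (apply Rmult_le_compat_r; [nra|lra]).
    assert (HD : t * (1 - t) * u k <= 1 * u k) by (apply Rmult_le_compat_r; nra).
    lra.
  - pose proof (scheme_rev Hq N_pos Hs) as Hr.
    pose proof (concave_left Hq Hg Hc0 Hd0 Hc1 Hd1 N_pos Hr s (N - j) (N - k) Hs0 Hps (max_at_rev _ _ _ Hmax)) as HL.
    destruct Hmax as [HjN _].
    cbv beta in HL. replace (N - (N - j))%nat with j in HL by lia.
    replace (N - (N - k))%nat with k in HL by lia.
    replace (N - 0)%nat with N in HL by lia.
    specialize (HL HN0 ltac:(lia)). rewrite grid_sub in HL by (lia || exact N_pos).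
    set (C := c1 / (s * c0)) in *. set (t := grid N k) in *.
    assert (Hu : 0 <= u k) by nra.
    assert (HA : t * ((1 - t) * (u j - u k)) <= t * (C * u k))
      by (apply Rmult_le_compat_l; lra).
    assert (HB : t * (C * u k) <= 1 * (C * u k))
      by (apply Rmult_le_compat_r; [nra|lra]).
    assert (HD : t * (1 - t) * u k <= 1 * u k) by (apply Rmult_le_compat_r; nra).
    lra.
Qed.

(** If [u N >= 0], then [concave_both] keeps [u] above a fixed fraction of [m] on [[a0, b0]], where
    [h >= eta]; there [w] loses so much that its modulus is large at one end of the interval. By
    monotonicity of [w] it is then large all the way to the nearer endpoint of the unit interval,
    and [u] would vary by more than [m]. *)
Lemma right_end_negative u w j m s K A a0 b0 eta :
  scheme' cs ds hs u w -> u 0%nat = 0 -> max_at u N j -> u j = m -> 0 < m ->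
  0 < s -> psi2 s <= d0 / d1 ->
  0 < a0 < b0 -> b0 < 1 -> 0 < eta -> (forall x, a0 <= x <= b0 -> eta <= h x) ->
  / INR N <= (b0 - a0) / 4 ->
  0 <= K -> 0 < A -> c1 < A * a0 -> c1 < A * (1 - b0) ->
  2 * d1 * psi2 A <=
    (b0 - a0) / 4 * eta * K * psi1 (a0 * (1 - b0) / (c1 / (s * c0) + 1)) ->
  (forall x, a0 * (1 - b0) / (c1 / (s * c0) + 1) * m <= x <= m -> K * phi x <= g x) ->
  u N < 0.
Proof.
  intros Hs Hu0 Hmax Hm Hm0 Hs0 Hps Hab Hb1 Heta Hheta HNl HK HA HA1 HA2 HKbig HgK.
  apply Rnot_le_lt. intros HuN.
  pose proof (fun k => concave_both u w s j k Hs Hs0 Hps Hmax ltac:(lra) HuN) as Hconc.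
  assert (HC : 0 < c1 / (s * c0)) by (apply Rdiv_lt_0_compat; [lra|nra]).
  set (C := c1 / (s * c0)) in *. rewrite Hm in Hconc.
  set (rho := a0 * (1 - b0) / (C + 1)) in *.
  assert (Hrho : 0 < rho) by (apply Rdiv_lt_0_compat; nra).
  (* Of the length [4 * l], a margin [l] at either end keeps the two-cell neighbourhoods inside
     [[a0, b0]], rounding costs at most another [l], and at least [l] remains between [ka] and
     [kb]. *)
  set (l := (b0 - a0) / 4) in *. assert (Hl : 0 < l) by (unfold l; lra).
  pose proof (inv_N_pos N N_pos) as HiN.
  set (ka := nfloor ((a0 + l) * INR N)). set (kb := nfloor ((b0 - l) * INR N)).
  pose proof (nfloor_grid N (a0 + l) N_pos ltac:(lra)) as Hka. fold ka in Hka.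
  pose proof (nfloor_grid N (b0 - l) N_pos ltac:(unfold l; lra)) as Hkb. fold kb in Hkb.
  assert (Hlen : l <= grid N kb - grid N ka) by (unfold l in *; lra).
  assert (Hkab : (ka < kb)%nat) by (apply (grid_lt_inv N); [exact N_pos|lra]).
  assert (HkbN : (kb < N)%nat).
  { apply (grid_lt_inv N); [exact N_pos|]. rewrite (grid_N N N_pos). lra. }
  assert (Hphim : 0 < phi m) by (eapply phi_pos; eassumption).
  assert (Hps1 : 0 < psi1 rho) by now apply (psi1_pos _ _ _ _ _ Hq).
  assert (Hps2 : 0 < psi2 A) by now apply (psi2_pos _ _ _ _ _ Hq).
  (* [y] is a value of [w] that forces speed at least [A * m / c1]; kept up for a time [t] with
     [c1 < A * t], it moves [u] by more than [m]. *)
  set (y := d1 * (psi2 A * phi m)).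
  assert (Hy : 0 <= y).
  { unfold y. apply Rmult_le_pos; [lra|]. apply Rmult_le_pos; lra. }
  assert (Hqy : A * m <= q (y / d1)).
  { replace (y / d1) with (psi2 A * phi m) by (unfold y; field; lra).
    rewrite <- (q_phi _ _ _ _ _ Hq m) at 1. apply (q_psi2 _ _ _ _ _ Hq); lra. }
  assert (Hbig : forall t, c1 < A * t -> 0 <= t -> m < t * (q (y / d1) / c1)).
  { intros t Ht Ht0. apply Rlt_le_trans with (t * (A * m / c1)).
    - replace (t * (A * m / c1)) with (A * t * m / c1) by (field; lra).
      apply Rmult_lt_reg_r with c1; [lra|].
      replace (A * t * m / c1 * c1) with (A * t * m) by (field; lra). nra.
    - apply Rmult_le_compat_l; [exact Ht0|]. apply Rmult_le_compat_r; [|exact Hqy].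
      left. apply Rinv_0_lt_compat. lra. }
  assert (Hdrop : 2 * y <= w ka - w kb).
  { set (v := eta * (K * (phi m * psi1 rho))).
    assert (Hv : 0 <= v).
    { unfold v. repeat apply Rmult_le_pos; lra. }
    apply Rle_trans with ((grid N kb - grid N ka) * v).
    - apply Rle_trans with (l * v).
      + unfold y, v. replace (2 * (d1 * (psi2 A * phi m))) with (2 * d1 * psi2 A * phi m) by ring.
        replace (l * (eta * (K * (phi m * psi1 rho)))) with (l * eta * K * psi1 rho * phi m) by ring.
        apply Rmult_le_compat_r; [lra|exact HKbig].
      + apply Rmult_le_compat_r; lra.
    - pose proof (telescope_le (fun k => grid N k * v) (fun k => - w k) ka kb ltac:(lia)) as T.
      simpl in T.
      enough (grid N kb * v - grid N ka * v <= - w kb - - w ka) by lra.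
      apply T. intros i Hi. rewrite grid_S.
      replace (- w (S i) - - w i) with (- (w (S i) - w i)) by ring.
      rewrite (sch_w _ _ _ _ _ _ _ _ _ _ _ _ Hs i ltac:(lia)).
      assert (Hi1 : grid N ka <= grid N i) by (apply grid_le; [exact N_pos|lia]).
      assert (Hi2 : grid N (S i) <= grid N kb) by (apply grid_le; [exact N_pos|lia]).
      rewrite grid_S in Hi2.
      assert (Hhs' : eta <= hs (S i)).
      { apply (proj2 (Hhs (S i) ltac:(lia))). intros x Hx Hxi. rewrite grid_S in Hxi.
        apply Hheta. unfold l in *. lra. }
      assert (Hui : rho * m <= u (S i)).
      { pose proof (Hconc (S i) ltac:(lia)) as Hci. rewrite grid_S in Hci.
        set (t := grid N i + / INR N) in *.
        assert (Ht : a0 <= t <= b0) by (unfold t, l in *; lra).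
        unfold rho. replace (a0 * (1 - b0) / (C + 1) * m)
          with (a0 * (1 - b0) * m / (C + 1)) by (field; lra).
        apply Rle_div_iff; [lra|].
        assert (a0 * (1 - b0) <= t * (1 - t)) by nra. nra. }
      assert (Hgi : K * (phi m * psi1 rho) <= g (u (S i))).
      { apply Rle_trans with (K * phi (u (S i))).
        - apply Rmult_le_compat_l; [exact HK|]. apply Rle_trans with (phi (m * rho)).
          + apply (phi_ge _ _ _ _ _ Hq); lra.
          + eapply phi_le; [eassumption|]. lra.
        - apply HgK. split; [exact Hui|]. rewrite <- Hm. apply Hmax. lia. }
      assert (v <= hs (S i) * g (u (S i))).
      { unfold v. apply Rmult_le_compat; [lra| |exact Hhs'|exact Hgi].
        repeat apply Rmult_le_pos; lra. }
      nra. }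
  (* A drop of [2 * y] leaves either [w ka >= y], a steep rise before [ka], or [w kb <= - y], a
     steep descent after [kb], treated by reversal. *)
  destruct (Rle_lt_dec y (w ka)) as [Hcase|Hcase].
  - assert (Hr : (grid N (S ka) - grid N 0) * (q (y / d1) / c1) <= u (S ka) - u 0%nat).
    { apply (rise_ge Hq Hc0 Hd0 Hc1 Hd1 N_pos Hs); [lia|exact Hy|].
      intros i Hi. apply Rle_trans with (w ka); [exact Hcase|].
      apply (w_noninc Hg N_pos Hs). lia. }
    rewrite grid_0, grid_S in Hr.
    pose proof (proj2 Hmax (S ka) ltac:(lia)) as Hmk.
    specialize (Hbig (grid N ka + / INR N) ltac:(nra) ltac:(lra)). lra.
  - assert (Hcase' : y <= - w kb) by lra.
    pose proof (scheme_rev Hq N_pos Hs) as Hrev.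
    assert (Hr : (grid N (N - kb) - grid N 0) * (q (y / d1) / c1)
      <= u (N - (N - kb))%nat - u (N - 0)%nat).
    { refine (rise_ge Hq Hc0 Hd0 Hc1 Hd1 N_pos Hrev
        0 (N - kb) y _ Hy _); [lia|].
      intros i Hi. apply Rle_trans with (- w kb); [exact Hcase'|].
      apply Ropp_le_contravar. apply (w_noninc Hg N_pos Hs). lia. }
    rewrite grid_0, grid_sub in Hr by (lia || exact N_pos).
    replace (N - (N - kb))%nat with kb in Hr by lia.
    replace (N - 0)%nat with N in Hr by lia.
    pose proof (proj2 Hmax kb ltac:(lia)) as Hmk.
    specialize (Hbig (1 - grid N kb) ltac:(nra) ltac:(lra)). lra.
Qed.

(** * The intermediate value argument in the initial slope *)

Hypothesis Hgc : continuity g.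
Hypothesis Hcs : forall k, (k < N)%nat -> c0 <= cs k <= c1.
Hypothesis Hds : forall k, (k < N)%nat -> d0 <= ds k <= d1.

Lemma shoot_scheme p :
  scheme' cs ds hs (fun k => fst (shoot q g N cs ds hs p k))
    (fun k => snd (shoot q g N cs ds hs p k)).
Proof.
  split.
  - intros k _. simpl. ring.
  - intros k _. simpl. ring.
  - exact Hcs.
  - exact Hds.
  - intros k Hk. apply (proj2 (Hhs k Hk)). intros x Hx _. now apply Hh0.
Qed.

(** The sign [sg] covers the situations of (a) and (b) together. The two implications serve twice:
    they give opposite signs at [p1] and [p2], and at the zero found in between they exclude a
    maximum outside [(lo, hi)]. *)
Lemma discrete_solution lo hi (sg : R) : 0 < lo -> 0 < hi -> sg <> 0 ->
  (forall u w j, scheme' cs ds hs u w -> u 0%nat = 0 -> max_at u N j -> 0 < u j <= lo ->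
     0 < sg * u N) ->
  (forall u w j, scheme' cs ds hs u w -> u 0%nat = 0 -> max_at u N j -> hi <= u j ->
     sg * u N < 0) ->
  exists u w, scheme' cs ds hs u w /\ u 0%nat = 0 /\ u N = 0 /\
    exists j, max_at u N j /\ lo < u j < hi.
Proof.
  intros Hlo Hhi Hsg Hsmall Hlarge.
  set (U := fun p k => fst (shoot q g N cs ds hs p k)).
  set (W := fun p k => snd (shoot q g N cs ds hs p k)).
  assert (HS : forall p, scheme' cs ds hs (U p) (W p)) by (intros p; apply shoot_scheme).
  assert (HU0 : forall p, U p 0%nat = 0) by reflexivity.
  pose proof (inv_N_pos N N_pos) as HiN.
  assert (HUc : forall k, continuity (fun p => U p k)).
  { intros k. apply shoot_continuity; [apply (q_cont _ _ _ _ _ Hq)|exact Hgc]. }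
  assert (HU1 : forall p, U p 1%nat = / INR N * (q (p / ds 0%nat) / cs 0%nat)).
  { intros p. unfold U. simpl. ring. }
  assert (Hcs0 : 0 < cs 0%nat) by (pose proof (Hcs 0%nat N_pos); lra).
  assert (Hds0 : 0 < ds 0%nat) by (pose proof (Hds 0%nat N_pos); lra).
  assert (Hpos : forall p j, 0 < p -> max_at (U p) N j -> 0 < U p j).
  { intros p j Hp Hmax. apply Rlt_le_trans with (U p 1%nat); [|apply Hmax; lia].
    rewrite HU1. apply Rmult_lt_0_compat; [exact HiN|]. apply Rdiv_lt_0_compat; [|exact Hcs0].
    rewrite <- (q_0 Hq). apply (q_lt _ _ _ _ _ Hq).
    now apply Rdiv_lt_0_compat. }
  (* For [p = 0] the slope starts at 0 and can only decrease; by continuity at the finitely many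
     nodes, small positive [p] then keeps the maximum below [lo]. *)
  assert (Hat0 : forall k, (k <= N)%nat -> U 0 k <= 0).
  { intros k Hk.
    assert (Hr : U 0 k - U 0 0%nat <= (grid N k - grid N 0) * (q (0 / d0) / c0)).
    { apply (rise_le Hq Hc0 Hd0 N_pos (HS 0)); [lia|lra|].
      intros i Hi. replace 0 with (W 0 0%nat) by reflexivity.
      apply (w_noninc Hg N_pos (HS 0)). lia. }
    rewrite HU0 in Hr. replace (0 / d0) with 0 in Hr by (field; lra).
    rewrite (q_0 Hq) in Hr. unfold Rdiv in Hr. lra. }
  assert (Hp1 : exists p1, 0 < p1 /\ forall k, (k <= N)%nat -> U p1 k <= lo).
  { assert (Hn : forall K, (K <= N)%nat -> exists del, 0 < del /\
      forall p, 0 < p < del -> forall k, (k <= K)%nat -> U p k <= lo).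
    { induction K as [|K IH]; intros HK.
      - exists 1. split; [lra|]. intros p Hp k Hk. replace k with 0%nat by lia.
        rewrite HU0. lra.
      - destruct (IH ltac:(lia)) as [del [Hdel Hd]].
        destruct (HUc (S K) 0 lo Hlo) as [del' [Hdel' Hd']].
        exists (Rmin del del'). split; [now apply Rmin_pos|].
        intros p Hp k Hk. pose proof (Rmin_l del del'). pose proof (Rmin_r del del').
        destruct (Nat.eq_dec k (S K)) as [->|Hne].
        + assert (Hcl : R_dist (U p (S K)) (U 0 (S K)) < lo).
          { apply Hd'. split; [split; [exact I|lra]|]. simpl. unfold R_dist.
            rewrite Rminus_0_r, Rabs_pos_eq; lra. }
          unfold R_dist in Hcl. apply Rabs_def2 in Hcl.
          specialize (Hat0 (S K) HK). lra.
        + apply Hd; [lra|lia]. }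
    destruct (Hn N (Nat.le_refl N)) as [del [Hdel Hd]].
    exists (del / 2). split; [lra|]. intros k Hk. apply Hd; [lra|exact Hk]. }
  destruct Hp1 as [p1 [Hp1 Hp1']].
  assert (Hs1 : 0 < sg * U p1 N).
  { destruct (max_at_exists (U p1) N) as [j Hj].
    apply (Hsmall (U p1) (W p1) j); [apply HS|apply HU0|exact Hj|].
    split; [now apply Hpos|]. apply Hp1'. apply Hj. }
  (* Chosen so that the first step alone reaches exactly [hi]. *)
  set (p2 := ds 0%nat * phi (hi * INR N * cs 0%nat)).
  pose proof (INR_N_pos N N_pos) as HNp.
  assert (Hp2 : 0 < p2).
  { apply Rmult_lt_0_compat; [exact Hds0|]. eapply phi_pos; [eassumption|].
    repeat apply Rmult_lt_0_compat; assumption. }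
  assert (Hs2 : sg * U p2 N < 0).
  { destruct (max_at_exists (U p2) N) as [j Hj].
    apply (Hlarge (U p2) (W p2) j); [apply HS|apply HU0|exact Hj|].
    apply Rle_trans with (U p2 1%nat); [|apply Hj; lia].
    rewrite HU1. unfold p2.
    replace (ds 0%nat * phi (hi * INR N * cs 0%nat) / ds 0%nat)
      with (phi (hi * INR N * cs 0%nat)) by (field; lra).
    rewrite (q_phi _ _ _ _ _ Hq). right. field. lra. }
  assert (Hroot : exists p, 0 < p /\ U p N = 0).
  { assert (Hmul : U p1 N * U p2 N <= 0).
    { assert (0 < sg * sg) by nra.
      assert (sg * sg * (U p1 N * U p2 N) < 0).
      { replace (sg * sg * (U p1 N * U p2 N)) with (sg * U p1 N * (sg * U p2 N)) by ring. nra. }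
      apply Rnot_lt_le. intros Hc. nra. }
    (* Nothing orders [p1] and [p2]; either way the zero lies between two positive numbers. *)
    destruct (Rle_lt_dec p1 p2) as [Hle|Hlt].
    - destruct (IVT_cor (fun p => U p N) p1 p2 (HUc N) Hle Hmul) as [p [Hp Ep]].
      exists p. split; [lra|exact Ep].
    - destruct (IVT_cor (fun p => U p N) p2 p1 (HUc N)) as [p [Hp Ep]];
        [lra|lra|]. exists p. split; [lra|exact Ep]. }
  destruct Hroot as [p [Hp Ep]].
  exists (U p), (W p). split; [apply HS|]. split; [apply HU0|]. split; [exact Ep|].
  destruct (max_at_exists (U p) N) as [j Hj]. exists j. split; [exact Hj|].
  split; apply Rnot_le_lt; intros Hc.
  - specialize (Hsmall (U p) (W p) j (HS p) (HU0 p) Hj). rewrite Ep in Hsmall.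
    assert (0 < sg * 0); [|lra]. apply Hsmall. split; [now apply Hpos|exact Hc].
  - specialize (Hlarge (U p) (W p) j (HS p) (HU0 p) Hj Hc). rewrite Ep in Hlarge. lra.
Qed.

End TwoSided.

Arguments cell_inf_rev {h n N hs} HNn Hhs.
Arguments right_end_positive {phi psi1 psi2 q Psi g c0 c1 d0 d1} Hq Hc0 Hd0 {h H1 P1 H2 P2} Hh0 HW1 HW2 {n N cs ds hs} HNn Hhs {u w}.
Arguments right_end_negative {phi psi1 psi2 q Psi g c0 c1 d0 d1} Hq Hg Hc0 Hd0 Hc1 Hd1 {h n N cs ds hs} HNn Hhs {u w}.
Arguments concave_both {phi psi1 psi2 q Psi g c0 c1 d0 d1} Hq Hg Hc0 Hd0 Hc1 Hd1 {n N cs ds hs} HNn {u w}.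
Arguments discrete_solution {phi psi1 psi2 q Psi g c0 c1 d0 d1} Hq Hg Hc0 Hd0 {h} Hh0 {n N cs ds hs} HNn Hhs.

(** * Convergence of grid functions near a point *)

Lemma telescope_abs N (x : nat -> R) v e i j : (i <= j)%nat ->
  (forall k, (i <= k < j)%nat -> Rabs (x (S k) - x k - / INR N * v) <= / INR N * e) ->
  Rabs (x j - x i - (grid N j - grid N i) * v) <= (grid N j - grid N i) * e.
Proof.
  intros Hij H.
  pose proof (telescope_le (fun k => x k - grid N k * v) (fun k => grid N k * e) i j Hij) as T1.
  pose proof (telescope_le (fun k => grid N k * v - x k) (fun k => grid N k * e) i j Hij) as T2.
  simpl in T1, T2.
  assert (A : forall k, (i <= k < j)%nat ->
    x (S k) - grid N (S k) * v - (x k - grid N k * v) <= grid N (S k) * e - grid N k * e /\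
    grid N (S k) * v - x (S k) - (grid N k * v - x k) <= grid N (S k) * e - grid N k * e).
  { intros k Hk. specialize (H k Hk). rewrite grid_S. apply Rabs_le_between in H. lra. }
  apply Rabs_le.
  specialize (T1 (fun k Hk => proj1 (A k Hk))). specialize (T2 (fun k Hk => proj2 (A k Hk))).
  lra.
Qed.

Section Near.
Variable UF : (nat -> Prop) -> Prop.
Hypothesis HU : ultra UF.
Variable Nn : nat -> nat.
Hypothesis HNpos : forall n, (0 < Nn n)%nat.
Hypothesis HNinf : forall e, 0 < e -> exists n0, forall n, (n0 <= n)%nat -> / INR (Nn n) < e.

(** The radius is chosen before the index [n], so [near_lim] is convergence at all nodes of a fixed
    small interval, as difference quotients require, whereas [point_lim] looks at a single node for
    each [t]. *)
Definition near (t0 : R) (Q : nat -> nat -> Prop) : Prop :=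
  exists del, 0 < del /\ UF (fun n => forall k, Rabs (grid (Nn n) k - t0) < del -> Q n k).

Definition near_lim (t0 : R) (x : nat -> nat -> R) (l : R) : Prop :=
  forall e, 0 < e -> near t0 (fun n k => Rabs (x n k - l) < e).

Definition point_lim (x : nat -> nat -> R) (t l : R) : Prop :=
  forall e, 0 < e -> UF (fun n => Rabs (x n (nfloor (t * INR (Nn n))) - l) < e).

Lemma UF_small e : 0 < e -> UF (fun n => / INR (Nn n) < e).
Proof.
  intros He. destruct (HNinf e He) as [n0 H]. exact (ultra_ev UF HU _ n0 H).
Qed.

Lemma near_mono t0 (Q Q' : nat -> nat -> Prop) :
  (forall n k, Q n k -> Q' n k) -> near t0 Q -> near t0 Q'.
Proof.
  intros HQ [del [Hdel H]]. exists del. split; [exact Hdel|].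
  apply (ultra_mono UF HU _ _) with (2 := H). intros n Hn k Hk. apply HQ. now apply Hn.
Qed.

Lemma near_and t0 (Q Q' : nat -> nat -> Prop) :
  near t0 Q -> near t0 Q' -> near t0 (fun n k => Q n k /\ Q' n k).
Proof.
  intros [del [Hdel H]] [del' [Hdel' H']]. exists (Rmin del del').
  split; [now apply Rmin_pos|].
  apply (ultra_mono UF HU _ _) with (2 := ultra_and UF HU _ _ H H').
  intros n [Hn Hn'] k Hk. pose proof (Rmin_l del del'). pose proof (Rmin_r del del').
  split; [apply Hn|apply Hn']; lra.
Qed.

Lemma near_ball t0 del (Q : nat -> nat -> Prop) : 0 < del ->
  (forall n k, / INR (Nn n) < del -> Rabs (grid (Nn n) k - t0) < del -> Q n k) -> near t0 Q.
Proof.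
  intros Hdel HQ. exists del. split; [exact Hdel|].
  apply (ultra_mono UF HU _ _) with (2 := UF_small del Hdel).
  intros n Hn k Hk. now apply HQ.
Qed.

Lemma iN_pos n : 0 < / INR (Nn n).
Proof. apply Rinv_0_lt_compat, lt_0_INR, HNpos. Qed.

Lemma near_S t0 (Q : nat -> nat -> Prop) : near t0 Q -> near t0 (fun n k => Q n (S k)).
Proof.
  intros [del [Hdel H]]. exists (del / 2). split; [lra|].
  apply (ultra_mono UF HU _ _) with (2 := ultra_and UF HU _ _ H (UF_small (del / 2) ltac:(lra))).
  intros n [Hn Hs] k Hk. apply Hn. rewrite grid_S. pose proof (iN_pos n).
  apply Rabs_def2 in Hk. apply Rabs_def1; lra.
Qed.

Lemma near_interior t0 : 0 < t0 < 1 ->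
  near t0 (fun n k => (0 < k)%nat /\ (S k < Nn n)%nat /\ 0 < grid (Nn n) k < 1 /\
    t0 / 2 < grid (Nn n) k /\ (1 - t0) / 2 < 1 - grid (Nn n) k).
Proof.
  intros Ht. set (del := Rmin (t0 / 2) ((1 - t0) / 4)).
  assert (Hdel : 0 < del) by (apply Rmin_pos; lra).
  pose proof (Rmin_l (t0 / 2) ((1 - t0) / 4)) as Hl.
  pose proof (Rmin_r (t0 / 2) ((1 - t0) / 4)) as Hr. fold del in Hl, Hr.
  apply (near_ball t0 del); [exact Hdel|]. intros n k Hn Hk. apply Rabs_def2 in Hk.
  repeat split; try lra.
  - apply (grid_lt_inv (Nn n)); [apply HNpos|]. rewrite grid_0. lra.
  - apply (grid_lt_inv (Nn n)); [apply HNpos|]. rewrite grid_S, (grid_N _ (HNpos n)). lra.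
Qed.

Lemma near_lim_S t0 x l : near_lim t0 x l -> near_lim t0 (fun n k => x n (S k)) l.
Proof. intros H e He. apply (near_S t0 (fun n k => Rabs (x n k - l) < e)). now apply H. Qed.

Lemma near_lim_grid t0 : near_lim t0 (fun n k => grid (Nn n) k) t0.
Proof. intros e He. now apply (near_ball t0 e). Qed.

Lemma near_lim_cont t0 x l f :
  continuity_pt f l -> near_lim t0 x l -> near_lim t0 (fun n k => f (x n k)) (f l).
Proof.
  intros Hf Hx e He. destruct (Hf e He) as [del [Hdel Hd]].
  apply (near_mono t0 _ _) with (2 := Hx del Hdel). intros n k Hk.
  destruct (Req_dec (x n k) l) as [->|Hne].
  - rewrite Rminus_diag, Rabs_R0. exact He.
  - apply (Hd (x n k)). split; [split; [exact I|]|exact Hk]. intros E. apply Hne. now symmetry.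
Qed.

Lemma near_lim_mult t0 x y l m :
  near_lim t0 x l -> near_lim t0 y m -> near_lim t0 (fun n k => x n k * y n k) (l * m).
Proof.
  intros Hx Hy e He.
  set (D := Rabs l + Rabs m + 1).
  pose proof (Rabs_pos l). pose proof (Rabs_pos m).
  set (r := Rmin 1 (e / (2 * D))).
  assert (HD : 0 < e / (2 * D)) by (apply Rdiv_lt_0_compat; unfold D; lra).
  assert (Hr : 0 < r) by (apply Rmin_pos; lra).
  pose proof (Rmin_l 1 (e / (2 * D))) as Hr1. pose proof (Rmin_r 1 (e / (2 * D))) as Hr2.
  fold r in Hr1, Hr2.
  apply (near_mono t0 _ _) with (2 := near_and t0 _ _ (Hx r Hr) (Hy r Hr)).
  intros n k [H1 H2].
  replace (x n k * y n k - l * m)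
    with ((x n k - l) * (y n k - m) + l * (y n k - m) + (x n k - l) * m) by ring.
  eapply Rle_lt_trans; [eapply Rle_trans; [apply Rabs_triang|
    apply Rplus_le_compat_r, Rabs_triang]|].
  rewrite !Rabs_mult.
  pose proof (Rabs_pos (x n k - l)). pose proof (Rabs_pos (y n k - m)).
  assert (Rabs (x n k - l) * Rabs (y n k - m) <= r * 1) by nra.
  assert (Rabs l * Rabs (y n k - m) <= Rabs l * r) by nra.
  assert (Rabs (x n k - l) * Rabs m <= r * Rabs m) by nra.
  assert (r * D <= e / 2).
  { apply Rle_trans with (e / (2 * D) * D).
    - apply Rmult_le_compat_r; [unfold D; lra|exact Hr2].
    - right. field. unfold D. lra. }
  unfold D in *. lra.
Qed.

Lemma near_lim_opp t0 x l : near_lim t0 x l -> near_lim t0 (fun n k => - x n k) (- l).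
Proof.
  intros H e He. apply (near_mono t0 _ _) with (2 := H e He). intros n k Hk.
  replace (- x n k - - l) with (- (x n k - l)) by ring. now rewrite Rabs_Ropp.
Qed.

Lemma near_lim_bounded t0 x l : near_lim t0 x l -> near t0 (fun n k => Rabs (x n k) <= Rabs l + 1).
Proof.
  intros H. apply (near_mono t0 _ _) with (2 := H 1 Rlt_0_1). intros n k Hk.
  replace (x n k) with (x n k - l + l) by ring.
  eapply Rle_trans; [apply Rabs_triang|]. lra.
Qed.

Lemma nfloor_near n t : 0 <= t ->
  t - / INR (Nn n) < grid (Nn n) (nfloor (t * INR (Nn n))) <= t.
Proof. intros Ht. pose proof (nfloor_grid (Nn n) t (HNpos n) Ht). lra. Qed.

Lemma between_close n t0 del i j k : (i <= k <= j)%nat ->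
  Rabs (grid (Nn n) i - t0) < del -> Rabs (grid (Nn n) j - t0) < del ->
  Rabs (grid (Nn n) k - t0) < del.
Proof.
  intros Hk Hi Hj. apply Rabs_def2 in Hi. apply Rabs_def2 in Hj.
  pose proof (grid_le (Nn n) i k (HNpos n) ltac:(lia)).
  pose proof (grid_le (Nn n) k j (HNpos n) ltac:(lia)).
  apply Rabs_def1; lra.
Qed.

Lemma increments_close n t0 del (x : nat -> R) v e i j :
  (forall k, Rabs (grid (Nn n) k - t0) < del ->
     Rabs (x (S k) - x k - / INR (Nn n) * v) <= / INR (Nn n) * e) ->
  Rabs (grid (Nn n) i - t0) < del -> Rabs (grid (Nn n) j - t0) < del ->
  Rabs (x j - x i - (grid (Nn n) j - grid (Nn n) i) * v)
    <= Rabs (grid (Nn n) j - grid (Nn n) i) * e.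
Proof.
  intros H Hi Hj. destruct (Nat.le_gt_cases i j) as [Hij|Hij].
  - rewrite (Rabs_pos_eq (grid (Nn n) j - grid (Nn n) i))
      by (pose proof (grid_le (Nn n) i j (HNpos n) Hij); lra).
    apply telescope_abs; [exact Hij|]. intros k Hk. apply H.
    apply (between_close n t0 del i j); (lia || assumption).
  - rewrite (Rabs_left1 (grid (Nn n) j - grid (Nn n) i))
      by (pose proof (grid_le (Nn n) j i (HNpos n) ltac:(lia)); lra).
    replace (x j - x i - (grid (Nn n) j - grid (Nn n) i) * v)
      with (- (x i - x j - (grid (Nn n) i - grid (Nn n) j) * v)) by ring.
    rewrite Rabs_Ropp, Ropp_minus_distr.
    apply telescope_abs; [lia|]. intros k Hk. apply H.
    apply (between_close n t0 del j i); (lia || assumption).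
Qed.

(** A Lipschitz bound uniform in [n] carries the limit at one node over to all nodes nearby; this
    takes the place of equicontinuity. *)
Lemma near_lim_of_point t0 x l L : 0 < t0 -> 0 <= L -> point_lim x t0 l ->
  near t0 (fun n k => Rabs (x n (S k) - x n k) <= / INR (Nn n) * L) -> near_lim t0 x l.
Proof.
  intros Ht HL Hl [del [Hdel H]] e He.
  set (r := Rmin del (e / (4 * (L + 1)))).
  assert (He' : 0 < e / (4 * (L + 1))) by (apply Rdiv_lt_0_compat; lra).
  assert (Hr : 0 < r) by (apply Rmin_pos; lra).
  pose proof (Rmin_l del (e / (4 * (L + 1)))) as Hr1.
  pose proof (Rmin_r del (e / (4 * (L + 1)))) as Hr2. fold r in Hr1, Hr2.
  exists r. split; [exact Hr|].
  apply (ultra_mono UF HU _ _) with (2 := ultra_and UF HU _ _ H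
    (ultra_and UF HU _ _ (Hl (e / 2) ltac:(lra)) (UF_small r Hr))).
  intros n (H1 & H2 & H3) k Hk.
  set (j := nfloor (t0 * INR (Nn n))) in *.
  pose proof (nfloor_near n t0 ltac:(lra)) as Hj. fold j in Hj.
  assert (Hjr : Rabs (grid (Nn n) j - t0) < r) by (apply Rabs_def1; lra).
  pose proof (increments_close n t0 del (x n) 0 L j k) as Hinc.
  assert (Hx : Rabs (x n k - x n j - (grid (Nn n) k - grid (Nn n) j) * 0)
    <= Rabs (grid (Nn n) k - grid (Nn n) j) * L).
  { apply Hinc; [|lra|lra]. intros i Hi. rewrite Rmult_0_r, Rminus_0_r. now apply H1. }
  rewrite Rmult_0_r, Rminus_0_r in Hx.
  assert (Hg : Rabs (grid (Nn n) k - grid (Nn n) j) <= 2 * r).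
  { apply Rabs_def2 in Hk. apply Rabs_def2 in Hjr. apply Rabs_le. lra. }
  assert (HrL : 2 * r * L <= e / 2).
  { apply Rle_trans with (2 * (e / (4 * (L + 1))) * (L + 1)).
    - nra.
    - right. field. lra. }
  replace (x n k - l) with (x n k - x n j + (x n j - l)) by ring.
  eapply Rle_lt_trans; [apply Rabs_triang|]. nra.
Qed.

(** Between two nodes near [t0] the increment of [x] is a sum of values of [y], all within [eps / 2]
    of [v]. For each fixed [a] this bound passes to [X (t0 + a) - X t0]. *)
Lemma point_lim_derivable x X t0 v y : 0 < t0 < 1 ->
  (forall t, 0 < t < 1 -> point_lim x t (X t)) ->
  near t0 (fun n k => x n (S k) - x n k = / INR (Nn n) * y n k) ->
  near_lim t0 y v -> derivable_pt_lim X t0 v.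
Proof.
  intros Ht0 HX Hxy Hy eps Heps.
  destruct (near_and t0 _ _ Hxy (Hy (eps / 2) ltac:(lra))) as [del [Hdel Hd]].
  set (r := Rmin (del / 2) (Rmin (t0 / 2) ((1 - t0) / 2))).
  assert (Hr : 0 < r) by (unfold r; repeat apply Rmin_pos; lra).
  assert (Hr1 : r <= del / 2) by apply Rmin_l.
  assert (Hr2 : r <= t0 / 2) by (eapply Rle_trans; [apply Rmin_r|apply Rmin_l]).
  assert (Hr3 : r <= (1 - t0) / 2) by (eapply Rle_trans; [apply Rmin_r|apply Rmin_r]).
  exists (mkposreal r Hr). intros a Ha Har. simpl in Har.
  assert (Hkey : Rabs (X (t0 + a) - X t0 - a * v) <= eps / 2 * Rabs a).
  (* With [a] and [eta] fixed, one sufficiently good index [n] is enough; [z] is small enough to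
     absorb the errors of the two values and of the rounding of [t0] and [t0 + a]. *)
  { apply le_epsilon. intros eta Heta.
    pose proof (Rabs_pos v) as Hv.
    set (z := eta / (4 * (Rabs v + eps + 1))).
    assert (Hz : 0 < z) by (apply Rdiv_lt_0_compat; lra).
    assert (Hzeta : 4 * z * (Rabs v + eps + 1) = eta) by (unfold z; field; lra).
    pose proof (Rabs_def2 _ _ Har) as Har'.
    assert (Hrd : 0 < Rmin z (del / 2)) by (apply Rmin_pos; lra).
    assert (Hall := ultra_and UF HU _ _ (ultra_and UF HU _ _ Hd (UF_small _ Hrd))
      (ultra_and UF HU _ _ (HX (t0 + a) ltac:(lra) z Hz) (HX t0 Ht0 z Hz))).
    destruct (ultra_proper UF HU _ Hall) as [n [[H1 H2] [H3 H4]]].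
    pose proof (Rmin_l z (del / 2)). pose proof (Rmin_r z (del / 2)).
    set (j1 := nfloor ((t0 + a) * INR (Nn n))) in *.
    set (j0 := nfloor (t0 * INR (Nn n))) in *.
    pose proof (nfloor_near n (t0 + a) ltac:(lra)) as Hj1. fold j1 in Hj1.
    pose proof (nfloor_near n t0 ltac:(lra)) as Hj0. fold j0 in Hj0.
    assert (Hinc : Rabs (x n j1 - x n j0 - (grid (Nn n) j1 - grid (Nn n) j0) * v)
      <= Rabs (grid (Nn n) j1 - grid (Nn n) j0) * (eps / 2)).
    { apply (increments_close n t0 del).
      - intros k Hk. destruct (H1 k Hk) as [E Hyk]. rewrite E.
        rewrite <- Rmult_minus_distr_l, Rabs_mult.
        pose proof (iN_pos n). rewrite (Rabs_pos_eq (/ INR (Nn n))) by lra.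
        apply Rmult_le_compat_l; lra.
      - apply Rabs_def1; lra.
      - apply Rabs_def1; lra. }
    set (D := grid (Nn n) j1 - grid (Nn n) j0) in *.
    assert (HDa : Rabs (D - a) <= z) by (apply Rabs_le; unfold D; lra).
    assert (HD : Rabs D <= Rabs a + z).
    { replace D with (D - a + a) by ring. eapply Rle_trans; [apply Rabs_triang|]. lra. }
    replace (X (t0 + a) - X t0 - a * v)
      with (- (x n j1 - X (t0 + a)) + (x n j0 - X t0) + (x n j1 - x n j0 - D * v) + (D - a) * v)
      by ring.
    eapply Rle_trans; [apply Rabs_triang|].
    eapply Rle_trans; [apply Rplus_le_compat_r, Rabs_triang|].
    eapply Rle_trans; [apply Rplus_le_compat_r, Rplus_le_compat_r, Rabs_triang|].
    rewrite Rabs_Ropp, Rabs_mult.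
    assert (Rabs (D - a) * Rabs v <= z * Rabs v) by nra.
    assert (Rabs D * (eps / 2) <= (Rabs a + z) * (eps / 2)) by nra.
    nra. }
  replace ((X (t0 + a) - X t0) / a - v) with ((X (t0 + a) - X t0 - a * v) * / a) by (field; exact Ha).
  assert (Hpa : 0 < Rabs a) by now apply Rabs_pos_lt.
  rewrite Rabs_mult, Rabs_inv.
  apply Rmult_lt_reg_r with (Rabs a); [exact Hpa|].
  rewrite Rmult_assoc, Rinv_l, Rmult_1_r by lra. nra.
Qed.

Lemma point_lim_le x t l B : point_lim x t l ->
  UF (fun n => x n (nfloor (t * INR (Nn n))) <= B) -> l <= B.
Proof.
  intros Hl HB. apply le_epsilon. intros e He.
  destruct (ultra_proper UF HU _ (ultra_and UF HU _ _ HB (Hl e He))) as [n [H1 H2]].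
  apply Rabs_def2 in H2. lra.
Qed.

Lemma point_lim_ge x t l B : point_lim x t l ->
  UF (fun n => B <= x n (nfloor (t * INR (Nn n)))) -> B <= l.
Proof.
  intros Hl HB. apply le_epsilon. intros e He.
  destruct (ultra_proper UF HU _ (ultra_and UF HU _ _ HB (Hl e He))) as [n [H1 H2]].
  apply Rabs_def2 in H2. lra.
Qed.

Lemma point_lim_exists x t B :
  UF (fun n => Rabs (x n (nfloor (t * INR (Nn n)))) <= B) -> exists l, point_lim x t l.
Proof. exact (ultra_lim UF (fun n => x n (nfloor (t * INR (Nn n)))) B HU). Qed.

End Near.

(** * Passage to the limit *)

Lemma derivable_pt_lim_open (f f' : R -> R) t l : 0 < t < 1 ->
  (forall x, 0 < x < 1 -> f' x = f x) -> derivable_pt_lim f t l -> derivable_pt_lim f' t l.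
Proof.
  intros Ht E Hf eps Heps. destruct (Hf eps Heps) as [del Hd].
  assert (Hr : 0 < Rmin del (Rmin t (1 - t))).
  { apply Rmin_pos; [apply cond_pos|]. apply Rmin_pos; lra. }
  exists (mkposreal _ Hr). intros a Ha Har. simpl in Har.
  pose proof (Rmin_l del (Rmin t (1 - t))). pose proof (Rmin_r del (Rmin t (1 - t))).
  pose proof (Rmin_l t (1 - t)). pose proof (Rmin_r t (1 - t)).
  pose proof (Rabs_def2 _ _ Har).
  rewrite !E by lra. apply Hd; [exact Ha|lra].
Qed.

Section Limit.
Variables (phi psi1 psi2 q Psi g : R -> R) (c0 c1 d0 d1 : R).
Hypothesis Hq : phi_inverse phi psi1 psi2 q Psi.
Hypothesis Hg : forall s, 0 <= g s.
Hypotheses (Hc0 : 0 < c0) (Hd0 : 0 < d0).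
Hypotheses (Hc1 : c0 <= c1) (Hd1 : d0 <= d1).

(** The lower bound is the upper bound of the reversed trajectory. The result does not depend on
    [N], so the limits of [w] exist and [u] is locally Lipschitz uniformly in [N]. *)
Lemma w_abs_le N cs ds hs u w m a k :
  (0 < N)%nat -> scheme q g c0 c1 d0 d1 N cs ds hs u w ->
  (forall i, (i <= N)%nat -> 0 <= u i <= m) -> (k < N)%nat -> 0 < a ->
  a <= grid N (S k) -> a <= 1 - grid N k -> Rabs (w k) <= d1 * phi (c1 * m / a).
Proof.
  intros HN Hs Hu Hk Ha Ha1 Ha2.
  assert (Hm : 0 <= m) by (specialize (Hu 0%nat ltac:(lia)); lra).
  assert (Hmono : forall b, a <= b -> d1 * phi (c1 * m / b) <= d1 * phi (c1 * m / a)).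
  { intros b Hb. apply Rmult_le_compat_l; [lra|]. apply (phi_le _ _ _ _ _ Hq).
    apply Rmult_le_compat_l; [nra|]. apply Rinv_le_contravar; lra. }
  apply Rabs_le. split.
  - pose proof (scheme_rev Hq HN Hs) as Hr.
    pose proof (w_le_of_bound Hq Hg Hc0 Hd0 Hc1 Hd1 HN Hr (N - 1 - k) m ltac:(lia) Hm) as H.
    cbv beta in H.
    replace (N - 1 - (N - 1 - k))%nat with k in H by lia.
    replace (S (N - 1 - k)) with (N - k)%nat in H by lia.
    rewrite grid_sub in H by lia.
    specialize (H (proj1 (Hu (N - 0)%nat ltac:(lia))) (proj2 (Hu (N - (N - k))%nat ltac:(lia)))).
    specialize (Hmono _ Ha2). lra.
  - pose proof (w_le_of_bound Hq Hg Hc0 Hd0 Hc1 Hd1 HN Hs k m Hk Hm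
      (proj1 (Hu 0%nat ltac:(lia))) (proj2 (Hu (S k) ltac:(lia)))) as H.
    specialize (Hmono _ Ha1). lra.
Qed.

(** [b] does not depend on [N], so the bound passes to the limit and yields continuity at the
    endpoint. Starting from a bounded slope at the middle, the remaining descent is controlled by
    the remaining time and the tail of [P]; [e] makes the sum of both at most [eps / 2]. *)
Lemma right_boundary h H P m F eps :
  right_weight Psi h H P -> (forall x, 0 < x < 1 -> 0 <= h x) -> 0 <= m -> 0 <= F -> 0 < eps ->
  exists b, 0 < b < 1 /\ forall n N cs ds hs u w, N = (2 * n + 1)%nat ->
    scheme q g c0 c1 d0 d1 N cs ds hs u w ->
    (forall k x, (0 < k < N)%nat -> 0 < x < 1 ->
       grid N k - / INR N <= x <= grid N k + / INR N -> hs k <= h x) ->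
    u N = 0 -> (forall i, (i <= N)%nat -> 0 <= u i <= m) ->
    (forall i, (i <= N)%nat -> g (u i) <= F) ->
    forall k, (k <= N)%nat -> b <= grid N k -> u k <= eps.
Proof.
  intros HW Hh0 Hm HF Heps.
  set (y := d1 * phi (c1 * m / (1/2))).
  assert (Hy : 0 <= y).
  { apply Rmult_le_pos; [lra|]. apply (phi_ge0 _ _ _ _ _ Hq). apply Rmult_le_pos; [nra|lra]. }
  assert (Hid0 : 0 < / d0) by now apply Rinv_0_lt_compat.
  set (Q1 := q (2 * y / d0)). set (Q2 := q (2 * (2 * F) / d0)).
  assert (HQ1 : 0 <= Q1) by (apply (q_ge0 _ _ _ _ _ Hq), Rmult_le_pos; lra).
  assert (HQ2 : 0 <= Q2) by (apply (q_ge0 _ _ _ _ _ Hq), Rmult_le_pos; lra).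
  set (e := eps * c0 / (2 * (Q1 + Q2 + 1))).
  assert (He : 0 < e) by (apply Rdiv_lt_0_compat; nra).
  destruct (rw_tail _ _ _ _ HW e He) as [b1 [Hb1 HPb1]].
  set (b := Rmax b1 (1 - Rmin e (1/4))).
  assert (Hmin : 0 < Rmin e (1/4)) by (apply Rmin_pos; lra).
  pose proof (Rmin_l e (1/4)) as Hml. pose proof (Rmin_r e (1/4)) as Hmr.
  assert (Hbb1 : b1 <= b) by apply Rmax_l.
  assert (Hbe : 1 - Rmin e (1/4) <= b) by apply Rmax_r.
  assert (Hb : b < 1) by (apply Rmax_lub_lt; lra).
  exists b. split; [lra|].
  intros n N cs ds hs u w HNn Hs Hhs HuN Hu HgF k Hk Hbk.
  assert (HN : (0 < N)%nat) by lia.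
  pose proof (inv_N_pos N HN) as HiN.
  (* Cell [n] is symmetric about 1/2, so [w_abs_le] applies to it with [a = 1/2] from both sides. *)
  assert (Hn2 : 1 - grid N n = grid N (S n)).
  { rewrite <- grid_sub by lia. f_equal. lia. }
  rewrite grid_S in Hn2.
  assert (Hnk : (n < k)%nat) by (apply (grid_lt_inv N); [exact HN|lra]).
  assert (Hwn : - w n <= y).
  { pose proof (w_abs_le N cs ds hs u w m (1/2) n HN Hs Hu ltac:(lia) ltac:(lra)) as Hw.
    rewrite grid_S in Hw. specialize (Hw ltac:(lra) ltac:(lra)). fold y in Hw.
    pose proof (Rle_abs (- w n)). rewrite Rabs_Ropp in H0. lra. }
  pose proof (descent_le Hq Hc0 Hd0 HN Hs HNn HW Hhs Hh0 k y (2 * F) ltac:(lia) Hy ltac:(lra)) as HD.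
  assert (HD' := HD ltac:(intros i Hi;
    pose proof (w_drop_le HN Hs HNn HW Hhs Hh0 n i F (Nat.le_refl n) ltac:(lia) HF HgF); lra)).
  clear HD. rewrite HuN, Rminus_0_r in HD'. fold Q1 Q2 in HD'.
  eapply Rle_trans; [exact HD'|].
  assert (Hk1 : grid N k <= 1) by (rewrite <- (grid_N N HN); apply grid_le; assumption).
  assert (HP : P b1 <= P (grid N k)).
  { pose proof (rw_P _ _ _ _ HW b1 (grid N k) ltac:(lra) Hk1).
    pose proof (Psi_ge0 _ _ _ _ _ Hq (H b1)). nra. }
  apply Rle_trans with (/ c0 * (e * (Q1 + Q2 + 1))).
  - apply Rmult_le_compat_l; [left; now apply Rinv_0_lt_compat|]. nra.
  - unfold e. replace (/ c0 * (eps * c0 / (2 * (Q1 + Q2 + 1)) * (Q1 + Q2 + 1))) with (eps / 2)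
      by (field; lra). lra.
Qed.

Variables (c d h H1 P1 H2 P2 : R -> R).
Hypothesis Hgc : continuity g.
Hypothesis Hh0 : forall x, 0 < x < 1 -> 0 <= h x.
Hypothesis HW1 : right_weight Psi h H1 P1.
Hypothesis HW2 : right_weight Psi (fun t => h (1 - t)) H2 P2.
Hypotheses (Hcc : cont_on_open c 0 1) (Hdc : cont_on_open d 0 1) (Hhc : cont_on_open h 0 1).
Hypothesis Hcb : forall t, 0 < t < 1 -> c0 <= c t <= c1.
Hypothesis Hdb : forall t, 0 < t < 1 -> d0 <= d t <= d1.

(** The parameter is 1 because [g] will contain the factor [lam]. The hypothesis with [lo] and [C]
    is carried along since limits alone could degenerate to the zero solution. *)
Lemma limit_solution (kn : nat -> nat) (hs u w : nat -> nat -> R) (m lo C : R) :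
  let N n := (2 * kn n + 1)%nat in
  (forall e, 0 < e -> exists n0, forall n, (n0 <= n)%nat -> / INR (N n) < e) ->
  (forall n, scheme q g c0 c1 d0 d1 (N n) (fun k => c (grid (N n) k))
     (fun k => d (grid (N n) k)) (hs n) (u n) (w n)) ->
  (forall n, cell_inf h (N n) (hs n)) ->
  (forall n, u n 0%nat = 0) -> (forall n, u n (N n) = 0) ->
  (forall n k, (k <= N n)%nat -> 0 <= u n k <= m) ->
  (forall n k, (k <= N n)%nat -> grid (N n) k * (1 - grid (N n) k) * lo <= C * u n k) ->
  exists U, is_solution phi c d h g 1 U /\
    (forall t, 0 <= t <= 1 -> 0 <= U t <= m /\ t * (1 - t) * lo <= C * U t).
Proof.
  intros N HNinf Hs Hhs Hu0 HuN Hu Hlow.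
  destruct exists_ultra as [UF HU].
  assert (HNpos : forall n, (0 < N n)%nat) by (intros n; unfold N; lia).
  assert (Hm : 0 <= m) by (specialize (Hu 0%nat 0%nat ltac:(lia)); lra).
  set (idx := fun n t => nfloor (t * INR (N n))).
  assert (Hidx : forall n t, 0 <= t -> t - / INR (N n) < grid (N n) (idx n t) <= t)
    by (intros n t Ht; now apply nfloor_near).
  assert (HidxN : forall n t, 0 <= t <= 1 -> (idx n t <= N n)%nat).
  { intros n t Ht. destruct (Nat.le_gt_cases (idx n t) (N n)) as [|Hlt]; [assumption|exfalso].
    pose proof (grid_le (N n) (S (N n)) (idx n t) (HNpos n) Hlt) as HG.
    rewrite grid_S, (grid_N _ (HNpos n)) in HG.
    pose proof (inv_N_pos (N n) (HNpos n)). specialize (Hidx n t ltac:(lra)). lra. }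
  assert (HidxN' : forall n t, 0 <= t < 1 -> (idx n t < N n)%nat).
  { intros n t Ht. apply (grid_lt_inv (N n)); [apply HNpos|].
    rewrite (grid_N _ (HNpos n)). specialize (Hidx n t ltac:(lra)). lra. }
  assert (Hall : forall P : nat -> Prop, (forall n, P n) -> UF P).
  { intros P HP. exact (ultra_ev UF HU P 0%nat (fun n _ => HP n)). }
  assert (Hsmall : forall e, 0 < e -> UF (fun n => / INR (N n) < e))
    by (apply (UF_small UF HU N HNinf)).
  assert (HexU : forall t, exists l, 0 <= t <= 1 -> point_lim UF N u t l).
  { intros t. destruct (classic (0 <= t <= 1)) as [Ht|Ht]; [|now exists 0].
    destruct (point_lim_exists UF HU N u t m) as [l Hl].
    - apply Hall. intros n. specialize (Hu n (idx n t) (HidxN n t Ht)).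
      fold (idx n t). rewrite Rabs_pos_eq; lra.
    - now exists l. }
  destruct (choice_fun _ HexU) as [U HU']. clear HexU.
  assert (HexW : forall t, exists l, 0 < t < 1 -> point_lim UF N w t l).
  { intros t. destruct (classic (0 < t < 1)) as [Ht|Ht]; [|now exists 0].
    set (a := Rmin t (1 - t)). assert (Ha : 0 < a) by (apply Rmin_pos; lra).
    pose proof (Rmin_l t (1 - t)) as Hal. pose proof (Rmin_r t (1 - t)) as Har.
    fold a in Hal, Har.
    destruct (point_lim_exists UF HU N w t (d1 * phi (c1 * m / a))) as [l Hl].
    - apply Hall. intros n. fold (idx n t). specialize (Hidx n t ltac:(lra)).
      apply (w_abs_le (N n) _ _ _ _ _ m a _ (HNpos n) (Hs n) (Hu n)).
      + apply HidxN'; lra.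
      + exact Ha.
      + rewrite grid_S; lra.
      + lra.
    - now exists l. }
  destruct (choice_fun _ HexW) as [W HW']. clear HexW.
  assert (HUb : forall t, 0 <= t <= 1 -> 0 <= U t <= m).
  { intros t Ht. split.
    - apply (point_lim_ge UF HU N u t); [now apply HU'|]. apply Hall. intros n.
      apply Hu. now apply HidxN.
    - apply (point_lim_le UF HU N u t); [now apply HU'|]. apply Hall. intros n.
      apply Hu. now apply HidxN. }
  assert (Hends : U 0 = 0 /\ U 1 = 0).
  { assert (Hz : forall t, 0 <= t <= 1 -> (forall n, u n (idx n t) = 0) -> U t = 0).
    { intros t Ht Hz. apply Rle_antisym; [|apply HUb; exact Ht].
      apply (point_lim_le UF HU N u t); [now apply HU'|]. apply Hall. intros n.
      fold (idx n t). rewrite Hz. lra. }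
    split; apply Hz; try lra; intros n.
    - replace (idx n 0) with 0%nat; [apply Hu0|]. unfold idx.
      destruct (nfloor_spec (0 * INR (N n))) as [E _]; [lra|].
      destruct (nfloor (0 * INR (N n))) as [|k]; [reflexivity|].
      rewrite S_INR in E. pose proof (pos_INR k). lra.
    - replace (idx n 1) with (N n); [apply HuN|].
      specialize (HidxN n 1 ltac:(lra)). specialize (Hidx n 1 ltac:(lra)).
      destruct (Nat.le_gt_cases (N n) (idx n 1)) as [|Hlt]; [lia|exfalso].
      pose proof (grid_le (N n) (S (idx n 1)) (N n) (HNpos n) Hlt) as HG.
      rewrite grid_S, (grid_N _ (HNpos n)) in HG. lra. }
  destruct (continuity_ab_maj g 0 m Hm ltac:(intros; apply Hgc)) as [Mx [HMx _]].
  set (F := g Mx) in HMx. assert (HF : 0 <= F) by apply Hg.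
  (* The bound on [w] makes [u] Lipschitz near [t0], so [u] converges at all nearby nodes; then so
     does [hs] times [g] of [u], which makes [w] Lipschitz and convergent there. Both difference
     equations can then pass to the limit. *)
  assert (Hloc : forall t0, 0 < t0 < 1 ->
    derivable_pt_lim U t0 (q (W t0 / d t0) / c t0) /\
    derivable_pt_lim W t0 (- (h t0 * g (U t0)))).
  { intros t0 Ht0.
    pose proof (near_interior UF HU N HNpos HNinf t0 Ht0) as Hint.
    set (a := Rmin (t0 / 2) ((1 - t0) / 2)).
    assert (Ha : 0 < a) by (apply Rmin_pos; lra).
    pose proof (Rmin_l (t0 / 2) ((1 - t0) / 2)) as Hal.
    pose proof (Rmin_r (t0 / 2) ((1 - t0) / 2)) as Har. fold a in Hal, Har.
    set (Wb := d1 * phi (c1 * m / a)).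
    assert (Hstepu : near UF N t0 (fun n k => u n (S k) - u n k = / INR (N n) *
      (q (w n k * / d (grid (N n) k)) * / c (grid (N n) k)))).
    { apply (near_mono UF HU N t0 _ _) with (2 := Hint). intros n k (_ & Hk & _).
      apply (sch_u _ _ _ _ _ _ _ _ _ _ _ _ (Hs n)). lia. }
    assert (HLu : near_lim UF N t0 u (U t0)).
    { apply (near_lim_of_point UF HU N HNpos HNinf t0 u (U t0) (q (Wb / d0) / c0)).
      - lra.
      - apply Rmult_le_pos; [|left; now apply Rinv_0_lt_compat].
        apply (q_ge0 _ _ _ _ _ Hq). apply Rmult_le_pos; [|left; now apply Rinv_0_lt_compat].
        unfold Wb. apply Rmult_le_pos; [lra|]. apply (phi_ge0 _ _ _ _ _ Hq).
        apply Rmult_le_pos; [nra|left; now apply Rinv_0_lt_compat].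
      - apply HU'. lra.
      - apply (near_mono UF HU N t0 _ _) with (2 := near_and UF HU N t0 _ _ Hint Hstepu).
        intros n k [(Hk0 & Hk & Hgk & Hg1 & Hg2) E]. rewrite E.
        pose proof (inv_N_pos (N n) (HNpos n)) as HiN.
        assert (Hwk : Rabs (w n k) <= Wb).
        { apply (w_abs_le (N n) _ _ _ _ _ m a _ (HNpos n) (Hs n) (Hu n)); try lra; [lia|].
          rewrite grid_S. lra. }
        pose proof (Hcb _ Hgk) as Hcg. pose proof (Hdb _ Hgk) as Hdg.
        rewrite Rabs_mult, (Rabs_pos_eq (/ INR (N n))) by lra.
        apply Rmult_le_compat_l; [lra|]. rewrite Rabs_mult, Rabs_inv.
        rewrite (Rabs_pos_eq (c _)) by lra. unfold Rdiv.
        apply Rmult_le_compat; [apply Rabs_pos|left; apply Rinv_0_lt_compat; lra| |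
          apply Rinv_le_contravar; lra].
        assert (Hwd : Rabs (w n k * / d (grid (N n) k)) <= Wb * / d0).
        { rewrite Rabs_mult, Rabs_inv, (Rabs_pos_eq (d _)) by lra.
          apply Rmult_le_compat; [apply Rabs_pos|left; apply Rinv_0_lt_compat; lra|exact Hwk|
            apply Rinv_le_contravar; lra]. }
        apply Rabs_le_between in Hwd. apply Rabs_le.
        rewrite <- (q_opp _ _ _ _ _ Hq).
        split; apply (q_le _ _ _ _ _ Hq); lra. }
    assert (HLh : near_lim UF N t0 (fun n k => hs n k) (h t0)).
    { intros e He. destruct (Hhc t0 Ht0 (e / 2) ltac:(lra)) as [del [Hdel Hd]].
      assert (Hhx : forall x, Rabs (x - t0) < del -> Rabs (h x - h t0) < e / 2).
      { intros x Hx. destruct (Req_dec x t0) as [->|Hne].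
        - rewrite Rminus_diag, Rabs_R0. lra.
        - apply (Hd x). split; [split; [exact I|]|exact Hx]. intros E; apply Hne; now symmetry. }
      pose proof (near_ball UF HU N HNinf t0 (del / 2)
        (fun n k => / INR (N n) < del / 2 /\ Rabs (grid (N n) k - t0) < del / 2)
        ltac:(lra) ltac:(tauto)) as Hb.
      apply (near_mono UF HU N t0 _ _) with (2 := near_and UF HU N t0 _ _ Hint Hb).
      intros n k [(Hk0 & Hk & Hgk & _) (Hn & Hk')].
      pose proof (inv_N_pos (N n) (HNpos n)) as HiN.
      destruct (Hhs n k ltac:(lia)) as [Hup Hdn]. apply Rabs_def2 in Hk'.
      assert (hs n k <= h (grid (N n) k)) by (apply Hup; lra).
      assert (Hh1 : Rabs (h (grid (N n) k) - h t0) < e / 2) by (apply Hhx, Rabs_def1; lra).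
      apply Rabs_def2 in Hh1.
      assert (h t0 - e / 2 <= hs n k).
      { apply Hdn. intros x Hx Hxk.
        assert (Hh2 : Rabs (h x - h t0) < e / 2) by (apply Hhx, Rabs_def1; lra).
        apply Rabs_def2 in Hh2. lra. }
      apply Rabs_def1; lra. }
    assert (HLy : near_lim UF N t0 (fun n k => - (hs n (S k) * g (u n (S k))))
      (- (h t0 * g (U t0)))).
    { apply (near_lim_opp UF HU).
      apply (near_lim_mult UF HU N t0 (fun n k => hs n (S k)) (fun n k => g (u n (S k)))).
      - now apply (near_lim_S UF HU N HNpos HNinf t0 hs).
      - apply (near_lim_S UF HU N HNpos HNinf t0 (fun n k => g (u n k))).
        apply (near_lim_cont UF HU); [apply Hgc|exact HLu]. }
    assert (Hstepw : near UF N t0 (fun n k => w n (S k) - w n k = / INR (N n) *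
      (- (hs n (S k) * g (u n (S k)))))).
    { apply (near_mono UF HU N t0 _ _) with (2 := Hint). intros n k (_ & Hk & _).
      rewrite (sch_w _ _ _ _ _ _ _ _ _ _ _ _ (Hs n)) by exact Hk. ring. }
    assert (HLw : near_lim UF N t0 w (W t0)).
    { apply (near_lim_of_point UF HU N HNpos HNinf t0 w (W t0) (Rabs (- (h t0 * g (U t0))) + 1)).
      - lra.
      - pose proof (Rabs_pos (- (h t0 * g (U t0)))). lra.
      - now apply HW'.
      - apply (near_mono UF HU N t0 _ _) with
          (2 := near_and UF HU N t0 _ _ Hstepw (near_lim_bounded UF HU N t0 _ _ HLy)).
        intros n k [E Hb]. rewrite E, Rabs_mult.
        pose proof (inv_N_pos (N n) (HNpos n)) as HiN. rewrite Rabs_pos_eq by lra.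
        apply Rmult_le_compat_l; lra. }
    pose proof (Hcb t0 Ht0) as Hcg. pose proof (Hdb t0 Ht0) as Hdg.
    assert (Hinvc : forall f, cont_on_open f 0 1 -> 0 < f t0 ->
      near_lim UF N t0 (fun n k => / f (grid (N n) k)) (/ f t0)).
    { intros f Hf Hf0. apply (near_lim_cont UF HU N t0 (fun n k => f (grid (N n) k)) (f t0) Rinv).
      - apply (continuity_pt_inv id); [apply derivable_continuous, derivable_id|unfold id; lra].
      - apply (near_lim_cont UF HU N t0 (fun n k => grid (N n) k)); [now apply Hf|].
        apply (near_lim_grid UF HU N HNinf). }
    split.
    - apply (point_lim_derivable UF HU N HNpos HNinf u U t0 _ _ Ht0) with (2 := Hstepu).
      + intros t Ht. apply HU'. lra.
      + apply (near_lim_mult UF HU N t0 (fun n k => q (w n k * / d (grid (N n) k)))).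
        * apply (near_lim_cont UF HU N t0 (fun n k => w n k * / d (grid (N n) k))).
          -- apply (q_cont _ _ _ _ _ Hq).
          -- apply (near_lim_mult UF HU); [exact HLw|apply Hinvc; [exact Hdc|lra]].
        * apply Hinvc; [exact Hcc|lra].
    - apply (point_lim_derivable UF HU N HNpos HNinf w W t0 _ _ Ht0) with (2 := Hstepw);
        [exact HW'|exact HLy]. }
  exists U. split; [|intros t Ht; split; [now apply HUb|]].
  - assert (HUc : forall t, 0 < t < 1 -> continuity_pt U t).
    { intros t Ht. apply derivable_continuous_pt. eexists. apply (proj1 (Hloc t Ht)). }
    assert (HWc : forall t, 0 < t < 1 -> continuity_pt W t).
    { intros t Ht. apply derivable_continuous_pt. eexists. apply (proj2 (Hloc t Ht)). }
    assert (HgF : forall n i, (i <= N n)%nat -> g (u n i) <= F).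
    { intros n i Hi. apply HMx. now apply Hu. }
    assert (Hright : forall e, 0 < e -> exists b, 0 < b < 1 /\
      forall t, b < t <= 1 -> U t <= e).
    { intros e He. destruct (right_boundary h H1 P1 m F e HW1 Hh0 Hm HF He) as [b [Hb Hbk]].
      exists b. split; [exact Hb|]. intros t Ht.
      apply (point_lim_le UF HU N u t); [apply HU'; lra|].
      apply (ultra_mono UF HU _ _) with (2 := Hsmall (t - b) ltac:(lra)). intros n Hn.
      fold (idx n t). specialize (Hidx n t ltac:(lra)).
      apply (Hbk (kn n) (N n) _ _ _ _ _ eq_refl (Hs n)); try (lra || apply HuN || apply Hu || apply HgF).
      - intros k x Hk. now apply (Hhs n k Hk).
      - apply HidxN. lra. }
    (* On this side rounding down moves the node towards the endpoint, so no condition on the mesh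
       is needed. *)
    assert (Hleft : forall e, 0 < e -> exists b, 0 < b < 1 /\
      forall t, 0 <= t < 1 - b -> U t <= e).
    { intros e He.
      destruct (right_boundary (fun t => h (1 - t)) H2 P2 m F e HW2
        ltac:(intros; apply Hh0; lra) Hm HF He) as [b [Hb Hbk]].
      exists b. split; [exact Hb|]. intros t Ht.
      apply (point_lim_le UF HU N u t); [apply HU'; lra|].
      apply Hall. intros n.
      fold (idx n t). specialize (Hidx n t ltac:(lra)).
      pose proof (scheme_rev Hq (HNpos n) (Hs n)) as Hr.
      specialize (HidxN n t ltac:(lra)).
      pose proof (Hbk (kn n) (N n) _ _ _ _ _ eq_refl Hr) as HB. cbv beta in HB.
      specialize (HB ltac:(intros; now apply (cell_inf_rev (n := kn n) eq_refl (Hhs n)))).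
      replace (N n - N n)%nat with 0%nat in HB by lia.
      specialize (HB (Hu0 n) ltac:(intros; apply Hu; lia) ltac:(intros; apply HgF; lia)
        (N n - idx n t)%nat ltac:(lia)).
      rewrite grid_sub in HB by (apply HNpos || exact HidxN).
      replace (N n - (N n - idx n t))%nat with (idx n t) in HB by lia.
      apply HB. lra. }
    destruct Hends as [HU0 HU1].
    split; [|split; [exact HU0|split; [exact HU1|]]].
    + intros t Ht eps Heps.
      destruct (Req_dec t 0) as [->|Ht0]; [|destruct (Req_dec t 1) as [->|Ht1]].
      * destruct (Hleft (eps / 2) ltac:(lra)) as [b [Hb Hbt]]. exists (1 - b). split; [lra|].
        intros s Hs' Hst. rewrite HU0, !Rminus_0_r in *. pose proof (HUb s Hs') as Hus.
        rewrite Rabs_pos_eq in Hst by lra. rewrite Rabs_pos_eq by lra.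
        specialize (Hbt s ltac:(lra)). lra.
      * destruct (Hright (eps / 2) ltac:(lra)) as [b [Hb Hbt]]. exists (1 - b). split; [lra|].
        intros s Hs' Hst. rewrite HU1, !Rminus_0_r in *. pose proof (HUb s Hs') as Hus.
        apply Rabs_def2 in Hst. rewrite Rabs_pos_eq by lra.
        specialize (Hbt s ltac:(lra)). lra.
      * destruct (HUc t ltac:(lra) eps Heps) as [del [Hdel Hd]]. exists del. split; [exact Hdel|].
        intros s _ Hst. destruct (Req_dec s t) as [->|Hne].
        -- rewrite Rminus_diag, Rabs_R0. exact Heps.
        -- apply (Hd s). split; [split; [exact I|]|exact Hst]. intros E; apply Hne; now symmetry.
    + exists (fun t => q (W t / d t) / c t), (fun t => - (h t * g (U t))).
      split; [|split; [|split; [|split]]].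
      * intros t Ht. apply (Hloc t Ht).
      * intros t Ht. pose proof (Hcb t Ht). pose proof (Hdb t Ht).
        apply (continuity_pt_div (fun t => q (W t / d t)) c); [|now apply Hcc|lra].
        apply (continuity_pt_comp (fun t => W t / d t) q); [|apply (q_cont _ _ _ _ _ Hq)].
        apply (continuity_pt_div W d); [now apply HWc|now apply Hdc|lra].
      * intros t Ht.
        (* With the derivative [q (W t / d t) / c t], the expression [d phi(c U')] is [W] itself on
           the open interval. *)
        apply (derivable_pt_lim_open W); [exact Ht| |apply (Hloc t Ht)].
        intros s Hs'. pose proof (Hcb s Hs'). pose proof (Hdb s Hs').
        replace (c s * (q (W s / d s) / c s)) with (q (W s / d s)) by (field; lra).
        rewrite (phi_q _ _ _ _ _ Hq). field. lra.
      * intros t Ht. apply (continuity_pt_opp (fun t => h t * g (U t))).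
        apply (continuity_pt_mult h (fun t => g (U t))); [now apply Hhc|].
        apply (continuity_pt_comp U g); [now apply HUc|apply Hgc].
      * intros t Ht. ring.
  (* One index with mesh and pointwise error below [z] suffices, because [t * (1 - t)] is
     1-Lipschitz on the unit interval. *)
  - apply le_epsilon. intros e He.
    set (D := Rabs C + Rabs lo + 1).
    pose proof (Rabs_pos C) as HCp. pose proof (Rabs_pos lo) as Hlop.
    set (z := e / D). assert (Hz : 0 < z) by (apply Rdiv_lt_0_compat; unfold D; lra).
    assert (HzD : z * D = e) by (unfold z; field; unfold D; lra).
    destruct (ultra_proper UF HU _ (ultra_and UF HU _ _ (HU' t Ht z Hz) (Hsmall z Hz)))
      as [n [Hn1 Hn2]].
    fold (idx n t) in Hn1. specialize (Hidx n t ltac:(lra)).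
    specialize (Hlow n (idx n t) (HidxN n t Ht)). set (x := grid (N n) (idx n t)) in *.
    assert (Hx0 : 0 <= x).
    { unfold x. rewrite <- (grid_0 (N n)). apply grid_le; [apply HNpos|lia]. }
    assert (Hdiff : t * (1 - t) * lo - x * (1 - x) * lo <= z * Rabs lo).
    { replace (t * (1 - t) * lo - x * (1 - x) * lo) with ((t - x) * (1 - t - x) * lo) by ring.
      eapply Rle_trans; [apply Rle_abs|]. rewrite !Rabs_mult.
      apply Rmult_le_compat_r; [exact Hlop|].
      assert (Rabs (t - x) <= z) by (apply Rabs_le; lra).
      assert (Rabs (1 - t - x) <= 1) by (apply Rabs_le; lra).
      pose proof (Rabs_pos (t - x)). pose proof (Rabs_pos (1 - t - x)). nra. }
    assert (HCu : C * u n (idx n t) - C * U t <= z * Rabs C).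
    { rewrite <- Rmult_minus_distr_l. eapply Rle_trans; [apply Rle_abs|].
      rewrite Rabs_mult, Rmult_comm. apply Rmult_le_compat_r; lra. }
    unfold D in HzD. nra.
Qed.

End Limit.

Arguments limit_solution {phi psi1 psi2 q Psi g c0 c1 d0 d1} Hq Hg Hc0 Hd0 Hc1 Hd1 {c d h H1 P1 H2 P2} Hgc Hh0 HW1 HW2 Hcc Hdc Hhc.

(** * Existence of solutions *)

Lemma sup_norm_bounds (u : R -> R) B :
  (forall t, 0 <= t <= 1 -> 0 <= u t <= B) ->
  sup_norm u <= B /\ forall t, 0 <= t <= 1 -> u t <= sup_norm u.
Proof.
  intros Hu. unfold sup_norm.
  assert (Hub : is_upper_bound (fun y => exists t, 0 <= t <= 1 /\ y = Rabs (u t)) B).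
  { intros y [t [Ht ->]]. specialize (Hu t Ht). rewrite Rabs_pos_eq; lra. }
  destruct (excluded_middle_informative _) as [H|H].
  - destruct (constructive_indefinite_description _ H) as [m [Hm1 Hm2]]; simpl. split.
    + now apply Hm2.
    + intros t Ht. rewrite <- (Rabs_pos_eq (u t)) by (apply Hu; exact Ht).
      apply Hm1. now exists t.
  - exfalso. apply H.
    destruct (completeness (fun y => exists t, 0 <= t <= 1 /\ y = Rabs (u t))) as [m Hm].
    + now exists B.
    + exists (Rabs (u 0)), 0. split; [lra|reflexivity].
    + now exists m.
Qed.

(** No compactness of the set of solutions is available to attain the infimum; a minimizer up to [e]
    suffices for selecting the family. *)
Lemma almost_minimizer {T : Type} (P : T -> Prop) (F : T -> R) b e :
  (exists u, P u) -> (forall u, P u -> b <= F u) -> 0 < e ->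
  exists u, P u /\ forall v, P v -> F u <= F v + e.
Proof.
  intros [u0 Hu0] Hb He.
  destruct (completeness (fun y => exists u, P u /\ y = - F u)) as [S [Hub Hlub]].
  - exists (- b). intros y [u [Hu ->]]. specialize (Hb u Hu). lra.
  - now exists (- F u0), u0.
  - destruct (classic (exists u, P u /\ S - e < - F u)) as [[u [Hu Hlt]]|Hno].
    + exists u. split; [exact Hu|]. intros v Hv.
      assert (- F v <= S) by (apply Hub; now exists v). lra.
    + exfalso. assert (S <= S - e); [|lra]. apply Hlub. intros y [u [Hu ->]].
      apply Rnot_lt_le. intros Hlt. apply Hno. now exists u.
Qed.

(** Composing with this 1-Lipschitz retraction turns continuity relative to the closed interval into
    continuity on the line, so that the extreme value theorem applies. *)
Definition clamp01 (x : R) : R := Rmax 0 (Rmin x 1).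

Lemma clamp01_spec x : 0 <= clamp01 x <= 1 /\ (0 <= x <= 1 -> clamp01 x = x) /\
  forall y, Rabs (clamp01 x - clamp01 y) <= Rabs (x - y).
Proof.
  unfold clamp01. split; [|split].
  - unfold Rmax, Rmin. repeat destruct Rle_dec; lra.
  - intros Hx. rewrite Rmin_left, Rmax_right; lra.
  - intros y. unfold Rmax, Rmin, Rabs.
    repeat destruct Rle_dec; repeat destruct Rcase_abs; lra.
Qed.

Lemma clamp01_continuity (f : R -> R) :
  cont_on_closed f 0 1 -> continuity (fun x => f (clamp01 x)).
Proof.
  intros Hf x eps Heps.
  destruct (Hf (clamp01 x) (proj1 (clamp01_spec x)) eps Heps) as [del [Hdel Hd]].
  exists del. split; [exact Hdel|]. intros y [_ Hy]. simpl in *. unfold R_dist in *.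
  apply Hd; [apply clamp01_spec|]. eapply Rle_lt_trans; [apply clamp01_spec|exact Hy].
Qed.

Lemma cont_on_closed_bounds (f : R -> R) :
  cont_on_closed f 0 1 -> (forall t, 0 <= t <= 1 -> 0 < f t) ->
  exists m M, 0 < m /\ m <= M /\ forall t, 0 <= t <= 1 -> m <= f t <= M.
Proof.
  intros Hf Hpos. pose proof (clamp01_continuity f Hf) as Hc.
  destruct (continuity_ab_maj (fun x => f (clamp01 x)) 0 1 Rle_0_1 (fun x _ => Hc x))
    as [xM [HM _]].
  destruct (continuity_ab_min (fun x => f (clamp01 x)) 0 1 Rle_0_1 (fun x _ => Hc x))
    as [xm [Hm _]].
  exists (f (clamp01 xm)), (f (clamp01 xM)). split; [apply Hpos, clamp01_spec|].
  assert (H : forall t, 0 <= t <= 1 -> f (clamp01 xm) <= f t <= f (clamp01 xM)).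
  { intros t Ht. rewrite <- (proj1 (proj2 (clamp01_spec t)) Ht) at 1 2.
    split; [now apply Hm|now apply HM]. }
  split; [|exact H]. specialize (H 0 ltac:(lra)). lra.
Qed.

Lemma cont_on_closed_open (f : R -> R) : cont_on_closed f 0 1 -> cont_on_open f 0 1.
Proof.
  intros Hf t Ht eps Heps. destruct (Hf t ltac:(lra) eps Heps) as [del [Hdel Hd]].
  exists (Rmin del (Rmin t (1 - t))). split; [repeat apply Rmin_pos; lra|].
  intros s [_ Hs]. simpl in *. unfold R_dist in *.
  pose proof (Rmin_l del (Rmin t (1 - t))). pose proof (Rmin_r del (Rmin t (1 - t))).
  pose proof (Rmin_l t (1 - t)). pose proof (Rmin_r t (1 - t)).
  pose proof (Rabs_def2 _ _ Hs). apply Hd; lra.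
Qed.

Lemma nonneg_extension_continuity (f : R -> R) :
  cont_on_nonneg f -> continuity (fun x => f (Rmax 0 x)).
Proof.
  intros Hf x eps Heps. destruct (Hf (Rmax 0 x) (Rmax_l 0 x) eps Heps) as [del [Hdel Hd]].
  exists del. split; [exact Hdel|]. intros y [_ Hy]. simpl in *. unfold R_dist in *.
  apply Hd; [apply Rmax_l|]. eapply Rle_lt_trans; [|exact Hy].
  unfold Rmax, Rabs. repeat destruct Rle_dec; repeat destruct Rcase_abs; lra.
Qed.

Lemma inv_odd_small e : 0 < e -> exists n0, forall k, (n0 <= k)%nat -> / INR (2 * k + 1) < e.
Proof.
  intros He. assert (Hie : 0 < / e) by now apply Rinv_0_lt_compat.
  exists (nfloor (/ e)). intros k Hk.
  destruct (nfloor_spec (/ e) ltac:(lra)) as [_ H].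
  apply le_INR in Hk. pose proof (pos_INR k).
  rewrite <- (Rinv_inv e). apply Rinv_lt_contravar.
  - apply Rmult_lt_0_compat; [exact Hie|]. apply lt_0_INR. lia.
  - rewrite plus_INR, mult_INR. simpl. lra.
Qed.

Lemma positive_interval (h : R -> R) : cont_on_open h 0 1 ->
  (forall t, 0 < t < 1 -> 0 <= h t) -> (exists t, 0 < t < 1 /\ h t <> 0) ->
  exists a b eta, 0 < a < b /\ b < 1 /\ 0 < eta /\ forall x, a <= x <= b -> eta <= h x.
Proof.
  intros Hc Hpos [t [Ht Hne]]. assert (H0 : 0 < h t) by (specialize (Hpos t Ht); lra).
  destruct (Hc t Ht (h t / 2) ltac:(lra)) as [del [Hdel Hd]].
  set (r := Rmin (del / 2) (Rmin (t / 2) ((1 - t) / 2))).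
  assert (Hr : 0 < r) by (unfold r; repeat apply Rmin_pos; lra).
  assert (Hr1 : r <= del / 2) by apply Rmin_l.
  assert (Hr2 : r <= t / 2) by (eapply Rle_trans; [apply Rmin_r|apply Rmin_l]).
  assert (Hr3 : r <= (1 - t) / 2) by (eapply Rle_trans; [apply Rmin_r|apply Rmin_r]).
  exists (t - r), (t + r), (h t / 2). repeat split; try lra.
  intros x Hx. destruct (Req_dec x t) as [->|Hxt]; [lra|].
  assert (Hlt : Rabs (h x - h t) < h t / 2).
  { apply (Hd x). split; [split; [exact I|intros E; apply Hxt; now symmetry]|].
    simpl. unfold R_dist. apply Rabs_def1; lra. }
  apply Rabs_def2 in Hlt. lra.
Qed.

Section Existence.
Variables phi psi1 psi2 c d f h : R -> R.
Hypothesis Hphi : odd_inc_homeo phi.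
Hypothesis HA : condA phi psi1 psi2.
Hypothesis Hc : cont_on_closed c 0 1.
Hypothesis Hcpos : forall t, 0 <= t <= 1 -> 0 < c t.
Hypothesis Hd : cont_on_closed d 0 1.
Hypothesis Hdpos : forall t, 0 <= t <= 1 -> 0 < d t.
Hypothesis Hf : f_ok f.
Hypothesis Hh : h_ok psi1 h.

(** The discrete maxima exceed [lo], but for the limit only the concavity estimate is kept. At
    [t = 1/2] it bounds [lo / 4] by a constant times the norm, hence the factor [C] in the lower
    bound. *)
Lemma existence_between_norms :
  exists kap K rho C, 0 < kap /\ 0 < K /\ 0 < rho /\ 0 < C /\
  forall lam lo hi, 0 < lam -> 0 < lo -> 0 < hi ->
  let small_at m := forall x, 0 <= x <= m -> lam * f x <= kap * phi m in
  let large_at m := forall x, rho * m <= x <= m -> K * phi x <= lam * f x in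
  ((forall m, 0 < m <= lo -> large_at m) /\ (forall m, hi <= m -> small_at m)) \/
  ((forall m, 0 < m <= lo -> small_at m) /\ (forall m, hi <= m -> large_at m)) ->
  exists u, is_pos_solution phi c d h f lam u /\ 0 < sup_norm u /\
    lo <= C * sup_norm u /\ sup_norm u <= hi.
Proof.
  destruct (phi_inverse_exists phi psi1 psi2 Hphi HA) as [q Hq].
  set (Psi := inv_nonneg psi1) in *.
  destruct Hh as (Hhc & Hhpos & Hhne & HhL & HhR & _).
  destruct Hf as (Hfc & Hf0 & Hfpos).
  destruct (right_weight_right Psi h (Psi_le _ _ _ _ _ Hq) (Psi_ge0 _ _ _ _ _ Hq)
    (Psi_cont _ _ _ _ _ Hq) Hhc Hhpos HhR) as (H1 & P1 & HW1).
  destruct (right_weight_left Psi h (Psi_le _ _ _ _ _ Hq) (Psi_ge0 _ _ _ _ _ Hq)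
    (Psi_cont _ _ _ _ _ Hq) Hhc Hhpos HhL) as (H2 & P2 & HW2).
  destruct (cont_on_closed_bounds c Hc Hcpos) as (c0 & c1 & Hc0 & Hc1 & Hcb).
  destruct (cont_on_closed_bounds d Hd Hdpos) as (d0 & d1 & Hd0 & Hd1 & Hdb).
  destruct (positive_interval h Hhc Hhpos Hhne) as (a0 & b0 & eta & Hab & Hb1 & Heta & Hheta).
  set (B := Rmax 0 (Rmax (P1 1 - P1 (1/2)) (P2 1 - P2 (1/2)))).
  assert (HB0 : 0 <= B) by apply Rmax_l.
  assert (HB1 : P1 1 - P1 (1/2) <= B) by (eapply Rle_trans; [apply Rmax_l|apply Rmax_r]).
  assert (HB2 : P2 1 - P2 (1/2) <= B) by (eapply Rle_trans; [apply Rmax_r|apply Rmax_r]).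
  set (s1 := c0 / (2 * (B + 1))).
  assert (Hs1 : 0 < s1) by (apply Rdiv_lt_0_compat; lra).
  assert (Hs1B : s1 * B < c0).
  { assert (s1 * (B + 1) = c0 / 2) by (unfold s1; field; lra). nra. }
  assert (Hdd : 0 < d0 / d1) by (apply Rdiv_lt_0_compat; lra).
  destruct (psi2_onto _ _ _ _ _ Hq (d0 / d1) ltac:(lra)) as [s2 [Hs2' Es2]].
  assert (Hs2 : 0 < s2).
  { destruct Hs2' as [|<-]; [assumption|].
    rewrite (homeo_0 psi2) in Es2 by apply HA. lra. }
  set (C := c1 / (s2 * c0) + 1).
  assert (HC : 0 < C).
  { unfold C. assert (0 < c1 / (s2 * c0)) by (apply Rdiv_lt_0_compat; nra). lra. }
  set (rho := a0 * (1 - b0) / C).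
  assert (Hrho : 0 < rho) by (apply Rdiv_lt_0_compat; nra).
  (* Either summand alone would give equality in one of the two conditions on [A]; the sum makes
     both strict. *)
  set (A := c1 / a0 + c1 / (1 - b0)).
  assert (HA1 : 0 < c1 / a0) by (apply Rdiv_lt_0_compat; lra).
  assert (HA2 : 0 < c1 / (1 - b0)) by (apply Rdiv_lt_0_compat; lra).
  assert (HAa : c1 < A * a0).
  { replace (A * a0) with (c1 + c1 / (1 - b0) * a0) by (unfold A; field; lra). nra. }
  assert (HAb : c1 < A * (1 - b0)).
  { replace (A * (1 - b0)) with (c1 + c1 / a0 * (1 - b0)) by (unfold A; field; lra). nra. }
  pose proof (psi1_pos _ _ _ _ _ Hq) as Hpsi1. pose proof (psi2_pos _ _ _ _ _ Hq) as Hpsi2.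
  (* [K] solves the largeness condition of [right_end_negative] with equality, as [kap] below solves
     [4 * kap / d0 = psi1 s1]. *)
  set (K := 2 * d1 * psi2 A / ((b0 - a0) / 4 * eta * psi1 rho)).
  assert (HpA : 0 < psi2 A) by (apply Hpsi2; unfold A; lra).
  assert (Hpr : 0 < psi1 rho) by now apply Hpsi1.
  assert (Hden : 0 < (b0 - a0) / 4 * eta * psi1 rho).
  { apply Rmult_lt_0_compat; [nra|exact Hpr]. }
  assert (HK : 0 < K) by (apply Rdiv_lt_0_compat; nra).
  set (kap := d0 * psi1 s1 / 4).
  assert (Hps1 : 0 < psi1 s1) by now apply Hpsi1.
  assert (Hkap : 0 < kap) by (unfold kap; nra).
  exists kap, K, rho, (4 * C). do 4 (split; [lra|]).
  intros lam lo hi Hlam Hlo Hhi small_at large_at Hcases.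
  (* Trajectories of the shooting may become negative, so [f] is continued by the constant [f 0]. *)
  set (g := fun x => lam * f (Rmax 0 x)).
  assert (Hg : forall x, 0 <= g x).
  { intros x. apply Rmult_le_pos; [lra|]. apply Hf0, Rmax_l. }
  assert (Hgc : continuity g).
  { apply (continuity_scal (fun x => f (Rmax 0 x))). now apply nonneg_extension_continuity. }
  assert (Hgf : forall x, 0 <= x -> g x = lam * f x).
  { intros x Hx. unfold g. now rewrite Rmax_right. }
  destruct (inv_odd_small ((b0 - a0) / 4) ltac:(lra)) as [n0 Hn0].
  (* The shift by [n0] makes the mesh at most [(b0 - a0) / 4] for every [n], not just eventually. *)
  set (kn := fun n => (n + n0)%nat). set (N := fun n => (2 * kn n + 1)%nat).
  assert (Hdisc : forall n, exists z : (nat -> R) * (nat -> R) * (nat -> R),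
    let hs := fst (fst z) in let u := snd (fst z) in let w := snd z in
    cell_inf h (N n) hs /\
    scheme q g c0 c1 d0 d1 (N n) (fun k => c (grid (N n) k)) (fun k => d (grid (N n) k)) hs u w /\
    u 0%nat = 0 /\ u (N n) = 0 /\ exists j, max_at u (N n) j /\ lo < u j < hi).
  { intros n. destruct (cell_inf_exists h (N n) Hhpos) as [hs Hhs].
    assert (HNpos : (0 < N n)%nat) by (unfold N; lia).
    assert (Hgrid : forall k, (k < N n)%nat -> 0 <= grid (N n) k <= 1).
    { intros k Hk. rewrite <- (grid_N _ HNpos). rewrite <- (grid_0 (N n)) at 1.
      split; apply grid_le; lia. }
    assert (Hpos' : forall u w j, scheme q g c0 c1 d0 d1 (N n) (fun k => c (grid (N n) k))
        (fun k => d (grid (N n) k)) hs u w -> u 0%nat = 0 -> max_at u (N n) j -> 0 < u j ->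
        small_at (u j) -> 0 < u (N n)).
    { intros u w j Hs Hu0 Hj Huj Hsm.
      apply (right_end_positive (n := kn n) Hq Hc0 Hd0 Hhpos HW1 HW2 eq_refl Hhs j (u j) kap s1 B
        Hs Hu0 Hj eq_refl);
        try assumption; try lra; try reflexivity.
      - intros x Hx. destruct (Rle_lt_dec 0 x) as [Hx0|Hx0].
        + rewrite Hgf by exact Hx0. apply Hsm. lra.
        + unfold g. rewrite Rmax_left by lra. apply Hsm. lra.
      - right. unfold kap. field. lra. }
    assert (Hneg' : forall u w j, scheme q g c0 c1 d0 d1 (N n) (fun k => c (grid (N n) k))
        (fun k => d (grid (N n) k)) hs u w -> u 0%nat = 0 -> max_at u (N n) j -> 0 < u j ->
        large_at (u j) -> u (N n) < 0).
    { intros u w j Hs Hu0 Hj Huj Hla.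
      apply (right_end_negative (n := kn n) Hq Hg Hc0 Hd0 Hc1 Hd1 eq_refl Hhs j (u j) s2 K A a0 b0 eta
        Hs Hu0 Hj eq_refl);
        try assumption; try lra; try reflexivity.
      - left. apply Hn0. unfold kn. lia.
      - unfold A. lra.
      - fold C. fold rho. right. unfold K. field. repeat split; nra.
      - fold C. fold rho. intros x Hx. rewrite Hgf by nra. now apply Hla. }
    assert (Hex : exists sg, sg <> 0 /\
      (forall u w j, scheme q g c0 c1 d0 d1 (N n) (fun k => c (grid (N n) k))
        (fun k => d (grid (N n) k)) hs u w -> u 0%nat = 0 -> max_at u (N n) j -> 0 < u j <= lo ->
        0 < sg * u (N n)) /\
      (forall u w j, scheme q g c0 c1 d0 d1 (N n) (fun k => c (grid (N n) k))
        (fun k => d (grid (N n) k)) hs u w -> u 0%nat = 0 -> max_at u (N n) j -> hi <= u j ->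
        sg * u (N n) < 0)).
    { destruct Hcases as [[HL HS]|[HS HL]].
      - exists (-1). split; [lra|]. split; intros u w j Hs Hu0 Hj Huj.
        + specialize (Hneg' u w j Hs Hu0 Hj ltac:(lra) (HL _ Huj)). lra.
        + specialize (Hpos' u w j Hs Hu0 Hj ltac:(lra) (HS _ Huj)). lra.
      - exists 1. split; [lra|]. split; intros u w j Hs Hu0 Hj Huj.
        + specialize (Hpos' u w j Hs Hu0 Hj ltac:(lra) (HS _ Huj)). lra.
        + specialize (Hneg' u w j Hs Hu0 Hj ltac:(lra) (HL _ Huj)). lra. }
    destruct Hex as (sg & Hsg & Hsm & Hla).
    destruct (discrete_solution (n := kn n) Hq Hg Hc0 Hd0 Hhpos eq_refl Hhs Hgc
      (fun k Hk => Hcb _ (Hgrid k Hk)) (fun k Hk => Hdb _ (Hgrid k Hk)) lo hi sg Hlo Hhi Hsg Hsm Hla)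
      as (u & w & Hs & Hu0 & HuN & j & Hj & Huj).
    exists (hs, u, w). simpl. split; [exact Hhs|]. split; [exact Hs|]. split; [exact Hu0|].
    split; [exact HuN|]. now exists j. }
  destruct (choice_fun _ Hdisc) as [Z HZ]. cbv zeta in HZ.
  (* The lower estimate is proved first: the nonnegativity of the discrete solution is read off from
     it. *)
  assert (Hconc : forall n k, (k <= N n)%nat ->
    grid (N n) k * (1 - grid (N n) k) * lo <= C * snd (fst (Z n)) k /\ 0 <= snd (fst (Z n)) k <= hi).
  { intros n k Hk. destruct (HZ n) as (Hhs & Hs & Hu0 & HuN & j & Hj & Huj).
    assert (HNpos : (0 < N n)%nat) by (unfold N; lia).
    pose proof (concave_both (n := kn n) Hq Hg Hc0 Hd0 Hc1 Hd1 eq_refl s2 j k Hs Hs2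
      (Req_le _ _ Es2) Hj (Req_le _ _ (eq_sym Hu0)) (Req_le _ _ (eq_sym HuN)) Hk) as Hcv.
    fold C in Hcv. change (2 * kn n + 1)%nat with (N n) in Hcv.
    assert (Hg01 : 0 <= grid (N n) k <= 1).
    { rewrite <- (grid_N _ HNpos). rewrite <- (grid_0 (N n)) at 1.
      split; apply grid_le; lia. }
    assert (Hprod : 0 <= grid (N n) k * (1 - grid (N n) k)) by nra.
    pose proof (proj2 Hj k Hk) as Huk.
    assert (Hlo' : grid (N n) k * (1 - grid (N n) k) * lo <= C * snd (fst (Z n)) k).
    { eapply Rle_trans; [|exact Hcv]. apply Rmult_le_compat_l; lra. }
    split; [exact Hlo'|]. split; [|lra].
    apply Rmult_le_reg_l with C; [exact HC|]. rewrite Rmult_0_r.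
    eapply Rle_trans; [|exact Hlo']. apply Rmult_le_pos; lra. }
  destruct (limit_solution Hq Hg Hc0 Hd0 Hc1 Hd1 Hgc Hhpos HW1 HW2 (cont_on_closed_open c Hc) (cont_on_closed_open d Hd) Hhc
    ltac:(intros; apply Hcb; lra) ltac:(intros; apply Hdb; lra) kn
    (fun n => fst (fst (Z n))) (fun n => snd (fst (Z n))) (fun n => snd (Z n)) hi lo C)
    as (U & HU & HUb).
  - intros e He. destruct (inv_odd_small e He) as [n1 Hn1]. exists n1. intros n Hn.
    apply Hn1. unfold kn. lia.
  - intros n. apply HZ.
  - intros n. apply HZ.
  - intros n. apply HZ.
  - intros n. apply HZ.
  - intros n k Hk. now apply Hconc.
  - intros n k Hk. now apply Hconc.
  - exists U.
    assert (HUpos : forall t, 0 < t < 1 -> 0 < U t).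
    { intros t Ht. destruct (HUb t ltac:(lra)) as [Hb Hl].
      assert (0 < t * (1 - t)) by nra.
      assert (0 < t * (1 - t) * lo) by nra.
      apply Rmult_lt_reg_l with C; [exact HC|]. lra. }
    destruct (sup_norm_bounds U hi (fun t Ht => proj1 (HUb t Ht))) as [Hsup Hle].
    specialize (Hle (1/2) ltac:(lra)) as Hhalf.
    pose proof (HUpos (1/2) ltac:(lra)) as HUh.
    split; [|split; [lra|split; [|exact Hsup]]].
    + split; [|exact HUpos].
      destruct HU as (HUc & HU0 & HU1 & u' & w' & Hu' & Hu'c & Hw' & Hw'c & Heq).
      split; [exact HUc|]. split; [exact HU0|]. split; [exact HU1|].
      exists u', w'. do 4 (split; [assumption|]). intros t Ht.
      specialize (Heq t Ht). rewrite Hgf in Heq by (left; now apply HUpos). lra.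
    + destruct (HUb (1/2) ltac:(lra)) as [_ Hl]. nra.
Qed.

(** * How small lambda must be for a prescribed bound on the norm *)

Lemma f_bounded_upto M : 0 <= M -> exists F, 0 < F /\ forall x, 0 <= x <= M -> f x <= F.
Proof.
  intros HM. destruct Hf as (Hfc & _ & _).
  destruct (continuity_ab_maj (fun x => f (Rmax 0 x)) 0 M HM
    (fun x _ => nonneg_extension_continuity f Hfc x)) as [xM [HxM _]].
  exists (Rmax 1 (f (Rmax 0 xM))). split.
  - pose proof (Rmax_l 1 (f (Rmax 0 xM))). lra.
  - intros x Hx. specialize (HxM x Hx). rewrite Rmax_right in HxM by lra.
    eapply Rle_trans; [exact HxM|apply Rmax_r].
Qed.

(** The growth at 0 gives the largeness condition below some level for every [lam]. The smallness
    condition above [eps] needs only a bound [K'] of [f x / phi m] for [x <= m] and [m >= eps], so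
    [lam < kap / K'] suffices. *)
Lemma small_solutions L : lim0_infty f phi -> liminf_finite f phi L -> forall eps, 0 < eps ->
  exists ls, 0 < ls /\ forall lam, 0 < lam < ls ->
    exists u, is_pos_solution phi c d h f lam u /\ 0 < sup_norm u /\ sup_norm u <= eps.
Proof.
  intros H0 Hinf eps Heps.
  destruct (phi_inverse_exists phi psi1 psi2 Hphi HA) as [q Hq].
  destruct existence_between_norms as (kap & K & rho & C & Hkap & HK & Hrho & HC & Hmain).
  destruct (Hinf 1 Rlt_0_1) as [M HM].
  pose proof (phi_pos _ _ _ _ _ Hq) as Hpp. pose proof (phi_le _ _ _ _ _ Hq) as Hpl.
  destruct (f_bounded_upto (Rmax 0 M) (Rmax_l 0 M)) as (F & HF & HfF).
  (* The first entry serves bounded [x], through [phi m >= phi eps]; the second serves large [x],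
     where [f / phi] is within 1 of [L]. *)
  set (K' := Rmax (F / phi eps) (L + 1)).
  assert (HFe : 0 < F / phi eps) by (apply Rdiv_lt_0_compat; [exact HF|now apply Hpp]).
  assert (HK'1 : F / phi eps <= K') by apply Rmax_l.
  assert (HK'2 : L + 1 <= K') by apply Rmax_r.
  assert (HfK : forall m x, eps <= m -> 0 <= x <= m -> f x <= K' * phi m).
  { intros m x Hm Hx. assert (Hpm : phi eps <= phi m) by now apply Hpl.
    pose proof (Hpp eps Heps) as Hpe.
    destruct (Rle_lt_dec x (Rmax 0 M)) as [HxM|HxM].
    - apply Rle_trans with F; [apply HfF; lra|].
      apply Rle_trans with (F / phi eps * phi eps); [right; field; lra|].
      apply Rmult_le_compat; lra.
    - pose proof (Rmax_l 0 M). pose proof (Rmax_r 0 M).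
      specialize (HM x ltac:(lra)). apply Rabs_def2 in HM.
      pose proof (Hpp x ltac:(lra)) as Hpx.
      assert (f x <= (L + 1) * phi x) by (apply Rle_div_iff; lra).
      assert (phi x <= phi m) by (apply Hpl; lra).
      apply Rle_trans with (K' * phi x); [|apply Rmult_le_compat_l; lra].
      eapply Rle_trans; [eassumption|]. apply Rmult_le_compat_r; lra. }
  exists (kap / K'). split; [apply Rdiv_lt_0_compat; lra|]. intros lam Hlam.
  destruct (H0 (K / lam)) as [del [Hdel Hdl]].
  destruct (Hmain lam (del / 2) eps ltac:(lra) ltac:(lra) Heps) as (u & Hu & Hpos & _ & Hsup).
  - left. split.
    + intros m Hm x Hx. assert (Hx0 : 0 < x) by nra.
      specialize (Hdl x ltac:(lra)). pose proof (Hpp x Hx0) as Hpx.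
      assert (K / lam * phi x <= f x) by (apply Rdiv_le_iff; lra).
      replace (K * phi x) with (lam * (K / lam * phi x)) by (field; lra).
      apply Rmult_le_compat_l; lra.
    + intros m Hm x Hx. specialize (HfK m x Hm Hx).
      assert (HlK : lam * K' <= kap) by (apply Rdiv_le_iff; lra).
      pose proof (Hpp m ltac:(lra)) as Hpm.
      apply Rle_trans with (lam * (K' * phi m)); [apply Rmult_le_compat_l; lra|].
      rewrite <- Rmult_assoc. apply Rmult_le_compat_r; lra.
  - now exists u.
Qed.

Lemma large_solutions L : lim0_finite f phi L -> liminf_infty f phi -> forall M,
  exists ls, 0 < ls /\ forall lam, 0 < lam < ls ->
    exists u, is_pos_solution phi c d h f lam u /\ 0 < sup_norm u /\ M < sup_norm u.
Proof.
  intros H0 Hinf M.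
  destruct (phi_inverse_exists phi psi1 psi2 Hphi HA) as [q Hq].
  destruct existence_between_norms as (kap & K & rho & C & Hkap & HK & Hrho & HC & Hmain).
  pose proof (phi_pos _ _ _ _ _ Hq) as Hpp. pose proof (phi_le _ _ _ _ _ Hq) as Hpl.
  destruct (H0 1 Rlt_0_1) as [del [Hdel Hdl]].
  (* The factor [C] offsets the loss in the lower bound of [existence_between_norms]. *)
  set (lo := C * (Rabs M + 1)).
  pose proof (Rabs_pos M) as HMp.
  assert (Hlo : 0 < lo) by (unfold lo; nra).
  destruct (f_bounded_upto lo ltac:(lra)) as (F & HF & HfF).
  set (K' := Rmax (F / phi del) (L + 1)).
  assert (HFe : 0 < F / phi del) by (apply Rdiv_lt_0_compat; [exact HF|now apply Hpp]).
  assert (HK'1 : F / phi del <= K') by apply Rmax_l.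
  assert (HK'2 : L + 1 <= K') by apply Rmax_r.
  assert (HfK : forall x, 0 < x <= lo -> f x <= K' * phi x).
  { intros x Hx. pose proof (Hpp x ltac:(lra)) as Hpx. pose proof (Hpp del Hdel) as Hpd.
    destruct (Rlt_le_dec x del) as [Hxd|Hxd].
    - specialize (Hdl x ltac:(lra)). apply Rabs_def2 in Hdl.
      assert (f x <= (L + 1) * phi x) by (apply Rle_div_iff; lra).
      eapply Rle_trans; [eassumption|]. apply Rmult_le_compat_r; lra.
    - apply Rle_trans with F; [apply HfF; lra|].
      apply Rle_trans with (F / phi del * phi del); [right; field; lra|].
      apply Rmult_le_compat; try lra. now apply Hpl. }
  (* The quotient by [phi] says nothing at 0 itself, where the value of [f] is reached by
     continuity. *)
  assert (HfK0 : forall m, 0 < m <= lo -> f 0 <= K' * phi m).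
  { intros m Hm. apply le_epsilon. intros e He.
    destruct Hf as (Hfc & _ & _). destruct (Hfc 0 (Rle_refl 0) e He) as [r [Hr Hr']].
    set (x := Rmin (r / 2) m). assert (Hx : 0 < x) by (apply Rmin_pos; lra).
    assert (Hx1 : x <= r / 2) by apply Rmin_l. assert (Hx2 : x <= m) by apply Rmin_r.
    specialize (Hr' x ltac:(lra)). rewrite Rminus_0_r, Rabs_pos_eq in Hr' by lra.
    specialize (Hr' ltac:(lra)). apply Rabs_def2 in Hr'.
    specialize (HfK x ltac:(lra)). assert (phi x <= phi m) by now apply Hpl.
    assert (K' * phi x <= K' * phi m) by (apply Rmult_le_compat_l; lra). lra. }
  exists (kap / K'). split; [apply Rdiv_lt_0_compat; lra|]. intros lam Hlam.
  destruct (Hinf (K / lam)) as [S HS].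
  (* For [m >= hi] the whole range from [rho * m] on lies beyond [S]. *)
  set (hi := (Rabs S + 1) / rho). pose proof (Rabs_pos S) as HSp. pose proof (Rle_abs S) as HSa.
  assert (Hhi : 0 < hi) by (apply Rdiv_lt_0_compat; lra).
  assert (Hhirho : rho * hi = Rabs S + 1) by (unfold hi; field; lra).
  destruct (Hmain lam lo hi ltac:(lra) Hlo Hhi) as (u & Hu & Hpos & Hlow & Hsup).
  - right. split.
    + intros m Hm x Hx. pose proof (Hpp m ltac:(lra)) as Hpm.
      assert (Hfx : f x <= K' * phi m).
      { destruct (Req_dec x 0) as [->|Hne]; [now apply HfK0|].
        apply Rle_trans with (K' * phi x); [apply HfK; lra|].
        apply Rmult_le_compat_l; [lra|]. apply Hpl. lra. }
      assert (HlK : lam * K' <= kap) by (apply Rdiv_le_iff; lra).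
      apply Rle_trans with (lam * (K' * phi m)); [apply Rmult_le_compat_l; lra|].
      rewrite <- Rmult_assoc. apply Rmult_le_compat_r; lra.
    + intros m Hm x Hx. assert (Hx0 : Rabs S + 1 <= x) by nra.
      specialize (HS x ltac:(lra)). pose proof (Hpp x ltac:(lra)) as Hpx.
      assert (K / lam * phi x <= f x) by (apply Rdiv_le_iff; lra).
      replace (K * phi x) with (lam * (K / lam * phi x)) by (field; lra).
      apply Rmult_le_compat_l; lra.
  - exists u. split; [exact Hu|]. split; [exact Hpos|].
    assert (HMs : Rabs M + 1 <= sup_norm u).
    { apply Rmult_le_reg_l with C; [exact HC|exact Hlow]. }
    pose proof (Rle_abs M). lra.
Qed.

End Existence.

(** * Selection of one family of solutions from the norm-wise existence results *)

Theorem theorem3p7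
  (phi psi1 psi2 c d f h : R -> R)
  (Hphi : odd_inc_homeo phi)
  (HA : condA phi psi1 psi2)
  (Hc : cont_on_closed c 0 1) (Hcpos : forall t, 0 <= t <= 1 -> 0 < c t)
  (Hd : cont_on_closed d 0 1) (Hdpos : forall t, 0 <= t <= 1 -> 0 < d t)
  (Hf : f_ok f)
  (Hh : h_ok psi1 h) :
  (* (a) *)
  ((lim0_infty f phi /\ (exists L, 0 < L /\ liminf_finite f phi L)) ->
   exists lam_star, 0 < lam_star /\
   exists m_star : option R,  (* None stands for +oo *)
     (forall m, m_star = Some m -> 0 < m) /\
     (exists U : R -> R -> R,
        (forall lam, 0 < lam < lam_star ->
           is_pos_solution phi c d h f lam (U lam) /\
           0 < sup_norm (U lam) /\
           (forall m, m_star = Some m -> sup_norm (U lam) < m)) /\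
        (forall eps, 0 < eps -> exists del, 0 < del /\
           forall lam, 0 < lam < del -> lam < lam_star ->
             sup_norm (U lam) < eps)) /\
     (forall m, m_star = Some m ->
        exists u, is_pos_solution phi c d h f lam_star u)) /\
  (* (b) *)
  (((exists L, 0 < L /\ lim0_finite f phi L) /\ liminf_infty f phi) ->
   exists lam_star, 0 < lam_star /\
   exists m_star, 0 <= m_star /\
     (exists U : R -> R -> R,
        (forall lam, 0 < lam < lam_star ->
           is_pos_solution phi c d h f lam (U lam) /\
           m_star < sup_norm (U lam)) /\
        (forall M, exists del, 0 < del /\
           forall lam, 0 < lam < del -> lam < lam_star ->
             M < sup_norm (U lam))) /\
     (0 < m_star -> exists u, is_pos_solution phi c d h f lam_star u)).
Proof.
  set (good := fun lam u => is_pos_solution phi c d h f lam u /\ 0 < sup_norm u).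
  split.
  - intros [H0 [L [_ Hinf]]].
    pose proof (small_solutions phi psi1 psi2 c d f h Hphi HA Hc Hcpos Hd Hdpos Hf Hh L H0 Hinf)
      as Hsol.
    destruct (Hsol 1 Rlt_0_1) as [ls [Hls Hls']].
    exists ls. split; [exact Hls|]. exists None. split; [discriminate|].
    split; [|discriminate].
    (* The solution with norm at most [eps] depends on [eps], the family must not. An almost minimal
       norm with tolerance [lam] is at most [lam] above that of every such solution. *)
    assert (HU : forall lam, exists u, 0 < lam < ls ->
      good lam u /\ forall v, good lam v -> sup_norm u <= sup_norm v + lam).
    { intros lam. destruct (classic (0 < lam < ls)) as [Hlam|Hlam]; [|now exists (fun _ => 0)].
      destruct (almost_minimizer (good lam) sup_norm 0 lam) as [u Hu].
      - destruct (Hls' lam Hlam) as (u & Hu & Hp & _). now exists u.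
      - intros u [_ Hp]. lra.
      - lra.
      - now exists u. }
    destruct (choice_fun _ HU) as [U HU'].
    exists U. split.
    + intros lam Hlam. destruct (HU' lam Hlam) as [[H1 H2] _].
      split; [exact H1|]. split; [exact H2|discriminate].
    + intros eps Heps. destruct (Hsol (eps / 2) ltac:(lra)) as [l2 [Hl2 Hl2']].
      exists (Rmin l2 (eps / 2)). split; [apply Rmin_pos; lra|]. intros lam Hlam Hlam'.
      pose proof (Rmin_l l2 (eps / 2)). pose proof (Rmin_r l2 (eps / 2)).
      destruct (Hl2' lam ltac:(lra)) as (v & Hv & Hp & Hle).
      destruct (HU' lam ltac:(lra)) as [_ Hmin]. specialize (Hmin v (conj Hv Hp)). lra.
  - intros [[L [_ H0]] Hinf].
    pose proof (large_solutions phi psi1 psi2 c d f h Hphi HA Hc Hcpos Hd Hdpos Hf Hh L H0 Hinf)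
      as Hsol.
    destruct (Hsol 0) as [ls [Hls Hls']].
    exists ls. split; [exact Hls|]. exists 0. split; [lra|].
    split; [|intros Hbad; exfalso; lra].
    (* The norms may be unbounded for a given [lam]: truncate at [1 / lam] before maximizing. *)
    assert (HU : forall lam, exists u, 0 < lam < ls -> good lam u /\
      forall v, good lam v -> - Rmin (sup_norm u) (/ lam) <= - Rmin (sup_norm v) (/ lam) + 1).
    { intros lam. destruct (classic (0 < lam < ls)) as [Hlam|Hlam]; [|now exists (fun _ => 0)].
      destruct (almost_minimizer (good lam) (fun u => - Rmin (sup_norm u) (/ lam)) (- / lam) 1)
        as [u Hu].
      - destruct (Hls' lam Hlam) as (u & Hu & Hp & _). now exists u.
      - intros u _. apply Ropp_le_contravar, Rmin_r.
      - lra.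
      - now exists u. }
    destruct (choice_fun _ HU) as [U HU'].
    exists U. split.
    + intros lam Hlam. apply (HU' lam Hlam).
    + intros M. destruct (Hsol (Rabs M + 1)) as [l2 [Hl2 Hl2']].
      pose proof (Rabs_pos M) as HMp. pose proof (Rle_abs M) as HMa.
      assert (HiM : 0 < / (Rabs M + 2)) by (apply Rinv_0_lt_compat; lra).
      exists (Rmin l2 (/ (Rabs M + 2))). split; [now apply Rmin_pos|]. intros lam Hlam Hlam'.
      pose proof (Rmin_l l2 (/ (Rabs M + 2))). pose proof (Rmin_r l2 (/ (Rabs M + 2))).
      destruct (Hl2' lam ltac:(lra)) as (v & Hv & Hp & Hle).
      destruct (HU' lam ltac:(lra)) as [_ Hmin]. specialize (Hmin v (conj Hv Hp)).
      (* For such [lam] the truncation leaves the value of [v] above [Rabs M + 1], and the tolerance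
         1 still leaves more than [M]. *)
      assert (Hil : Rabs M + 2 < / lam).
      { rewrite <- (Rinv_inv (Rabs M + 2)). apply Rinv_lt_contravar; [|lra].
        apply Rmult_lt_0_compat; lra. }
      pose proof (Rmin_l (sup_norm (U lam)) (/ lam)) as Hm1.
      assert (Hm2 : Rabs M + 1 < Rmin (sup_norm v) (/ lam)) by (apply Rmin_glb_lt; lra).
      lra.
Qed.
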